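(* Let $X=(X_n)$ and $Y=(Y_n)$ be sequences of independent $\mathbb R^{d_*}$-valued random vectors such that $Z(X)$ and $Z(Y)$ satisfy: (i) for every $p\ge1$ there is $M_p$ with $\|Z_{n,i}(X)\|_p,\|Z_{n,i}(Y)\|_p\le M_p$ for all $n,i$; (ii) there is $\underline\lambda\in(0,1]$ with $\mathrm{Cov}(Z_n(X))\ge\underline\lambda I$ and $\mathrm{Cov}(Z_n(Y))\ge\underline\lambda I$ for all $n$. Let $c,d$ be finitely supported real coefficient families vanishing for $|\alpha|>N$, with $|c|_N>0$, $|d|_N>0$, $\delta_*(c)\le1$, $\delta_*(d)\le1$. Then for every $k\in\mathbb N$ and $\theta\in((1+k)^{-2},1)$ there exists $C>0$, depending on $N,k,k_*,d_*,\theta$, suitable moments of $X,Y$ and $\underline\lambda$, such that $$\begin{aligned}d_{Kol}(Q_{N,k_*}(c,X),Q_{N,k_*}(d,Y))\le\;& C(1+|c|_N^{-2N}+|d|_N^{-2N})(1+|c|+|d|)^{5(k\vee3)+1}\\&\times\Big(\delta_*(c)^{\frac{\theta}{2(k\vee3)N+1}}+\delta_*(d)^{\frac{\theta}{2(k\vee3)N+1}}+d_{k\vee3}(Q_{N,k_*}(c,X),Q_{N,k_*}(d,Y))^{\frac{\theta}{2(k\vee3)N+1}}\Big).\end{aligned}$$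
   Context: Let $m_*=d_*k_*$. Multi-indices: $\alpha=(\alpha_1,\dots,\alpha_m)$, $\alpha_i=(\alpha_i',\alpha_i'')\in\mathbb N\times[m_*]$, $\alpha_1'<\dots<\alpha_m'$, $|\alpha|=m$, including $\emptyset$; $x^\alpha=\prod_i x_{\alpha_i',\alpha_i''}$, $x^\emptyset=1$. $Z_{n,kd_*+j}(X)=X_{n,j}^{k+1}-\mathbb E(X_{n,j}^{k+1})$ for $j\in[d_*]$, $k\in\{0,\dots,k_*-1\}$; $Q_{N,k_*}(c,X)=\sum_{0\le|\alpha|\le N}c(\alpha)Z^\alpha(X)$. $|c|_m^2=\sum_{|\alpha|=m}c(\alpha)^2$, $|c|^2=\sum_{|\alpha|\le N}c(\alpha)^2$, $\delta_*(c)^2=\sup_n\sum_{\alpha:\,n\in\{\alpha'_i\}}c(\alpha)^2$. $d_{Kol}(F,G)=\sup_x|\mathbb P(F\le x)-\mathbb P(G\le x)|$; $d_k(F,G)=\sup\{|\mathbb Ef(F)-\mathbb Ef(G)|:\|f\|_{k,\infty}\le1\}$ with $\|f\|_{k,\infty}$ the sup norm of $f$ and its derivatives up to order $k$. *)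

(* Defs.v *)
From HB Require Import structures.
From mathcomp Require Import all_boot all_order all_algebra.
From mathcomp Require Import all_classical all_reals all_analysis.
Set Implicit Arguments. Unset Strict Implicit. Unset Printing Implicit Defensive.
Import Order.TTheory GRing.Theory Num.Theory.
Import numFieldNormedType.Exports.
Local Open Scope classical_set_scope.
Local Open Scope ring_scope.

Section defs.
Context (R : realType) (d : measure_display) (T : measurableType d)
  (P : probability T R).

Definition random_vectors (dstar : nat) (X : nat -> 'I_dstar -> T -> R) :=
  forall n j, measurable_fun setT (X n j).

Definition sigma_vec (dstar : nat) (X : nat -> 'I_dstar -> T -> R) (n : nat)
  : set (set T) :=
  <<s [set A | exists j (B : set R), measurable B /\ A = X n j @^-1` B] >>.

Definition independent_seq (dstar : nat) (X : nat -> 'I_dstar -> T -> R) :=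
  forall (s : seq nat) (A : nat -> set T), uniq s ->
    (forall n, n \in s -> sigma_vec X n (A n)) ->
    P (\big[setI/setT]_(n <- s) A n) = (\prod_(n <- s) P (A n))%E.

(* Z_{n, k dstar + j}(X) = X_{n,j}^{k+1} - E(X_{n,j}^{k+1}),
   index i : 'I_(dstar*kstar) (0-based), j = i mod dstar, k = i div dstar *)
Definition Zc (dstar kstar : nat) (X : nat -> 'I_dstar -> T -> R)
  (n : nat) (i : 'I_(dstar * kstar)) : T -> R :=
  match dstar as m return (nat -> 'I_m -> T -> R) -> T -> R with
  | 0 => fun _ _ => 0
  | m.+1 => fun X' => let j : 'I_m.+1 := inord (i %% m.+1) in
              let k := (i %/ m.+1)%N in
              fun w => X' n j w ^+ k.+1 - fine ('E_P[fun w' => X' n j w' ^+ k.+1])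
  end X.

Definition covZ (dstar kstar : nat) (X : nat -> 'I_dstar -> T -> R) (n : nat)
  : 'M[R]_(dstar * kstar) :=
  \matrix_(i, j) fine (covariance P (Zc X n i) (Zc X n j)).

(* Multi-index alpha = (alpha_1,...,alpha_m), alpha_i = (alpha_i', alpha_i'')
   with alpha_1' < ... < alpha_m' ; |alpha| = size alpha. *)
Definition multi_index (mstar : nat) (a : seq (nat * 'I_mstar)) : Prop :=
  sorted ltn [seq x.1 | x <- a].

Definition Zpow (dstar kstar : nat) (X : nat -> 'I_dstar -> T -> R)
  (a : seq (nat * 'I_(dstar * kstar))) : T -> R :=
  fun w => \prod_(x <- a) Zc X x.1 x.2 w.

Definition Q (dstar kstar N : nat) (c : seq (nat * 'I_(dstar * kstar)) -> R)
  (X : nat -> 'I_dstar -> T -> R) : T -> R :=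
  fun w => (\sum_(a \in [set a | multi_index a /\ (size a <= N)%N])
              c a * Zpow X a w)%R.

Definition dKol (F G : T -> R) : R :=
  sup [set `|fine (P [set w | F w <= x]) - fine (P [set w | G w <= x])|
       | x in [set: R]].

Definition Ck_unit_ball (k : nat) (f : R -> R) : Prop :=
  (forall j, (j < k)%N -> forall x, derivable (derive1n j f) x 1) /\
  continuous (derive1n k f) /\
  (forall j, (j <= k)%N -> forall x, `|derive1n j f x| <= 1).

Definition dk (k : nat) (F G : T -> R) : R :=
  sup [set `|fine ('E_P[f \o F]) - fine ('E_P[f \o G])|
       | f in Ck_unit_ball k].

End defs.

Section coefnorms.
Context (R : realType) (mstar : nat).
Implicit Types c : seq (nat * 'I_mstar) -> R.

Definition finitely_supported c : Prop :=
  finite_set [set a | multi_index a /\ c a != 0].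

Definition vanish_above (N : nat) c : Prop :=
  forall a, multi_index a -> (N < size a)%N -> c a = 0.

Definition cnorm_deg (m : nat) c : R :=
  Num.sqrt (\sum_(a \in [set a | multi_index a /\ size a = m]) c a ^+ 2).

Definition cnorm (N : nat) c : R :=
  Num.sqrt (\sum_(a \in [set a | multi_index a /\ (size a <= N)%N]) c a ^+ 2).

Definition delta_star c : R :=
  Num.sqrt (sup [set (\sum_(a \in [set a | multi_index a /\
                                   n \in [seq x.1 | x <- a]]) c a ^+ 2)
                 | n in [set: nat]]).
End coefnorms.

Definition loewner_ge (R : realType) (m : nat) (A B : 'M[R]_m) : Prop :=
  forall v : 'rV[R]_m, 0 <= (v *m (A - B) *m v^T) 0 0.

(* Main.v *)
(** Smoothing the indicator of a half-line at scale [h] bounds the Kolmogorov distance by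
    [sup_x P(|G - x| <= h) + C h^-K d_K(F, G)], where [G] is one of the two chaoses only,
    so everything rests on an anticoncentration bound [P(|G - x| <= h) <= C h^(theta/(2N))].

    That bound is proved without Gaussian comparison.  Let [Z1], [Z2] be independent copies of
    the centred powers and [Zu = ((1 - u^2) Z1 + 2 u Z2)/(1 + u^2)].  Since [Zu] has the mean and
    covariance of [Z1], Lindeberg's exchange gives [p(h) := P(|G(Z1) - x| <= h)
    <= P(|G(Zu) - x| <= 2h) + O(h^-3 delta)] for every [u].  Pathwise, [(1 + u^2)^N (G(Zu) - x)]
    is a polynomial of degree [2N] in [u]; if it is small at many points of a grid of [u],
    Lagrange interpolation makes it small at [u = 0] and [u = 1], i.e. both [G(Z1)] and [G(Z2)]
    are near [x], which has probability [p^2].  Averaging over [u] yields a recursion bounding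
    [p(h)] by squares of [p] at larger scales plus a term linear in the grid density.  Started
    from [p < 1] at unit scale (Paley-Zygmund and hypercontractivity), it forces the decay
    [h^(theta/(2N))] for every [theta < 1]. *)

Require Import Defs.
From HB Require Import structures.
From mathcomp Require Import all_boot all_order all_algebra.
From mathcomp Require Import all_classical all_reals all_analysis.
From mathcomp Require Import measurable_realfun ring lra zify.
Set Implicit Arguments. Unset Strict Implicit. Unset Printing Implicit Defensive.
Import Order.TTheory GRing.Theory Num.Theory.
Import numFieldNormedType.Exports.
Local Open Scope classical_set_scope.
Local Open Scope ring_scope.

(** The obstacle is the exponent. When only a fraction 2^-i of the angles is good, interpolating a
    polynomial of degree 2N costs a factor 4^(N i), so the weight 2^-i meets a scale enlarged by
    4^(N i). The balance is h^(1/(2N)), and the resulting geometric series has ratio 2^(theta - 1),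
    which explains theta < 1. Two forms of the recursion are used. The one-scale form contracts by
    q0 < 1 and drives p to 0, without a rate but uniformly over all data. Once p is below a small
    constant e, p^2 <= e p makes the multi-scale form linear with a small factor, and a power bound
    reproduces itself. The exchange error delta / h^3 is of order h^(1/(2N)) only while delta <=
    h^(3 + 1/(2N)), so the recursion stops at that scale. The final choice h^(K + 1/(2N)) = D, with
    K >= 3 and D >= delta, respects this and gives the exponent theta / (2KN + 1). Constants may
    depend neither on the probability space nor on the coefficients; the latter enter through a
    normalised starting scale, whose negative power becomes the prefactor. *)

(** * Real-valued expectations and fourth moments *)

Section real_expectation.
Context (d : measure_display) (T : measurableType d) (R : realType)
  (P : probability T R).
Implicit Types f g : T -> R.

Definition ig (f : T -> R) := P.-integrable setT (EFin \o f).
Definition Er (f : T -> R) := Rintegral P setT f.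

Lemma ig_measurable f : ig f -> measurable_fun setT f.
Proof. by move=> /measurable_int /measurable_EFinP. Qed.

Lemma ig_cst (c : R) : ig (fun=> c).
Proof. exact: finite_measure_integrable_cst. Qed.

Lemma igD f g : ig f -> ig g -> ig (fun w => f w + g w).
Proof. by move=> hf hg; rewrite /ig; exact: integrableD hf hg. Qed.

Lemma igZ c f : ig f -> ig (fun w => c * f w).
Proof.
move=> hf; rewrite /ig (_ : EFin \o _ = (fun w => c%:E * (EFin \o f) w)%E) //.
exact: integrableZl.
Qed.

Lemma igN f : ig f -> ig (fun w => - f w).
Proof. by move=> hf; rewrite /ig; exact: integrableN hf. Qed.

Lemma igB f g : ig f -> ig g -> ig (fun w => f w - g w).
Proof. by move=> hf hg; apply: igD => //; exact: igN. Qed.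

Lemma ig_sum (I : Type) (s : seq I) (F : I -> T -> R) :
  (forall i, ig (F i)) -> ig (fun w => \sum_(i <- s) F i w).
Proof.
move=> hF; elim: s => [|i s IH].
  by under eq_fun do rewrite big_nil; exact: ig_cst.
under eq_fun do rewrite big_cons; exact: igD.
Qed.

Lemma ig_le f g : measurable_fun setT f -> (forall w, `|f w| <= g w) -> ig g ->
  ig f.
Proof.
move=> mf fg hg; apply: le_integrable hg => //; first exact/measurable_EFinP.
by move=> w _ /=; rewrite lee_fin (le_trans (fg w))// ler_norm.
Qed.

Lemma ErD f g : ig f -> ig g -> Er (fun w => f w + g w) = Er f + Er g.
Proof. by move=> hf hg; rewrite /Er RintegralD. Qed.

Lemma ErB f g : ig f -> ig g -> Er (fun w => f w - g w) = Er f - Er g.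
Proof. by move=> hf hg; rewrite /Er RintegralB. Qed.

Lemma ErZ c f : ig f -> Er (fun w => c * f w) = c * Er f.
Proof. by move=> hf; rewrite /Er RintegralZl. Qed.

Lemma Er_cst c : Er (fun=> c) = c.
Proof. rewrite /Er Rintegral_cst//; have /= -> := @probability_setT _ _ _ P; exact: mulr1. Qed.

Lemma Er_sum (I : Type) (s : seq I) (F : I -> T -> R) :
  (forall i, ig (F i)) ->
  Er (fun w => \sum_(i <- s) F i w) = \sum_(i <- s) Er (F i).
Proof.
move=> hF; elim: s => [|i s IH].
  rewrite big_nil -[RHS](Er_cst 0); congr Er.
  by apply/funext => w; rewrite big_nil.
rewrite big_cons -IH -ErD//; last exact: ig_sum.
by congr Er; apply/funext => w; rewrite big_cons.
Qed.

Lemma Er_le f g : ig f -> ig g -> (forall w, f w <= g w) -> Er f <= Er g.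
Proof. by move=> hf hg fg; rewrite /Er le_Rintegral. Qed.

Lemma Er_ge0 f : (forall w, 0 <= f w) -> 0 <= Er f.
Proof. by move=> f0; rewrite /Er Rintegral_ge0. Qed.

Lemma Er_norm f : ig f -> `|Er f| <= Er (fun w => `|f w|).
Proof. by move=> hf; rewrite /Er le_normr_Rintegral. Qed.

Lemma ig_norm f : ig f -> ig (fun w => `|f w|).
Proof. by move=> hf; exact: integrable_norm. Qed.

Lemma Er_EFin f : ig f -> (\int[P]_w (f w)%:E = (Er f)%:E)%E.
Proof. by move=> hf; rewrite /Er /Rintegral fineK//; exact: integrable_fin_num hf. Qed.

Lemma ig_indic (A : set T) : measurable A -> ig (\1_A).
Proof. by move=> mA; exact: integrable_indic. Qed.

Definition pr (A : set T) : R := fine (P A).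

Lemma Er_indic (A : set T) : measurable A -> Er (\1_A) = pr A.
Proof. by move=> mA; rewrite /Er /Rintegral integral_indic// setIT. Qed.

Lemma pr_EFin (A : set T) : measurable A -> (P A = (pr A)%:E)%E.
Proof. by move=> mA; rewrite /pr fineK// fin_num_measure. Qed.

Lemma pr_ge0 (A : set T) : 0 <= pr A.
Proof. exact/fine_ge0/measure_ge0. Qed.

Lemma pr_le1 (A : set T) : measurable A -> pr A <= 1.
Proof. by move=> mA; rewrite -lee_fin -pr_EFin// probability_le1. Qed.

Lemma pr_le (A B : set T) : measurable A -> measurable B -> A `<=` B ->
  pr A <= pr B.
Proof.
by move=> mA mB AB; rewrite -lee_fin -!pr_EFin// le_measure// inE.
Qed.

Lemma prU_le (A B : set T) : measurable A -> measurable B ->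
  pr (A `|` B) <= pr A + pr B.
Proof.
move=> mA mB; have mAB : measurable (A `|` B) by exact: measurableU.
rewrite -lee_fin EFinD -!pr_EFin//; exact: measureU2.
Qed.

(** The integrability class of the whole argument: products of up to four such functions are
    integrable, by an elementary inequality in place of Hölder's. *)
Definition L4 (f : T -> R) :=
  measurable_fun setT f /\ ig (fun w => f w ^+ 4).

Lemma L4_cst c : L4 (fun=> c).
Proof. by split; [exact: measurable_cst|exact: ig_cst]. Qed.

Lemma norm_mul4_le (a b c e : R) :
  `|a * b * c * e| <= a ^+ 4 + b ^+ 4 + c ^+ 4 + e ^+ 4.
Proof.
have H (x y : R) : `|x * y| <= x ^+ 2 + y ^+ 2.
  by rewrite ler_norml; nra.
apply: (le_trans (y := (a * b) ^+ 2 + (c * e) ^+ 2)).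
  by rewrite -mulrA; exact: H.
have := sqr_ge0 (a ^+ 2 - b ^+ 2); have := sqr_ge0 (c ^+ 2 - e ^+ 2).
have : 0 <= a ^+ 4 by rewrite exprn_even_ge0.
have : 0 <= b ^+ 4 by rewrite exprn_even_ge0.
have : 0 <= c ^+ 4 by rewrite exprn_even_ge0.
have : 0 <= e ^+ 4 by rewrite exprn_even_ge0.
nra.
Qed.

Lemma ig_mul4 (a b c e : T -> R) : L4 a -> L4 b -> L4 c -> L4 e ->
  ig (fun w => a w * b w * c w * e w).
Proof.
move=> [ma ia] [mb ib] [mc ic] [me ie].
apply: (ig_le (g := fun w => a w ^+ 4 + b w ^+ 4 + c w ^+ 4 + e w ^+ 4)).
- by do 3 (apply: measurable_funM => //).
- by move=> w; exact: norm_mul4_le.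
- by do 3 (apply: igD => //).
Qed.

Lemma ig_mul3 (a b c : T -> R) : L4 a -> L4 b -> L4 c ->
  ig (fun w => a w * b w * c w).
Proof.
move=> ha hb hc; have := ig_mul4 ha hb hc (L4_cst 1).
by under eq_fun do rewrite mulr1.
Qed.

Lemma ig_mul2 (a b : T -> R) : L4 a -> L4 b -> ig (fun w => a w * b w).
Proof.
move=> ha hb; have := ig_mul3 ha hb (L4_cst 1).
by under eq_fun do rewrite mulr1.
Qed.

Lemma L4_ig (a : T -> R) : L4 a -> ig a.
Proof.
move=> ha; have := ig_mul2 ha (L4_cst 1).
by under eq_fun do rewrite mulr1.
Qed.

Lemma exprD4_le (x y : R) : (x + y) ^+ 4 <= 8 * (x ^+ 4 + y ^+ 4).
Proof.
have := sqr_ge0 (x ^+ 2 - y ^+ 2); have := sqr_ge0 (x - y).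
have := sqr_ge0 ((x - y) * (x + y)); have := sqr_ge0 ((x - y) ^+ 2).
nra.
Qed.

Lemma L4D f g : L4 f -> L4 g -> L4 (fun w => f w + g w).
Proof.
move=> [mf hf] [mg hg]; split; first exact: measurable_funD.
apply: (ig_le (g := fun w => 8 * (f w ^+ 4 + g w ^+ 4))).
- by apply: measurable_funX; exact: measurable_funD.
- by move=> w; rewrite ger0_norm ?exprn_even_ge0// exprD4_le.
- by apply: igZ; exact: igD.
Qed.

Lemma L4Z c f : L4 f -> L4 (fun w => c * f w).
Proof.
move=> [mf hf]; split; first exact: measurable_funM.
by under eq_fun do rewrite exprMn; exact: igZ.
Qed.

Lemma L4N f : L4 f -> L4 (fun w => - f w).
Proof. by move=> /(L4Z (-1)); under eq_fun do rewrite mulN1r. Qed.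

Lemma L4B f g : L4 f -> L4 g -> L4 (fun w => f w - g w).
Proof. by move=> hf hg; apply: L4D => //; exact: L4N. Qed.

Lemma L4_sum (I : Type) (s : seq I) (F : I -> T -> R) :
  (forall i, L4 (F i)) -> L4 (fun w => \sum_(i <- s) F i w).
Proof.
move=> hF; elim: s => [|i s IH].
  by under eq_fun do rewrite big_nil; exact: L4_cst.
under eq_fun do rewrite big_cons; exact: L4D.
Qed.

(* [2 U V <= t U^2 + V^2 / t], optimised over t *)
Lemma Er_cauchy_schwarz (f g : T -> R) (a b : R) : L4 f -> L4 g ->
  0 <= a -> 0 <= b ->
  Er (fun w => f w ^+ 4) <= a ^+ 2 -> Er (fun w => g w ^+ 4) <= b ^+ 2 ->
  Er (fun w => f w ^+ 2 * g w ^+ 2) <= a * b.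
Proof.
move=> hf hg a0 b0 ha hb.
(* Enlarging [a] and [b] by [e] keeps the optimal ratio [t] finite and positive when one of them
   vanishes; [e] then tends to 0. *)
have K (e : R) : 0 < e -> Er (fun w => f w ^+ 2 * g w ^+ 2) <= (a + e) * (b + e).
  move=> e0; have ae : 0 < a + e by lra.
  have be : 0 < b + e by lra.
  pose t := (b + e) / (a + e).
  have t0 : 0 < t by rewrite divr_gt0.
  have hle : Er (fun w => f w ^+ 2 * g w ^+ 2) <=
      Er (fun w => t / 2 * f w ^+ 4 + t^-1 / 2 * g w ^+ 4).
    apply: Er_le.
    - have := ig_mul4 hf hf hg hg.
      by under eq_fun do rewrite -mulrA -!expr2.
    - by apply: igD; apply: igZ; [case: hf|case: hg].
    - move=> w; rewrite -(ler_pM2l (x := 2 * t)); last by rewrite mulr_gt0.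
      have := sqr_ge0 (t * f w ^+ 2 - g w ^+ 2).
      have -> : 2 * t * (t / 2 * f w ^+ 4 + t^-1 / 2 * g w ^+ 4) =
         t ^+ 2 * f w ^+ 4 + g w ^+ 4 by field; rewrite gt_eqF.
      nra.
  apply: (le_trans hle).
  rewrite ErD; [|by apply: igZ; case: hf|by apply: igZ; case: hg].
  rewrite !ErZ; [|by case: hg|by case: hf].
  have h1 : Er (fun w => f w ^+ 4) <= (a + e) ^+ 2.
    by apply: (le_trans ha); rewrite ler_sqr ?nnegrE; lra.
  have h2 : Er (fun w => g w ^+ 4) <= (b + e) ^+ 2.
    by apply: (le_trans hb); rewrite ler_sqr ?nnegrE; lra.
  have -> : (a + e) * (b + e) = t / 2 * (a + e) ^+ 2 + t^-1 / 2 * (b + e) ^+ 2.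
    by rewrite /t; field; rewrite !gt_eqF.
  by apply: lerD; apply: ler_wpM2l => //; rewrite divr_ge0// ?invr_ge0 ltW.
apply/ler_addgt0Pr => e e0.
pose s := Num.min 1 (e / (a + b + 1)).
have ab1 : 0 < a + b + 1 by lra.
have s0 : 0 < s by rewrite /s lt_min ltr01 divr_gt0.
have s1 : s <= 1 by rewrite /s ge_min lexx.
have se : s * (a + b + 1) <= e by rewrite -ler_pdivlMr// /s ge_min lexx orbT.
apply: (le_trans (K s s0)); nra.
Qed.

End real_expectation.

(** * Independence through pi-systems *)

Section product_expectation.
Context (d1 d2 : measure_display) (T1 : measurableType d1)
  (T2 : measurableType d2) (R : realType)
  (P1 : probability T1 R) (P2 : probability T2 R).

Definition Pprod : probability (T1 * T2)%type R := (P1 \x P2)%E.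

Lemma ig_prod (f : T1 -> R) (g : T2 -> R) : ig P1 f -> ig P2 g ->
  ig Pprod (fun z => f z.1 * g z.2).
Proof.
move=> hf hg.
have mf : measurable_fun setT (fun z : T1 * T2 => f z.1).
  by apply: measurableT_comp => //; exact: ig_measurable hf.
have mg : measurable_fun setT (fun z : T1 * T2 => g z.2).
  by apply: measurableT_comp => //; exact: ig_measurable hg.
apply/integrable12ltyP => /=.
  by apply/measurable_EFinP; exact: measurable_funM.
under eq_integral => x _.
  under eq_integral => y _ do rewrite normrM EFinM.
  rewrite ge0_integralZl//=; last first.
    by apply/measurable_EFinP; apply: measurableT_comp => //; exact: ig_measurable hg.
  rewrite (Er_EFin (ig_norm hg)) muleC.
  over.
rewrite ge0_integralZl//=; [| |by rewrite lee_fin; exact: Er_ge0]; last first.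
  by apply/measurable_EFinP; apply: measurableT_comp => //; exact: ig_measurable hf.
by rewrite (Er_EFin (ig_norm hf)) ltry.
Qed.

Lemma Er_prod (f : T1 -> R) (g : T2 -> R) : ig P1 f -> ig P2 g ->
  Er Pprod (fun z => f z.1 * g z.2) = Er P1 f * Er P2 g.
Proof.
move=> hf hg; apply: EFin_inj; rewrite -Er_EFin; last exact: ig_prod.
rewrite -[LHS](integral12_prod_meas1 (ig_prod hf hg)) /fubini_F/=.
under eq_integral => x _.
  under eq_integral => y _ do rewrite EFinM.
  rewrite integralZl//= (Er_EFin hg) muleC.
  over.
by rewrite integralZl//= (Er_EFin hf) -EFinM mulrC.
Qed.

End product_expectation.

Section independent_pair.
Context (d : measure_display) (T : measurableType d) (R : realType)
  (P : probability T R).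

Definition indep_fun (U V : T -> R) := forall A B : set R,
  measurable A -> measurable B ->
  pr P (U @^-1` A `&` V @^-1` B) = pr P (U @^-1` A) * pr P (V @^-1` B).

Lemma measurable_preimage (U : T -> R) (A : set R) :
  measurable_fun setT U -> measurable A -> measurable (U @^-1` A).
Proof. by move=> mU mA; rewrite -[X in measurable X]setTI; exact: mU. Qed.

Lemma ig_distribution (X : {RV P >-> R}) : ig P X ->
  ig (distribution P X : probability _ R) (fun x => x).
Proof.
move=> /integrableP[_ hX]; apply/integrableP; split.
  by apply/measurable_EFinP; exact: measurable_id.
have mn : measurable_fun [set: R] (fun z : R => `|z|%:E).
  by apply/measurable_EFinP; exact: normr_measurable.
have := ge0_integral_distribution X mn (fun z => normr_ge0 z).
by rewrite /comp/= => ->.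
Qed.

(** The joint law of [(U, V)] agrees with the product of the marginal laws on rectangles, hence
    everywhere, and Fubini applies to the product of the two coordinates. *)
Lemma indep_fun_Er (U V : T -> R) : ig P U -> ig P V -> indep_fun U V ->
  ig P (fun w => U w * V w) /\ Er P (fun w => U w * V w) = Er P U * Er P V.
Proof.
move=> hU hV UV.
have mU := ig_measurable hU; have mV := ig_measurable hV.
pose X : {RV P >-> R} := HB.pack U (isMeasurableFun.Build _ _ _ _ _ mU).
pose Y : {RV P >-> R} := HB.pack V (isMeasurableFun.Build _ _ _ _ _ mV).
have mXY : measurable_fun setT (fun w => (U w, V w)) by exact: measurable_fun_pair.
pose XY : {RV P >-> (R * R)%type} :=
  HB.pack (fun w => (U w, V w)) (isMeasurableFun.Build _ _ _ _ _ mXY).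
pose PX := distribution P X; pose PY := distribution P Y.
have law (A : set (R * R)) : measurable A ->
    (PX \x PY)%E A = distribution P XY A.
  apply: product_measure_unique => A' B' mA mB.
  have mUA : measurable (U @^-1` A') by exact: measurable_preimage.
  have mVB : measurable (V @^-1` B') by exact: measurable_preimage.
  have mI : measurable (U @^-1` A' `&` V @^-1` B') by exact: measurableI.
  have E : P (U @^-1` A' `&` V @^-1` B') = (P (U @^-1` A') * P (V @^-1` B'))%E.
    by rewrite (pr_EFin _ mI) (pr_EFin _ mUA) (pr_EFin _ mVB) UV// EFinM.
  exact: E.
have idX : ig (PX : probability _ R) (fun x => x) by exact: (ig_distribution (X := X)).
have idY : ig (PY : probability _ R) (fun x => x) by exact: (ig_distribution (X := Y)).
have hprod := ig_prod idX idY; have eprod := Er_prod idX idY.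
have mm : measurable_fun setT (fun z : R * R => z.1 * z.2) by exact: measurable_funM.
have intXY : ig P (fun w => U w * V w).
  apply/integrableP; split; first by apply/measurable_EFinP; exact: measurable_funM.
  have := @ge0_integral_distribution _ _ _ _ _ P XY (fun z => `|z.1 * z.2|%:E)%E.
  rewrite /comp/= => <-//; last by apply/measurable_EFinP; exact: measurableT_comp.
  rewrite (_ : (\int[_]_y _)%E = (\int[(PX \x PY)%E]_y `|y.1 * y.2|%:E)%E).
    by have /integrableP[] := hprod.
  by apply: eq_measure_integral => A mA _; exact: esym (law A mA).
split => //; apply: EFin_inj; rewrite -Er_EFin//.
have EX : Er P U = Er (PX : probability _ R) (fun x => x).
  by rewrite /Er /Rintegral; congr fine; symmetry; apply: integral_distribution.
have EY : Er P V = Er (PY : probability _ R) (fun x => x).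
  by rewrite /Er /Rintegral; congr fine; symmetry; apply: integral_distribution.
rewrite EX EY -eprod -Er_EFin//.
have := @integral_distribution _ _ _ _ _ P XY (fun z => (z.1 * z.2)%:E).
rewrite /comp/= => <-//; last by apply/measurable_EFinP.
by apply: eq_measure_integral => A mA _; exact: esym (law A mA).
Qed.

End independent_pair.

Section pi_family.
Context (d : measure_display) (T : measurableType d) (R : realType)
  (P : probability T R) (Pi : nat -> set (set T)) (L : nat).

(** The product formula is asked over all [L] blocks at once; since [setT] lies in every [Pi k], it
    covers sub-families. The abstract form serves both the original space and the product space
    carrying two copies. *)
Definition pi_family := [/\ forall k, Pi k setT, forall k, setI_closed (Pi k),
  forall k, Pi k `<=` measurable &
  forall A : nat -> set T, (forall k, Pi k (A k)) ->
    pr P (\big[setI/setT]_(k < L) A k) = \prod_(k < L) pr P (A k)].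

Definition cylinders (s : pred nat) : set (set T) :=
  [set \big[setI/setT]_(k < L) A k | A in
    [set A : nat -> set T | (forall k, Pi k (A k)) /\
                            (forall k, ~~ s k -> A k = setT)]].

(** Measurability with respect to the blocks selected by [s]; disjoint selections give independent
    functions. *)
Definition mbs (s : pred nat) (f : T -> R) :=
  forall B : set R, measurable B -> <<s cylinders s >> (f @^-1` B).

Hypothesis HPi : pi_family.

Lemma cylinders_measurable s : cylinders s `<=` measurable.
Proof.
case: HPi => _ _ mPi _ _ [A [PiA _] <-].
by apply: bigsetI_measurable => k _; exact/mPi/PiA.
Qed.

Lemma setI_closed_cylinders s : setI_closed (cylinders s).
Proof.
case: HPi => _ IPi _ _ _ _ [A [PiA AT] <-] [B [PiB BT] <-].
exists (fun k => A k `&` B k); last by rewrite big_split.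
by split=> k => [|sk]; [exact: IPi|rewrite AT// BT// setTI].
Qed.

Lemma cylindersT s : cylinders s setT.
Proof.
case: HPi => PiT _ _ _; exists (fun=> setT); last by rewrite big1.
by split.
Qed.

Lemma sigma_cylinders_measurable s : <<s cylinders s >> `<=` measurable.
Proof.
apply: smallest_sub; last exact: cylinders_measurable.
exact: sigma_algebra_measurable.
Qed.

Lemma cylinders_indep (s s' : pred nat) (A B : set T) :
  (forall k, s k -> ~~ s' k) -> cylinders s A -> cylinders s' B ->
  pr P (A `&` B) = pr P A * pr P B.
Proof.
move=> ss'; case: HPi => PiT IPi _ PPi [A' [PiA AT] <-] [B' [PiB BT] <-].
rewrite -big_split/= (PPi (fun k => A' k `&` B' k)); last by move=> k; exact: IPi.
rewrite !PPi// -big_split/=; apply: eq_bigr => k _.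
have prT : pr P setT = 1 by rewrite /pr; have /= -> := @probability_setT _ _ _ P.
have [sk|sk] := boolP (s k); first by rewrite BT ?ss'// setIT prT mulr1.
by rewrite AT// setTI prT mul1r.
Qed.

(** The finite measures P(A and .) and P(A) P(.) agree on the pi-system [G], hence on the
    sigma-algebra it generates. [mbs_indep] applies this once on each side. *)
Lemma sigma_indep1 (A : set T) (G : set (set T)) : measurable A ->
  G `<=` measurable -> setI_closed G -> G setT ->
  (forall B, G B -> pr P (A `&` B) = pr P A * pr P B) ->
  forall B, <<s G >> B -> pr P (A `&` B) = pr P A * pr P B.
Proof.
move=> mA mG IG GT H B sB.
have sGm : <<s G >> `<=` measurable.
  by apply: smallest_sub => //; exact: sigma_algebra_measurable.
pose r : {nonneg R} := NngNum (pr_ge0 P A).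
have E : (mrestr P mA B = mscale r P B)%E.
  apply: (g_sigma_algebra_measure_unique G mG (fun=> setT)) => //.
  - by rewrite bigcup_const.
  - move=> C GC; change (P (C `&` A) = (pr P A)%:E * P C)%E.
    have mC := mG _ GC; have mCA : measurable (C `&` A) by exact: measurableI.
    by rewrite (pr_EFin _ mCA) (pr_EFin _ mC) setIC H// EFinM.
  - by move=> _; rewrite /= /mrestr setTI (pr_EFin _ mA) ltry.
move: E; have mB := sGm _ sB; rewrite /mrestr /mscale/= setIC.
have mAB : measurable (A `&` B) by exact: measurableI.
by rewrite (pr_EFin _ mAB) (pr_EFin _ mB) -EFinM; exact: EFin_inj.
Qed.

Lemma mbs_indep (s s' : pred nat) (U V : T -> R) :
  (forall k, s k -> ~~ s' k) -> mbs s U -> mbs s' V -> indep_fun P U V.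
Proof.
move=> ss' sU sV A B mA mB; rewrite setIC mulrC.
apply: (sigma_indep1 _ (@cylinders_measurable s) (@setI_closed_cylinders s)
  (cylindersT s)) (sU _ mA) => [|C sC].
  apply: (@sigma_cylinders_measurable s'); exact: sV.
rewrite setIC mulrC.
apply: (sigma_indep1 _ (@cylinders_measurable s') (@setI_closed_cylinders s')
  (cylindersT s')) (sV _ mB) => [|D sD].
  exact: cylinders_measurable sC.
exact: cylinders_indep sC sD.
Qed.

Lemma mbsP s f :
  mbs s f <-> @measurable_fun _ _ (g_sigma_algebraType (cylinders s)) R setT f.
Proof.
by split=> [h _ B mB|h B mB]; [rewrite setTI; exact: h|
  rewrite -[X in <<s _ >> X]setTI; exact: h].
Qed.

Lemma mbs_sub (s s' : pred nat) f : (forall k, s k -> s' k) -> mbs s f -> mbs s' f.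
Proof.
move=> ss' h B mB; apply: sub_smallest2r (h B mB).
  exact: smallest_sigma_algebra.
move=> _ [A [PiA AT] <-]; exists A => //; split => // k s'k.
by apply: AT; apply: contra s'k; exact: ss'.
Qed.

Lemma mbs_cst s c : mbs s (fun=> c).
Proof. by apply/mbsP; exact: measurable_cst. Qed.

Lemma mbsD s f g : mbs s f -> mbs s g -> mbs s (fun w => f w + g w).
Proof. by move=> /mbsP hf /mbsP hg; apply/mbsP; exact: measurable_funD. Qed.

Lemma mbsM s f g : mbs s f -> mbs s g -> mbs s (fun w => f w * g w).
Proof. by move=> /mbsP hf /mbsP hg; apply/mbsP; exact: measurable_funM. Qed.

Lemma mbs_comp s (h : R -> R) f : measurable_fun setT h -> mbs s f ->
  mbs s (fun w => h (f w)).
Proof. by move=> mh /mbsP hf; apply/mbsP; exact: measurableT_comp mh hf. Qed.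

Lemma mbs_sum s (I : Type) (r : seq I) (F : I -> T -> R) :
  (forall i, mbs s (F i)) -> mbs s (fun w => \sum_(i <- r) F i w).
Proof.
move=> hF; elim: r => [|i r IH].
  by under eq_fun do rewrite big_nil; exact: mbs_cst.
by under eq_fun do rewrite big_cons; exact: mbsD.
Qed.

Lemma mbs_prod s (I : eqType) (r : seq I) (F : I -> T -> R) :
  (forall i, i \in r -> mbs s (F i)) -> mbs s (fun w => \prod_(i <- r) F i w).
Proof.
elim: r => [|i r IH] hF.
  by under eq_fun do rewrite big_nil; exact: mbs_cst.
under eq_fun do rewrite big_cons; apply: mbsM; first by apply: hF; rewrite mem_head.
by apply: IH => j jr; apply: hF; rewrite inE jr orbT.
Qed.

Lemma mbs_base k f : (k < L)%N -> (forall B : set R, measurable B -> Pi k (f @^-1` B)) ->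
  mbs (pred1 k) f.
Proof.
move=> kL h B mB; apply: sub_sigma_algebra.
exists (fun j => if j == k then f @^-1` B else setT).
  case: HPi => PiT _ _ _; split=> j; first by case: eqP => [->|_]; [exact: h|].
  by move=> /negbTE /= ->.
rewrite (bigD1 (Ordinal kL))//= eqxx big1 ?setIT// => j jk.
by rewrite ifF//; apply/negbTE.
Qed.

Lemma Er_indep (s s' : pred nat) (U V : T -> R) :
  (forall k, s k -> ~~ s' k) -> mbs s U -> mbs s' V -> ig P U -> ig P V ->
  ig P (fun w => U w * V w) /\ Er P (fun w => U w * V w) = Er P U * Er P V.
Proof.
by move=> ss' sU sV iU iV; apply: indep_fun_Er => //; exact: mbs_indep ss' sU sV.
Qed.

End pi_family.

(** * Multilinear polynomials *)

Section multilinear.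
Context (R : realType) (m : nat).
Local Notation idx := (seq (nat * 'I_m)).
Implicit Types (c : idx -> R) (v : nat -> 'I_m -> R) (L n N : nat).

(** Multi-indices with all blocks below [L], listed by their last block, so that sums over them can
    be treated by peeling off blocks from the top. *)
Fixpoint mis L : seq idx :=
  if L is L'.+1 then
    mis L' ++ [seq rcons a (L', i) | a <- mis L', i <- enum 'I_m]
  else [:: [::]].

Lemma mem_mis L (a : idx) :
  (a \in mis L) = sorted ltn [seq x.1 | x <- a] && all (fun x => (x.1 < L)%N) a.
Proof.
elim: L a => [|L IH] a /=.
  by rewrite inE; case: a => [|x a]//=; rewrite andbF.
rewrite mem_cat IH; apply/orP/andP.
  case=> [/andP[sa aL]|/allpairsP[[b i] /= [bL _ ->]]].
    by split=> //; apply: sub_all aL => x /= /ltnW; rewrite ltnS.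
  move: bL; rewrite IH => /andP[sb bL]; split; last first.
    by rewrite all_rcons /= ltnSn /=; apply: sub_all bL => x /= /ltnW; rewrite ltnS.
  rewrite map_rcons /=; case: b sb bL => [|y b]//= sb /andP[yL bL].
  rewrite rcons_path sb/= (last_map (fun x : nat * 'I_m => x.1)).
  by move/allP: bL => bL; have := mem_last y b; rewrite inE => /predU1P[->//|/bL].
elim/last_ind: a => [|b [n i] _]; first by left.
rewrite map_rcons all_rcons /= ltnS => -[sb /andP[nL bL]].
have bn : all (fun x => (x.1 < n)%N) b.
  apply/allP => x xb.
  have : pairwise ltn (rcons [seq x.1 | x <- b] n) by rewrite -sorted_pairwise//; exact: ltn_trans.
  rewrite pairwise_rcons => /andP[/allP H _]; apply: H; exact: map_f.
have sb' : sorted ltn [seq x.1 | x <- b].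
  by move: sb; case: (b) => [|y b']//=; rewrite rcons_path => /andP[].
move: nL; rewrite leq_eqVlt => /predU1P[nL|nL].
  subst n.
  by right; apply/allpairsP; exists (b, i); rewrite IH/= sb' bn mem_enum.
left; rewrite all_rcons /= nL sb/=; apply: sub_all bn => x /= xn; exact: ltn_trans nL.
Qed.

Lemma uniq_mis L : uniq (mis L).
Proof.
elim: L => [//|L IH] /=; rewrite cat_uniq IH/=; apply/andP; split.
  apply/hasPn => _ /allpairsP[[b i] /= [bL _ ->]].
  by rewrite mem_mis all_rcons /= ltnn andbF.
apply: allpairs_uniq => //; first exact: enum_uniq.
by move=> [a i] [b j] _ _ /= /rcons_inj[-> ->].
Qed.

(** Coefficients of the polynomial that multiplies the variable [(n, i)] when [n] is the last block;
    its degree drops by one. *)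
Definition linkc c n (i : 'I_m) : idx -> R := fun a => c (rcons a (n, i)).

Lemma big_misS L (F : idx -> R) :
  \sum_(a <- mis L.+1) F a =
  \sum_(a <- mis L) F a + \sum_i \sum_(a <- mis L) F (rcons a (L, i)).
Proof.
rewrite /= big_cat /= big_allpairs_dep exchange_big /=; congr (_ + _).
by rewrite big_enum.
Qed.

Definition mono v (a : idx) : R := \prod_(x <- a) v x.1 x.2.

Definition mpoly L c v : R := \sum_(a <- mis L) c a * mono v a.

Definition nrm2 L c : R := \sum_(a <- mis L) c a ^+ 2.

Lemma nrm2_ge0 L c : 0 <= nrm2 L c.
Proof. by apply: sumr_ge0 => a _; exact: sqr_ge0. Qed.

Lemma nrm2S L c : nrm2 L.+1 c = nrm2 L c + \sum_i nrm2 L (linkc c L i).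
Proof. by rewrite /nrm2 big_misS. Qed.

Lemma mpolyS L c v :
  mpoly L.+1 c v = mpoly L c v + \sum_i v L i * mpoly L (linkc c L i) v.
Proof.
rewrite /mpoly big_misS; congr (_ + _); apply: eq_bigr => i _.
rewrite big_distrr/=; apply: eq_bigr => a _.
by rewrite /mono -cats1 big_cat big_seq1/= /linkc -cats1 mulrA mulrC.
Qed.

Lemma eq_mpoly L c v v' : (forall k, (k < L)%N -> v k = v' k) ->
  mpoly L c v = mpoly L c v'.
Proof.
move=> vv'; apply: eq_big_seq => a; rewrite mem_mis => /andP[_ /allP aL].
by congr (_ * _); apply: eq_big_seq => x xa; rewrite vv'// aL.
Qed.

Lemma mpoly_eq0 L c v : (forall a, a \in mis L -> c a = 0) -> mpoly L c v = 0.
Proof. by move=> c0; rewrite /mpoly big1_seq// => a /andP[_ aL]; rewrite c0// mul0r. Qed.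

Definition vanL L N c := forall a, a \in mis L -> (N < size a)%N -> c a = 0.

Lemma vanL_le L N c : vanL L.+1 N c -> vanL L N c.
Proof. by move=> H a aL; apply: H; rewrite /= mem_cat aL. Qed.

Lemma rcons_mis L a i : a \in mis L -> rcons a (L, i) \in mis L.+1.
Proof.
move=> aL; rewrite /= mem_cat; apply/orP; right; apply/allpairsP.
by exists (a, i); rewrite mem_enum.
Qed.

Lemma vanL_shift L N c i : vanL L.+1 N.+1 c -> vanL L N (linkc c L i).
Proof. by move=> H a aL sa; apply: H; [exact: rcons_mis|rewrite size_rcons]. Qed.

Lemma vanL_shift0 L c i a : vanL L.+1 0 c -> a \in mis L -> linkc c L i a = 0.
Proof. by move=> H aL; apply: H; [exact: rcons_mis|rewrite size_rcons]. Qed.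

Definition upd v n (z : 'I_m -> R) : nat -> 'I_m -> R :=
  fun k => if k == n then z else v k.

Definition zerov : 'I_m -> R := fun=> 0.
Definition unitv (i : 'I_m) : 'I_m -> R := fun j => (j == i)%:R.

Definition mpoly_coef L c v n i :=
  mpoly L c (upd v n (unitv i)) - mpoly L c (upd v n zerov).

Lemma upd_neq v n z k : k != n -> upd v n z k = v k.
Proof. by rewrite /upd => /negbTE ->. Qed.

Lemma upd_eq v n z : upd v n z n = z.
Proof. by rewrite /upd eqxx. Qed.

(** A multi-index meets block [n] at most once, because its first components strictly increase; so
    the polynomial is affine in that block, with slopes read off at unit vectors. *)
Lemma mpoly_affine L c v n :
  mpoly L c v =
  mpoly L c (upd v n zerov) + \sum_i v n i * mpoly_coef L c v n i.
Proof.
elim: L c => [|L IH] c.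
  rewrite /mpoly_coef /mpoly /= !big_seq1 /mono !big_nil.
  by rewrite big1 ?addr0// => i _; rewrite !big_seq1 /mono !big_nil subrr mulr0.
rewrite /mpoly_coef; have [<-|Ln] := eqVneq L n.
  have E z c' : mpoly L c' (upd v L z) = mpoly L c' v.
    by apply: eq_mpoly => k kL; rewrite upd_neq// ltn_eqF.
  have E0 : mpoly L.+1 c (upd v L zerov) = mpoly L c v.
    by rewrite mpolyS E upd_eq big1 ?addr0// => i _; rewrite mul0r.
  rewrite E0 mpolyS; congr (_ + _); apply: eq_bigr => i _; congr (_ * _).
  rewrite mpolyS E upd_eq (bigD1 i)//= /unitv eqxx mul1r E big1 ?addr0.
    by rewrite addrAC subrr add0r.
  by move=> j ji; rewrite (negbTE ji) mul0r.
rewrite !mpolyS (IH c) upd_neq//.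
under [X in _ + X = _]eq_bigr do rewrite IH mulrDr.
rewrite big_split/= -!addrA; congr (_ + _); rewrite addrCA; congr (_ + _).
under [X in _ + X]eq_bigr do rewrite mulr_sumr.
rewrite exchange_big/= -big_split/=; apply: eq_bigr => i _.
rewrite !mpolyS !upd_neq// opprD [X in _ = _ * X]addrACA [RHS]mulrDr.
congr (_ + _); rewrite -sumrB mulr_sumr; apply: eq_bigr => j _.
by rewrite -mulrBr mulrCA.
Qed.

Definition restr (p : pred idx) c : idx -> R := fun a => if p a then c a else 0.

Definition touches n : pred idx := fun a => n \in [seq x.1 | x <- a].

Lemma mono_upd0 v n a :
  mono (upd v n zerov) a = if touches n a then 0 else mono v a.
Proof.
rewrite /mono /touches; elim: a => [|x a IH] /=; first by rewrite !big_nil.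
rewrite !big_cons inE IH /upd [n == x.1]eq_sym; case: eqP => /= _.
  by rewrite mul0r.
by case: ifP => _; rewrite ?mulr0.
Qed.

Lemma mpoly_influence L c v n :
  mpoly L c v - mpoly L c (upd v n zerov) = mpoly L (restr (touches n) c) v.
Proof.
rewrite /mpoly -sumrB; apply: eq_bigr => a _.
rewrite mono_upd0 /restr; case: ifP => _; first by rewrite mulr0 subr0.
by rewrite subrr mul0r.
Qed.

Definition infl L c n : R := nrm2 L (restr (touches n) c).

(** A multi-index of size at most [N] touches at most [N] blocks, so each squared coefficient is
    counted at most [N] times. *)
Lemma sum_infl L N c : vanL L N c ->
  \sum_(n < L) infl L c n <= N%:R * nrm2 L c.
Proof.
move=> vc; rewrite /infl /nrm2 exchange_big/= mulr_sumr.
rewrite big_seq [leRHS]big_seq; apply: ler_sum => a aL.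
have -> : \sum_(n < L) restr (touches n) c a ^+ 2 =
   \sum_(n < L | touches n a) c a ^+ 2.
  rewrite [RHS]big_mkcond; apply: eq_bigr => n _.
  by rewrite /restr; case: ifP => //; rewrite expr0n.
rewrite sumr_const -[leLHS]mulr_natl.
have [sa|sa] := leqP (size a) N; last by rewrite vc// expr0n/= !mulr0.
apply: ler_wpM2r; first exact: sqr_ge0.
rewrite ler_nat; apply: leq_trans sa; rewrite -(size_map (fun x => x.1)).
rewrite -(size_image (@nat_of_ord L)); apply: uniq_leq_size.
  by rewrite map_inj_uniq; [exact: enum_uniq|exact: val_inj].
by move=> n /mapP[j]; rewrite mem_enum => ja ->.
Qed.

Lemma vanL_restr L N p c : vanL L N c -> vanL L N (restr p c).
Proof. by move=> H a aL sa; rewrite /restr; case: ifP => // _; exact: H. Qed.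

End multilinear.

Lemma sqr_sum_le (R : realType) (m : nat) (x : 'I_m -> R) :
  (\sum_i x i) ^+ 2 <= m%:R * \sum_i x i ^+ 2.
Proof.
set S := \sum_i x i ^+ 2.
have -> : m%:R * S = \sum_i \sum_(j < m) (x i ^+ 2 + x j ^+ 2) / 2.
  under eq_bigr do rewrite -mulr_suml big_split/= sumr_const card_ord -/S.
  rewrite -mulr_suml big_split/= sumr_const card_ord sumrMnl -/S.
  by rewrite mulr_natl; set X := _ *+ m; field.
rewrite expr2 mulr_suml; apply: ler_sum => i _; rewrite mulr_sumr.
apply: ler_sum => j _; have := sqr_ge0 (x i - x j); nra.
Qed.

Lemma expr4_sum_le (R : realType) (m : nat) (x : 'I_m -> R) :
  (\sum_i x i) ^+ 4 <= m%:R ^+ 3 * \sum_i x i ^+ 4.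
Proof.
have -> : (\sum_i x i) ^+ 4 = ((\sum_i x i) ^+ 2) ^+ 2 by rewrite -exprM.
have h1 := sqr_sum_le x.
have h2 := sqr_sum_le (fun i => x i ^+ 2).
have e4 i : (x i ^+ 2) ^+ 2 = x i ^+ 4 by rewrite -exprM.
under [X in _ <= _ * X]eq_bigr do rewrite -e4.
have s2 : 0 <= \sum_i x i ^+ 2 by apply: sumr_ge0 => i _; exact: sqr_ge0.
apply: (le_trans (y := (m%:R * \sum_i x i ^+ 2) ^+ 2)).
  by rewrite ler_sqr ?nnegrE ?sqr_ge0// mulr_ge0.
have -> : m%:R ^+ 3 * \sum_i (x i ^+ 2) ^+ 2 =
    m%:R ^+ 2 * (m%:R * \sum_i (x i ^+ 2) ^+ 2) by rewrite mulrA -exprSr.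
by rewrite exprMn ler_wpM2l// sqr_ge0.
Qed.

(** * Hypercontractivity and second moments of multilinear chaoses *)

Section block_moments.
Context (d : measure_display) (T : measurableType d) (R : realType)
  (P : probability T R) (Pi : nat -> set (set T)) (L : nat)
  (HPi : pi_family P Pi L) (m : nat).
Implicit Types V : nat -> 'I_m -> T -> R.
Local Notation Er := (Er P).
Local Notation ig := (ig P).
Local Notation L4 := (L4 P).
Local Notation mbs := (mbs Pi L).

Definition ev L' c V (w : T) : R := mpoly L' c (fun k i => V k i w).

Definition regular_env V := forall k, (k < L)%N -> forall i,
  mbs (pred1 k) (V k i) /\ L4 (V k i).

(** [L4] is not closed under products in general; for independent factors the fourth moment
    factorises. *)
Lemma L4M_indep (s s' : pred nat) (U W : T -> R) : (forall k, s k -> ~~ s' k) -> mbs s U -> mbs s' W ->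
  L4 U -> L4 W -> L4 (fun w => U w * W w).
Proof.
move=> ss' sU sW [mU iU] [mW iW]; split; first exact: measurable_funM.
have sU4 : mbs s (fun w => U w ^+ 4).
  by apply: (mbs_comp (h := fun x => x ^+ 4)) => //; exact: measurable_funX.
have sW4 : mbs s' (fun w => W w ^+ 4).
  by apply: (mbs_comp (h := fun x => x ^+ 4)) => //; exact: measurable_funX.
under eq_fun do rewrite exprMn.
by have [] := Er_indep HPi ss' sU4 sW4 iU iW.
Qed.

Lemma mbs_ev (s : pred nat) L' c V : (forall k i, (k < L')%N -> mbs s (V k i)) ->
  mbs s (ev L' c V).
Proof.
move=> H; rewrite /ev /mpoly.
(* Guarding each term by membership makes it measurable for every index, as [mbs_sum] requires. *)
have E : (fun w => \sum_(a <- mis m L') c a * mono (fun k i => V k i w) a) =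
    (fun w => \sum_(a <- mis m L')
       if a \in mis m L' then c a * mono (fun k i => V k i w) a else 0).
  by apply/funext => w; apply: eq_big_seq => a ->.
rewrite E; apply: mbs_sum => a; case: (boolP (a \in _)) => aL; last exact: mbs_cst.
apply: mbsM; first exact: mbs_cst.
apply: mbs_prod => x xa; apply: H.
by move: aL; rewrite mem_mis => /andP[_ /allP]; apply.
Qed.

Lemma mbs_prefix V L' c : regular_env V -> (L' <= L)%N ->
  mbs (fun k => (k < L')%N) (ev L' c V).
Proof.
move=> rV LL; apply: mbs_ev => k i kL.
have [+ _] := rV k (leq_trans kL LL) i.
by apply: mbs_sub => j /eqP ->.
Qed.

Lemma prefix_disj n k : (k < n)%N -> ~~ pred1 n k.
Proof. by move=> kn; rewrite /= ltn_eqF. Qed.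

Lemma evS L' c V w :
  ev L'.+1 c V w = ev L' c V w + \sum_i V L' i w * ev L' (linkc c L' i) V w.
Proof. by rewrite /ev mpolyS. Qed.

Lemma L4_ev V L' c : regular_env V -> (L' <= L)%N -> L4 (ev L' c V).
Proof.
move=> rV; elim: L' c => [|L' IH] c LL.
  have -> : ev 0 c V = fun=> c [::].
    by apply/funext => w; rewrite /ev /mpoly/= big_seq1 /mono big_nil mulr1.
  exact: L4_cst.
have -> : ev L'.+1 c V = fun w => ev L' c V w +
    \sum_i ev L' (linkc c L' i) V w * V L' i w.
  by apply/funext => w; rewrite evS; congr (_ + _); apply: eq_bigr => i _; rewrite mulrC.
have LL' := ltnW LL.
apply: L4D; first exact: IH.
apply: L4_sum => i; have [sV hV] := rV L' LL i.
exact: (L4M_indep (@prefix_disj L') (mbs_prefix _ rV LL') sV (IH _ LL') hV).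
Qed.

Definition good_env K V := forall k, (k < L)%N -> forall i,
  [/\ mbs (pred1 k) (V k i), L4 (V k i), Er (V k i) = 0 &
      Er (fun w => V k i w ^+ 4) <= K].

Lemma good_regular K V : good_env K V -> regular_env V.
Proof. by move=> H k kL i; have [] := H k kL i. Qed.

(** The price of one block in [hyper_step]; [m.+1] in place of [m] keeps it at least 1 when [m] is 0
    and [K] is at least 1. *)
Definition hyp_cst (K : R) : R := 4 * (m.+1)%:R ^+ 2 * K.

Lemma sqr_mean_le K (U : T -> R) : 1 <= K -> L4 U -> Er (fun w => U w ^+ 4) <= K ->
  Er (fun w => U w ^+ 2) <= K.
Proof.
move=> K1 hU hK.
have i2 : ig (fun w => U w ^+ 2).
  by have := ig_mul2 hU hU; under eq_fun do rewrite -expr2.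
have i4 : ig (fun w => 1 / 2 + 1 / 2 * U w ^+ 4).
  by apply: igD; [exact: ig_cst|apply: igZ; case: hU].
apply: (le_trans (y := Er (fun w => 1 / 2 + 1 / 2 * U w ^+ 4))).
  apply: Er_le => // w; have := sqr_ge0 (1 - U w ^+ 2); nra.
rewrite ErD; [|exact: ig_cst|by apply: igZ; case: hU].
rewrite Er_cst ErZ; last by case: hU.
lra.
Qed.

(** The term a^3 e is kept exact because it integrates to zero for a centred block; 4 a e^3 is
    absorbed through 2 e^2 (a - e)^2 >= 0. *)
Lemma expr4_split (a e : R) :
  (a + e) ^+ 4 <= a ^+ 4 + 4 * (a ^+ 3 * e) + 8 * (a ^+ 2 * e ^+ 2) + 3 * e ^+ 4.
Proof.
have := sqr_ge0 (e * (a - e)); nra.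
Qed.

(* The two-block inequality behind hypercontractivity: [A], [B i] do not depend
   on the centred block [U i]. *)
Lemma hyper_step K V n (A : T -> R) (B : 'I_m -> T -> R) (k0 a : R) (b : 'I_m -> R) :
  1 <= K -> good_env K V -> (n < L)%N ->
  mbs (fun k => (k < n)%N) A -> (forall i, mbs (fun k => (k < n)%N) (B i)) ->
  L4 A -> (forall i, L4 (B i)) -> 0 <= k0 -> 0 <= a -> (forall i, 0 <= b i) ->
  Er (fun w => A w ^+ 4) <= (hyp_cst K * k0 * a) ^+ 2 ->
  (forall i, Er (fun w => B i w ^+ 4) <= (k0 * b i) ^+ 2) ->
  Er (fun w => (A w + \sum_i V n i w * B i w) ^+ 4) <=
  (hyp_cst K * k0 * (a + \sum_i b i)) ^+ 2.
Proof.
move=> K1 gV nL sA sB hA hB k00 a0 b0 EA EB.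
have hyp0 : 0 <= hyp_cst K.
  by rewrite /hyp_cst !mulr_ge0// ?exprn_ge0//; lra.
have hV i : L4 (V n i) by have [] := gV n nL i.
have sV i : mbs (pred1 n) (V n i) by have [] := gV n nL i.
have EV i : Er (V n i) = 0 by have [] := gV n nL i.
have EV4 i : Er (fun w => V n i w ^+ 4) <= K by have [] := gV n nL i.
have hVB i : L4 (fun w => V n i w * B i w).
  have H := L4M_indep (@prefix_disj n) (sB i) (sV i) (hB i) (hV i).
  by under eq_fun do rewrite mulrC.
pose D w := \sum_i V n i w * B i w.
have hD : L4 D by exact: L4_sum.
have dis := @prefix_disj n.
have mX k : measurable_fun setT (fun x : R => x ^+ k) by exact: measurable_funX.
(* first-order cross terms *)
have i1 i : ig (fun w => A w ^+ 3 * B i w).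
  have := ig_mul4 hA hA hA (hB i).
  by under eq_fun do rewrite -expr2 -exprSr.
have c1 i : ig (fun w => A w ^+ 3 * B i w * V n i w) /\
    Er (fun w => A w ^+ 3 * B i w * V n i w) = 0.
  have sAB : mbs (fun k => (k < n)%N) (fun w => A w ^+ 3 * B i w).
    by apply: mbsM => //; exact: (mbs_comp (mX 3)).
  have [? ->] := Er_indep HPi dis sAB (sV i) (i1 i) (L4_ig (hV i)).
  by rewrite EV mulr0.
have i2 i : ig (fun w => A w ^+ 2 * B i w ^+ 2).
  have := ig_mul4 hA hA (hB i) (hB i).
  by under eq_fun do rewrite -mulrA -!expr2.
have iV2 i : ig (fun w => V n i w ^+ 2).
  by have := ig_mul2 (hV i) (hV i); under eq_fun do rewrite -expr2.
have c2 i : ig (fun w => A w ^+ 2 * B i w ^+ 2 * V n i w ^+ 2) /\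
    Er (fun w => A w ^+ 2 * B i w ^+ 2 * V n i w ^+ 2) <=
    hyp_cst K * k0 ^+ 2 * a * b i * K.
  have sAB : mbs (fun k => (k < n)%N) (fun w => A w ^+ 2 * B i w ^+ 2).
    by apply: mbsM; exact: (mbs_comp (mX 2)).
  have [? ->] := Er_indep HPi dis sAB (mbs_comp (mX 2%N) (sV i)) (i2 i) (iV2 i).
  split => //; apply: ler_pM.
  - by apply: Er_ge0 => w; rewrite mulr_ge0// sqr_ge0.
  - by apply: Er_ge0 => w; exact: sqr_ge0.
  - have -> : hyp_cst K * k0 ^+ 2 * a * b i = (hyp_cst K * k0 * a) * (k0 * b i) by ring.
    have h1 : 0 <= hyp_cst K * k0 * a by do 2?[apply: mulr_ge0].
    have h2 : 0 <= k0 * b i by apply: mulr_ge0.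
    exact: (Er_cauchy_schwarz hA (hB i) h1 h2 EA (EB i)).
  - exact: sqr_mean_le.
have c4 i : ig (fun w => B i w ^+ 4 * V n i w ^+ 4) /\
    Er (fun w => B i w ^+ 4 * V n i w ^+ 4) <= (k0 * b i) ^+ 2 * K.
  have iB4 : ig (fun w => B i w ^+ 4) by case: (hB i).
  have iV4 : ig (fun w => V n i w ^+ 4) by case: (hV i).
  have [? ->] := Er_indep HPi dis (mbs_comp (mX 4%N) (sB i)) (mbs_comp (mX 4%N) (sV i)) iB4 iV4.
  by split=> //; apply: ler_pM => //; apply: Er_ge0 => w; rewrite exprn_even_ge0.
have iA4 : ig (fun w => A w ^+ 4) by case: hA.
pose G1 w := \sum_i A w ^+ 3 * B i w * V n i w.
pose G2 w := \sum_i A w ^+ 2 * B i w ^+ 2 * V n i w ^+ 2.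
pose G4 w := \sum_i B i w ^+ 4 * V n i w ^+ 4.
have iG1 : ig G1 by apply: ig_sum => i; have [] := c1 i.
have iG2 : ig G2 by apply: ig_sum => i; have [] := c2 i.
have iG4 : ig G4 by apply: ig_sum => i; have [] := c4 i.
have EG1 : Er G1 = 0.
  rewrite Er_sum; last by move=> i; have [] := c1 i.
  by rewrite big1// => i _; have [] := c1 i.
have EG2 : Er G2 <= hyp_cst K * k0 ^+ 2 * a * K * \sum_i b i.
  rewrite Er_sum; last by move=> i; have [] := c2 i.
  rewrite mulr_sumr; apply: ler_sum => i _; rewrite mulrAC; exact: (c2 i).2.
have EG4 : Er G4 <= k0 ^+ 2 * K * (\sum_i b i) ^+ 2.
  rewrite Er_sum; last by move=> i; have [] := c4 i.
  apply: (le_trans (y := \sum_i k0 ^+ 2 * K * b i ^+ 2)).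
    by apply: ler_sum => i _; rewrite mulrAC -exprMn; exact: (c4 i).2.
  rewrite -mulr_sumr; apply: ler_wpM2l; first by rewrite mulr_ge0 ?sqr_ge0//; lra.
  rewrite [leRHS]expr2 mulr_suml; apply: ler_sum => i _.
  rewrite expr2; apply: ler_wpM2l => //.
  by rewrite (bigD1 i)//= lerDl sumr_ge0.
pose M : R := m%:R.
have M0 : 0 <= M by [].
have pw w : (A w + D w) ^+ 4 <=
    A w ^+ 4 + 4 * G1 w + 8 * M * G2 w + 3 * M ^+ 3 * G4 w.
  apply: (le_trans (expr4_split _ _)).
  have e1 : A w ^+ 3 * D w = G1 w.
    by rewrite mulr_sumr; apply: eq_bigr => i _; rewrite -mulrA [V n i w * _]mulrC.
  have e2 : A w ^+ 2 * D w ^+ 2 <= M * G2 w.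
    have -> : M * G2 w = A w ^+ 2 * (M * \sum_i (V n i w * B i w) ^+ 2).
      rewrite mulrCA; congr (_ * _); rewrite mulr_sumr; apply: eq_bigr => i _.
      by ring.
    by apply: ler_wpM2l; [exact: sqr_ge0|exact: sqr_sum_le].
  have e4 : D w ^+ 4 <= M ^+ 3 * G4 w.
    apply: (le_trans (expr4_sum_le _)); apply: ler_wpM2l; first exact: exprn_ge0.
    by apply: ler_sum => i _; rewrite exprMn mulrC.
  rewrite e1; lra.
have iG : ig (fun w => A w ^+ 4 + 4 * G1 w + 8 * M * G2 w + 3 * M ^+ 3 * G4 w).
  by do 3 (apply: igD; last exact: igZ).
have iAD : ig (fun w => (A w + D w) ^+ 4) by have [] := L4D hA hD.
apply: (le_trans (Er_le iAD iG pw)).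
rewrite !ErD ?ErZ; do ?[by [] | exact: igZ | by do 2?(apply: igD; last exact: igZ)].
rewrite EG1 mulr0 addr0.
set b' := \sum_i b i in EG2 EG4 *.
have b'0 : 0 <= b' by apply: sumr_ge0.
(* [hyp_cst K] dominates 4 m K and its square dominates 3 m^3 K, so the three remaining terms fit
   into one perfect square. *)
have h1 : 8 * M * Er G2 <= 2 * (hyp_cst K * k0) ^+ 2 * a * b'.
  apply: (le_trans (y := 8 * M * (hyp_cst K * k0 ^+ 2 * a * K * b'))).
    by apply: ler_wpM2l => //; rewrite mulr_ge0.
  have -> : 8 * M * (hyp_cst K * k0 ^+ 2 * a * K * b') =
    (8 * M * K) * (hyp_cst K * k0 ^+ 2 * a * b') by ring.
  have -> : 2 * (hyp_cst K * k0) ^+ 2 * a * b' =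
    (2 * hyp_cst K) * (hyp_cst K * k0 ^+ 2 * a * b') by ring.
  apply: ler_wpM2r; first by do !apply: mulr_ge0 => //; exact: sqr_ge0.
  rewrite /hyp_cst -addn1 natrD -/M; nra.
have h2 : 3 * M ^+ 3 * Er G4 <= (hyp_cst K * k0) ^+ 2 * b' ^+ 2.
  apply: (le_trans (y := 3 * M ^+ 3 * (k0 ^+ 2 * K * b' ^+ 2))).
    by apply: ler_wpM2l => //; rewrite mulr_ge0// exprn_ge0.
  have -> : 3 * M ^+ 3 * (k0 ^+ 2 * K * b' ^+ 2) =
    (3 * M ^+ 3 * K) * (k0 ^+ 2 * b' ^+ 2) by ring.
  rewrite exprMn -[leRHS]mulrA; apply: ler_wpM2r.
    by rewrite mulr_ge0// sqr_ge0.
  rewrite /hyp_cst; set q : R := m.+1%:R.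
  have q1 : 1 <= q by rewrite ler1n.
  have Mq : M <= q by rewrite ler_nat.
  have -> : (4 * q ^+ 2 * K) ^+ 2 = 16 * q ^+ 4 * K ^+ 2 by ring.
  have q3 : 0 <= q ^+ 3 by rewrite exprn_ge0//; lra.
  have hM : M ^+ 3 <= q ^+ 4.
    apply: (le_trans (y := q ^+ 3)); first by rewrite lerXn2r ?nnegrE//; lra.
    by rewrite ler_weXn2l.
  have KK : K <= K ^+ 2 by nra.
  apply: (le_trans (y := 3 * q ^+ 4 * K ^+ 2)).
    have M3 : 0 <= M ^+ 3 by exact: exprn_ge0.
    by apply: ler_pM => //; lra.
  have q4 : 0 <= q ^+ 4 by rewrite exprn_ge0//; lra.
  have : 0 <= q ^+ 4 * K ^+ 2 by rewrite mulr_ge0// sqr_ge0.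
  lra.
have -> : (hyp_cst K * k0 * (a + b')) ^+ 2 = (hyp_cst K * k0 * a) ^+ 2 +
   2 * (hyp_cst K * k0) ^+ 2 * a * b' + (hyp_cst K * k0) ^+ 2 * b' ^+ 2 by ring.
lra.
Qed.

(** Peeling off the last block leaves a part of the same degree and links of degree one less. The
    factor [hyp_cst K] is paid only on passing to a link, hence [N] times rather than once per
    block. *)
Lemma hyper4 K V L' N c : 1 <= K -> good_env K V -> (L' <= L)%N ->
  vanL L' N c ->
  Er (fun w => ev L' c V w ^+ 4) <= (hyp_cst K ^+ N * nrm2 L' c) ^+ 2.
Proof.
move=> K1 gV.
have hyp1 : 1 <= hyp_cst K.
  have : (1 : R) <= m.+1%:R ^+ 2 by rewrite exprn_ege1// ler1n.
  rewrite /hyp_cst; nra.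
have hyp0 : 0 <= hyp_cst K by lra.
elim: L' N c => [|L' IH] N c LL vc.
  have -> : (fun w => ev 0 c V w ^+ 4) = fun=> c [::] ^+ 4.
    by apply/funext => w; rewrite /ev /mpoly/= big_seq1 /mono big_nil mulr1.
  rewrite Er_cst /nrm2 /= big_seq1 exprMn -!exprM -[leLHS]mul1r.
  apply: ler_wpM2r; first by rewrite exprn_even_ge0.
  by rewrite exprn_ege1// exprn_ege1.
have LL' := ltnW LL; have rV := good_regular gV.
case: N => [|N] in vc *.
  have n0 i : nrm2 L' (linkc c L' i) = 0.
    by apply: big1_seq => a /andP[_ aL]; rewrite (vanL_shift0 _ vc)// expr0n.
  rewrite nrm2S big1 ?addr0//.
  have -> : (fun w => ev L'.+1 c V w ^+ 4) = (fun w => ev L' c V w ^+ 4).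
    apply/funext => w; rewrite evS big1 ?addr0// => i _.
    by rewrite /ev mpoly_eq0 ?mulr0// => a; exact: vanL_shift0.
  by apply: IH => //; exact: vanL_le vc.
have -> : (fun w => ev L'.+1 c V w ^+ 4) = (fun w => (ev L' c V w +
   \sum_i V L' i w * ev L' (linkc c L' i) V w) ^+ 4).
  by apply/funext => w; rewrite evS.
rewrite nrm2S [hyp_cst K ^+ _]exprS.
apply: (hyper_step (n := L')) => //; do ?[exact: mbs_prefix|exact: L4_ev|exact: nrm2_ge0].
- by move=> i; exact: mbs_prefix.
- by move=> i; exact: L4_ev.
- exact: exprn_ge0.
- by move=> i; exact: nrm2_ge0.
- by rewrite -exprS; apply: IH => //; exact: vanL_le vc.
- by move=> i; apply: IH => //; exact: vanL_shift vc.
Qed.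

Definition cov_ge (lam : R) V := forall k, (k < L)%N -> forall x : 'I_m -> R,
  lam * \sum_i x i ^+ 2 <=
  \sum_i \sum_j x i * x j * Er (fun w => V k i w * V k j w).

Lemma second_moment_ge K lam V L' N c : good_env K V -> cov_ge lam V ->
  0 <= lam <= 1 -> (L' <= L)%N -> vanL L' N c ->
  lam ^+ N * nrm2 L' c <= Er (fun w => ev L' c V w ^+ 2).
Proof.
move=> gV cV /andP[l0 l1].
elim: L' N c => [|L' IH] N c LL vc.
  have -> : (fun w => ev 0 c V w ^+ 2) = fun=> c [::] ^+ 2.
    by apply/funext => w; rewrite /ev /mpoly/= big_seq1 /mono big_nil mulr1.
  rewrite Er_cst /nrm2 /= big_seq1 -[leRHS]mul1r.
  by apply: ler_wpM2r; [exact: sqr_ge0|exact: exprn_ile1].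
have LL' := ltnW LL; have rV := good_regular gV.
case: N => [|N] in vc *.
  have n0 i : nrm2 L' (linkc c L' i) = 0.
    by apply: big1_seq => a /andP[_ aL]; rewrite (vanL_shift0 _ vc)// expr0n.
  rewrite nrm2S big1 ?addr0//.
  have -> : (fun w => ev L'.+1 c V w ^+ 2) = (fun w => ev L' c V w ^+ 2).
    apply/funext => w; rewrite evS big1 ?addr0// => i _.
    by rewrite /ev mpoly_eq0 ?mulr0// => a; exact: vanL_shift0.
  by apply: IH => //; exact: vanL_le vc.
pose A := ev L' c V; pose B i := ev L' (linkc c L' i) V.
have hA : L4 A by exact: L4_ev.
have hB i : L4 (B i) by exact: L4_ev.
have sA : mbs (fun k => (k < L')%N) A by exact: mbs_prefix.
have sB i : mbs (fun k => (k < L')%N) (B i) by exact: mbs_prefix.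
have hV i : L4 (V L' i) by have [] := gV L' LL i.
have sV i : mbs (pred1 L') (V L' i) by have [] := gV L' LL i.
have EV i : Er (V L' i) = 0 by have [] := gV L' LL i.
have dis := @prefix_disj L'.
have c1 i : ig (fun w => A w * B i w * V L' i w) /\
    Er (fun w => A w * B i w * V L' i w) = 0.
  have [? ->] := Er_indep HPi dis (mbsM sA (sB i)) (sV i)
    (ig_mul2 hA (hB i)) (L4_ig (hV i)).
  by rewrite EV mulr0.
have c2 i j := Er_indep HPi dis (mbsM (sB i) (sB j)) (mbsM (sV i) (sV j))
   (ig_mul2 (hB i) (hB j)) (ig_mul2 (hV i) (hV j)).
have iA2 : ig (fun w => A w ^+ 2).
  by have := ig_mul2 hA hA; under eq_fun do rewrite -expr2.
have iB2 i : ig (fun w => B i w ^+ 2).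
  by have := ig_mul2 (hB i) (hB i); under eq_fun do rewrite -expr2.
have iBB i j : ig (fun w => B i w * B j w) by exact: ig_mul2.
have -> : (fun w => ev L'.+1 c V w ^+ 2) = (fun w => A w ^+ 2 +
   2 * (\sum_i A w * B i w * V L' i w) +
   \sum_i \sum_j B i w * B j w * (V L' i w * V L' j w)).
  apply/funext => w; rewrite evS sqrrD; congr (_ + _ + _).
    rewrite -[LHS]mulr_natl; congr (_ * _); rewrite mulr_sumr; apply: eq_bigr => i _.
    by rewrite -[RHS]mulrA [_ * V L' i w]mulrC.
  rewrite expr2 mulr_suml; apply: eq_bigr => i _; rewrite mulr_sumr.
  by apply: eq_bigr => j _; rewrite /B; ring.
rewrite !ErD ?ErZ ?Er_sum//; last first.
all: do ?[by apply: ig_sum => i; apply: ig_sum => j; have [] := c2 i j].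
all: do ?[by move=> i; apply: ig_sum => j; have [] := c2 i j].
all: do ?[by apply: igD => //; apply: igZ; apply: ig_sum => i; have [] := c1 i].
all: do ?[by apply: igZ; apply: ig_sum => i; have [] := c1 i].
all: do ?[by apply: ig_sum => i; have [] := c1 i].
all: do ?[by move=> i; have [] := c1 i].
rewrite big1 ?mulr0 ?addr0; last by move=> i _; have [] := c1 i.
rewrite nrm2S mulrDr; apply: lerD; first by apply: IH => //; exact: vanL_le vc.
(* By independence the products of the last block may be replaced by their means; the covariance
   lower bound then applies pointwise to the vector of the [B i w]. *)
have -> : \sum_i Er (fun w => \sum_j B i w * B j w * (V L' i w * V L' j w)) =
   Er (fun w => \sum_i \sum_j B i w * B j w * Er (fun w => V L' i w * V L' j w)).
  rewrite Er_sum; last first.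
    by move=> i; apply: ig_sum => j; under eq_fun do rewrite mulrC; exact: igZ.
  apply: eq_bigr => i _; rewrite !Er_sum.
  - apply: eq_bigr => j _; have [_ ->] := c2 i j; rewrite mulrC -ErZ//.
    by congr Er; apply/funext => w; rewrite mulrC.
  - by move=> j; under eq_fun do rewrite mulrC; exact: igZ.
  - by move=> j; have [] := c2 i j.
apply: (le_trans (y := Er (fun w => lam * \sum_i B i w ^+ 2))); last first.
  apply: Er_le; last by move=> w; exact: cV.
    by apply: igZ; exact: ig_sum.
  by apply: ig_sum => i; apply: ig_sum => j; under eq_fun do rewrite mulrC; exact: igZ.
rewrite ErZ; last exact: ig_sum.
rewrite Er_sum// exprS -mulrA; apply: ler_wpM2l => //.
rewrite mulr_sumr; apply: ler_sum => i _; apply: IH => //; exact: vanL_shift vc.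
Qed.

End block_moments.

(** What the exchange uses of a test function: [b] serves integrability only, whereas [B] enters the
    error. *)
Record taylor3 (R : realType) (f f1 f2 : R -> R) (b B : R) : Prop := Taylor3 {
  t3_mf : measurable_fun setT f;
  t3_mf1 : measurable_fun setT f1;
  t3_mf2 : measurable_fun setT f2;
  t3_f : forall x, `|f x| <= b;
  t3_f1 : forall x, `|f1 x| <= b;
  t3_f2 : forall x, `|f2 x| <= b;
  t3_rem : forall x y,
    `|f (x + y) - f x - f1 x * y - f2 x * y ^+ 2 / 2| <= B * `|y| ^+ 3 }.

(** * Lindeberg exchange *)

Section lindeberg.
Context (d : measure_display) (T : measurableType d) (R : realType)
  (P : probability T R) (Pi : nat -> set (set T)) (L : nat)
  (HPi : pi_family P Pi L) (m : nat).
Implicit Types V : nat -> 'I_m -> T -> R.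
Local Notation Er := (Er P).
Local Notation ig := (ig P).
Local Notation L4 := (L4 P).
Local Notation mbs := (mbs Pi L).
Local Notation good_env := (good_env P Pi L).
Local Notation hyp := (hyp_cst m).

Definition updV V n (z : 'I_m -> R) : nat -> 'I_m -> T -> R :=
  fun k => if k == n then fun i _ => z i else V k.

Lemma updV_at V n z w :
  (fun k i => updV V n z k i w) = upd (fun k i => V k i w) n z.
Proof. by apply/funext => k; rewrite /updV /upd; case: eqP. Qed.

Lemma regular_updV V n z : regular_env P Pi L V -> regular_env P Pi L (updV V n z).
Proof.
move=> rV k kL i; rewrite /updV; case: eqP => _; last exact: rV.
by split; [exact: mbs_cst|exact: L4_cst].
Qed.

Lemma mbs_updV V n z c : regular_env P Pi L V ->
  mbs (fun k => k != n) (ev L c (updV V n z)).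
Proof.
move=> rV; apply: mbs_ev => k i kL; rewrite /updV; case: eqP => kn.
  exact: mbs_cst.
have [+ _] := rV k kL i; apply: mbs_sub => j /eqP ->; exact/eqP.
Qed.

Lemma norm3_le (s x : R) : 0 < s -> `|x| ^+ 3 <= s ^+ 3 + s^-1 * x ^+ 4.
Proof.
move=> s0; have -> : x ^+ 4 = `|x| ^+ 4 by rewrite -normrX ger0_norm// exprn_even_ge0.
set y := `|x|; have y0 : 0 <= y by exact: normr_ge0.
have [ys|sy] := lerP y s.
  have h : y ^+ 3 <= s ^+ 3 by rewrite lerXn2r ?nnegrE// ltW.
  apply: (le_trans h); rewrite lerDl mulr_ge0 ?exprn_ge0// invr_ge0 ltW//.
apply: (le_trans (y := s^-1 * y ^+ 4)); last by rewrite lerDr exprn_ge0// ltW.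
rewrite [y ^+ 4]exprS mulrA; apply: ler_peMl; first exact: exprn_ge0.
by rewrite ler_pdivlMl// mulr1 ltW.
Qed.

(** [norm3_le] at s = sqrt(influence) trades the third moment for the fourth. One factor s is
    bounded by [delta]; the influence stays to the first power, so that errors can be summed over
    blocks by [sum_infl]. *)
Lemma third_moment_le K V N c (delta : R) n : 1 <= K -> good_env K V ->
  vanL L N c -> 0 < delta -> infl L c n <= delta ^+ 2 ->
  ig (fun w => `|ev L (restr (touches n) c) V w| ^+ 3) /\
  Er (fun w => `|ev L (restr (touches n) c) V w| ^+ 3) <=
    (1 + hyp K ^+ (N * 2)) * delta * infl L c n.
Proof.
move=> K1 gV vc d0 hd; set D := ev L _ V.
have rV := good_regular gV.
have hD : L4 D by exact: (L4_ev HPi).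
have mD3 : measurable_fun setT (fun w => `|D w| ^+ 3).
  by apply: measurable_funX; apply: measurableT_comp => //; case: hD.
have iD4 : ig (fun w => D w ^+ 4) by case: hD.
have i0 : 0 <= infl L c n by exact: nrm2_ge0.
(* The choice of [s] below needs a nonzero influence; a zero one makes the difference vanish
   identically. *)
have [z|nz] := eqVneq (infl L c n) 0.
  have D0 w : D w = 0.
    apply: mpoly_eq0 => a aL; apply/eqP; rewrite -sqrf_eq0; apply/eqP.
    move: z; rewrite /infl /nrm2 => /eqP; rewrite psumr_eq0; last by move=> b _; exact: sqr_ge0.
    by move=> /allP/(_ a aL)/= /eqP.
  rewrite z mulr0; under eq_fun do rewrite D0 normr0 expr0n/=.
  by rewrite Er_cst; split=> //; exact: ig_cst.
pose s := Num.sqrt (infl L c n).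
have ip : 0 < infl L c n by rewrite lt_neqAle eq_sym nz.
have s0 : 0 < s by rewrite sqrtr_gt0.
have s2 : s ^+ 2 = infl L c n by rewrite sqr_sqrtr.
have sd : s <= delta.
  have h : s ^+ 2 <= delta ^+ 2 by rewrite s2.
  by rewrite ler_sqr ?nnegrE in h => //; rewrite ltW.
have iB : ig (fun w => s ^+ 3 + s^-1 * D w ^+ 4).
  by apply: igD; [exact: ig_cst|exact: igZ].
have iD3 : ig (fun w => `|D w| ^+ 3).
  apply: ig_le iB => // w; rewrite ger0_norm ?exprn_ge0//; exact: norm3_le.
split => //; apply: (le_trans (Er_le iD3 iB (fun w => norm3_le (D w) s0))).
rewrite ErD ?Er_cst ?ErZ//; [|exact: ig_cst|exact: igZ].
have h4 := hyper4 HPi K1 gV (leqnn L) (vanL_restr (touches n) vc).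
rewrite -/(infl L c n) exprMn -exprM in h4.
apply: (le_trans (y := s ^+ 3 + s^-1 * (hyp K ^+ (N * 2) * infl L c n ^+ 2))).
  by rewrite lerD2l; apply: ler_wpM2l => //; rewrite invr_ge0 ltW.
have -> : s ^+ 3 + s^-1 * (hyp K ^+ (N * 2) * infl L c n ^+ 2) =
    (1 + hyp K ^+ (N * 2)) * s * infl L c n.
  by rewrite -s2; field; rewrite gt_eqF.
have h0 : 0 <= hyp K ^+ (N * 2).
  by rewrite exprn_even_ge0// oddM andbF.
apply: ler_wpM2r => //; apply: ler_wpM2l => //; lra.
Qed.

Lemma bounded_comp_ig (g : R -> R) b A U : measurable_fun setT g ->
  (forall x, `|g x| <= b) -> measurable_fun setT A -> ig U ->
  ig (fun w => g (A w) * U w).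
Proof.
move=> mg gb mA iU; apply: (ig_le (g := fun w => b * `|U w|)).
- apply: measurable_funM; last exact: ig_measurable iU.
  exact: measurableT_comp mg mA.
- by move=> w; rewrite normrM; apply: ler_wpM2r.
- by apply: igZ; exact: ig_norm.
Qed.

(** Intercept of the chaos as an affine function of block [n]; with the slopes that follow it
    depends on the other blocks only. *)
Definition base V c n := ev L c (updV V n (@zerov R m)).
Definition slope V c n (i : 'I_m) w :=
  ev L c (updV V n (@unitv R m i)) w - base V c n w.

(** The first-order term vanishes by centring, so the comparison value sees block [n] only through
    its covariance, and cancels between two environments that share it. *)
Lemma lindeberg_expand K V N c (delta : R) n f f1 f2 b B :
  1 <= K -> good_env K V -> (n < L)%N ->
  vanL L N c -> 0 < delta -> infl L c n <= delta ^+ 2 ->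
  taylor3 f f1 f2 b B -> 0 <= B ->
  `|Er (fun w => f (ev L c V w)) - (Er (fun w => f (base V c n w)) +
    \sum_i \sum_j 1 / 2 *
      Er (fun w => f2 (base V c n w) * (slope V c n i w * slope V c n j w)) *
      Er (fun w => V n i w * V n j w))| <=
  B * ((1 + hyp K ^+ (N * 2)) * delta * infl L c n).
Proof.
move=> K1 gV nL vc d0 hd [mf mf1 mf2 hf hf1 hf2 hrem] B0.
pose A := base V c n; pose C := slope V c n; rewrite -/A -/C.
have rV := good_regular gV.
have hA : L4 A by apply: (L4_ev HPi) => //; exact: regular_updV.
have hC i : L4 (C i).
  by apply: L4B => //; apply: (L4_ev HPi) => //; exact: regular_updV.
have sA : mbs (fun k => k != n) A by exact: mbs_updV.
have sC i : mbs (fun k => k != n) (C i).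
  have -> : C i = fun w => ev L c (updV V n (@unitv R m i)) w + -1 * A w.
    by apply/funext => w; rewrite /C mulN1r.
  by apply: mbsD; [exact: mbs_updV|apply: mbsM; [exact: mbs_cst|]].
have hV i : L4 (V n i) by have [] := gV n nL i.
have sV i : mbs (pred1 n) (V n i) by have [] := gV n nL i.
have EV i : Er (V n i) = 0 by have [] := gV n nL i.
have dis k : k != n -> ~~ pred1 n k by [].
pose F := ev L c V; pose D w := F w - A w.
have DE w : D w = \sum_i V n i w * C i w.
  rewrite /D /F /ev (mpoly_affine _ _ _ n) /A /base /ev updV_at addrAC subrr add0r.
  by apply: eq_bigr => i _; rewrite /C /slope /base /ev !updV_at.
have DI w : D w = ev L (restr (touches n) c) V w.
  by rewrite /D /F /A /base /ev updV_at mpoly_influence.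
have hF : L4 F by exact: (L4_ev HPi).
have mA : measurable_fun setT A by case: hA.
have mFm : measurable_fun setT F by case: hF.
have bC (g : R -> R) (U : T -> R) : measurable_fun setT U -> measurable_fun setT g -> (forall x, `|g x| <= b) ->
    ig (fun w => g (U w)).
  move=> mU mg gb; have := bounded_comp_ig mg gb mU (ig_cst P 1).
  by under eq_fun do rewrite mulr1.
have ifF : ig (fun w => f (F w)) by exact: bC.
have ifA : ig (fun w => f (A w)) by exact: bC.
have c1 i : ig (fun w => f1 (A w) * C i w * V n i w) /\
    Er (fun w => f1 (A w) * C i w * V n i w) = 0.
  have sAB : mbs (fun k => k != n) (fun w => f1 (A w) * C i w).
    by apply: mbsM => //; exact: mbs_comp.
  have [? ->] := Er_indep HPi dis sAB (sV i)
     (bounded_comp_ig mf1 hf1 mA (L4_ig (hC i))) (L4_ig (hV i)).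
  by rewrite EV mulr0.
have c2 i j : ig (fun w => f2 (A w) * (C i w * C j w) * (V n i w * V n j w)) /\
    Er (fun w => f2 (A w) * (C i w * C j w) * (V n i w * V n j w)) =
    Er (fun w => f2 (A w) * (C i w * C j w)) * Er (fun w => V n i w * V n j w).
  have sAB : mbs (fun k => k != n) (fun w => f2 (A w) * (C i w * C j w)).
    by apply: mbsM; [exact: mbs_comp|exact: mbsM].
  exact: (Er_indep HPi dis sAB (mbsM (sV i) (sV j))
     (bounded_comp_ig mf2 hf2 mA (ig_mul2 (hC i) (hC j))) (ig_mul2 (hV i) (hV j))).
pose G1 w := \sum_i f1 (A w) * C i w * V n i w.
pose G2 w := \sum_i \sum_j f2 (A w) * (C i w * C j w) * (V n i w * V n j w).
have iG1 : ig G1 by apply: ig_sum => i; have [] := c1 i.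
have iG2 : ig G2 by apply: ig_sum => i; apply: ig_sum => j; have [] := c2 i j.
have EG1 : Er G1 = 0.
  rewrite Er_sum; last by move=> i; have [] := c1 i.
  by rewrite big1// => i _; have [] := c1 i.
have EG2 : Er G2 = \sum_i \sum_j Er (fun w => f2 (A w) * (C i w * C j w)) *
       Er (fun w => V n i w * V n j w).
  rewrite Er_sum; last by move=> i; apply: ig_sum => j; have [] := c2 i j.
  apply: eq_bigr => i _; rewrite Er_sum; last by move=> j; have [] := c2 i j.
  by apply: eq_bigr => j _; have [] := c2 i j.
have -> : \sum_i \sum_j 1 / 2 * Er (fun w => f2 (A w) * (C i w * C j w)) *
       Er (fun w => V n i w * V n j w) = 1 / 2 * Er G2.
  rewrite EG2 mulr_sumr; apply: eq_bigr => i _; rewrite mulr_sumr.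
  by apply: eq_bigr => j _; rewrite mulrA.
pose Rm w := f (F w) - f (A w) - G1 w - 1 / 2 * G2 w.
have iRm : ig Rm by apply: igB; [apply: igB => //; exact: igB|exact: igZ].
have ERm : Er Rm = Er (fun w => f (F w)) - (Er (fun w => f (A w)) + 1 / 2 * Er G2).
  rewrite /Rm ErB; [|by apply: igB => //; exact: igB|exact: igZ].
  rewrite ErB//; last exact: igB.
  by rewrite ErB// EG1 ErZ//; ring.
rewrite -ERm; have [iD3 ED3] := third_moment_le K1 gV vc d0 hd.
apply: (le_trans (Er_norm iRm)).
apply: (le_trans (y := Er (fun w => B * `|ev L (restr (touches n) c) V w| ^+ 3))).
  apply: Er_le; [exact: ig_norm|exact: igZ|move=> w].
  rewrite -DI; apply: le_trans (hrem (A w) (D w)).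
  rewrite le_eqVlt; apply/orP; left; apply/eqP; congr `|_|.
  rewrite /Rm; have -> : A w + D w = F w by rewrite /D addrC subrK.
  have -> : G1 w = f1 (A w) * D w.
    by rewrite DE mulr_sumr; apply: eq_bigr => i _; rewrite -mulrA [C i w * _]mulrC.
  have -> : G2 w = f2 (A w) * D w ^+ 2.
    rewrite DE expr2 mulr_suml mulr_sumr; apply: eq_bigr => i _.
    by rewrite !mulr_sumr; apply: eq_bigr => j _; ring.
  by field.
by rewrite ErZ//; apply: ler_wpM2l.
Qed.

Lemma updV_eq V V' n z : (forall k, k != n -> V k = V' k) -> updV V n z = updV V' n z.
Proof. by move=> H; apply/funext => k; rewrite /updV; case: eqP => // /eqP /H. Qed.

(* Exchanges the blocks of [V] for those of [V'] one at a time. *)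
Lemma lindeberg K V V' N c (delta : R) f f1 f2 b B :
  1 <= K -> good_env K V -> good_env K V' ->
  (forall k, (k < L)%N -> forall i j,
    Er (fun w => V k i w * V k j w) = Er (fun w => V' k i w * V' k j w)) ->
  vanL L N c -> 0 < delta -> (forall n, (n < L)%N -> infl L c n <= delta ^+ 2) ->
  taylor3 f f1 f2 b B -> 0 <= B ->
  `|Er (fun w => f (ev L c V w)) - Er (fun w => f (ev L c V' w))| <=
  2 * B * (1 + hyp K ^+ (N * 2)) * delta * N%:R * nrm2 L c.
Proof.
move=> K1 gV gV' cov vc d0 hd tf B0.
(* Hybrid environments: [W n] and [W n.+1] differ in block [n] alone. Each is good because block [k]
   of [V] and of [V'] are both measurable for the same [Pi k]. *)
pose W n : nat -> 'I_m -> T -> R := fun k => if (k < n)%N then V' k else V k.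
pose H := 1 + hyp K ^+ (N * 2).
have gW n : good_env K (W n) by move=> k kL i; rewrite /W; case: ifP => _; [exact: gV'|exact: gV].
have step n : (n < L)%N ->
    `|Er (fun w => f (ev L c (W n) w)) - Er (fun w => f (ev L c (W n.+1) w))| <=
    2 * B * H * delta * infl L c n.
  move=> nL.
  have h1 := lindeberg_expand K1 (gW n) nL vc d0 (hd n nL) tf B0.
  have h2 := lindeberg_expand K1 (gW n.+1) nL vc d0 (hd n nL) tf B0.
  have Wn z : updV (W n.+1) n z = updV (W n) n z.
    by apply: updV_eq => k kn; rewrite /W ltnS leq_eqVlt (negbTE kn).
  have bE : base (W n.+1) c n = base (W n) c n by rewrite /base Wn.
  have sE : slope (W n.+1) c n = slope (W n) c n.
    by apply/funext => i; rewrite /slope bE Wn.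
  have cE i j : Er (fun w => W n.+1 n i w * W n.+1 n j w) =
      Er (fun w => W n n i w * W n n j w) by rewrite /W ltnn ltnSn cov.
  rewrite bE sE in h2.
  move: h2; under eq_bigr do under eq_bigr do rewrite cE.
  move=> h2.
  have -> : 2 * B * H * delta * infl L c n =
     B * (H * delta * infl L c n) + B * (H * delta * infl L c n) by ring.
  set S := (X in Er _ - X) in h1.
  have -> : Er (fun w => f (ev L c (W n) w)) - Er (fun w => f (ev L c (W n.+1) w)) =
     (Er (fun w => f (ev L c (W n) w)) - S) - (Er (fun w => f (ev L c (W n.+1) w)) - S) by ring.
  by apply: (le_trans (ler_normB _ _)); apply: lerD.
have tele n : (n <= L)%N ->
    `|Er (fun w => f (ev L c (W 0%N) w)) - Er (fun w => f (ev L c (W n) w))| <=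
    \sum_(k < n) 2 * B * H * delta * infl L c k.
  elim: n => [|n IH] nL; first by rewrite subrr normr0 big_ord0.
  rewrite big_ord_recr/=; apply: le_trans (lerD (IH (ltnW nL)) (step n nL)).
  apply: le_trans (ler_normD _ _); rewrite le_eqVlt; apply/orP; left; apply/eqP.
  by congr `|_|; ring.
have W0 : W 0%N = V by apply/funext => k.
have WL : ev L c (W L) = ev L c V'.
  apply/funext => w; apply: eq_mpoly => k kL; apply/funext => i.
  by rewrite /W kL.
have := tele L (leqnn L); rewrite W0 WL => /le_trans; apply.
rewrite -mulr_sumr -[leRHS]mulrA; apply: ler_wpM2l; last exact: sum_infl.
have h0 : 0 <= hyp K ^+ (N * 2) by rewrite exprn_even_ge0// oddM andbF.
by rewrite !mulr_ge0//; rewrite /H; lra.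
Qed.

End lindeberg.

(** * Smooth steps *)

Section smooth_step.
Context (R : realType).
Implicit Types (f g : R -> R) (x y t u : R).

(** This criterion handles the kink of max(x, 0)^2 at the origin without a case split on one-sided
    limits. *)
Lemma is_derive_quadratic f x l (C : R) :
  (forall h, `|f (x + h) - f x - l * h| <= C * h ^+ 2) -> is_derive x 1 f l.
Proof.
move=> H.
have C0 : 0 <= C.
  by have := le_trans (normr_ge0 _) (H 1); rewrite expr1n mulr1.
have cv : (fun h => h^-1 *: ((f \o shift x) (h *: 1) - f x)) @ 0^' --> l.
  apply/cvgrPdist_le => e e0.
  near=> h.
  have hn0 : h != 0 by near: h; exact: nbhs_dnbhs_neq.
  have hs : `|h| <= e / (C + 1).
    near: h; apply: dnbhs0_le; rewrite divr_gt0//; lra.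
  rewrite /= /shift/= [h *: 1]mulr1 [h + x]addrC.
  have -> : l - h^-1 *: (f (x + h) - f x) = - (h^-1 * (f (x + h) - f x - l * h)).
    rewrite /GRing.scale/=; field; exact: hn0.
  rewrite normrN normrM normfV.
  have h0 : 0 < `|h| by rewrite normr_gt0.
  rewrite ler_pdivrMl//; apply: (le_trans (H h)).
  rewrite -[h ^+ 2]ger0_norm ?sqr_ge0// normrX expr2 mulrCA.
  apply: ler_wpM2l => //; move: hs; rewrite ler_pdivlMr; last lra.
  have : 0 <= `|h| by []. nra.
apply: DeriveDef; first by apply/cvg_ex; exists l.
by apply: cvg_lim cv.
Unshelve. all: by end_near.
Qed.

Definition pos_pow (n : nat) x : R := Num.max x 0 ^+ n / n`!%:R.

Lemma pos_pow2_rem (x h : R) :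
  `|Num.max (x + h) 0 ^+ 2 - Num.max x 0 ^+ 2 - 2 * Num.max x 0 * h| <= h ^+ 2.
Proof.
rewrite /Num.max; case: ltP => hx; case: ltP => hy; rewrite ler_norml; nra.
Qed.

Lemma is_derive_pos_pow_mul n x :
  is_derive x 1 (fun y => Num.max y 0 ^+ n.+2) (n.+2%:R * Num.max x 0 ^+ n.+1).
Proof.
elim: n => [|n IH].
  apply: (is_derive_quadratic (C := 1)) => h.
  by rewrite mul1r expr1; exact: pos_pow2_rem.
have -> : (fun y : R => Num.max y 0 ^+ n.+3) = id * (fun y => Num.max y 0 ^+ n.+2).
  apply/funext => y; rewrite /GRing.mul/= exprS /Num.max; case: ltP => // y0.
  by rewrite !expr0n/= !mulr0.
apply: is_derive_eq.
rewrite /GRing.scale/= mulr1.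
have -> : (n.+3%:R : R) = n.+2%:R + 1 by rewrite -[n.+3]addn1 natrD.
rewrite [RHS]mulrDl mul1r; congr (_ + _).
rewrite mulrCA; congr (_ * _).
rewrite [RHS]exprS /Num.max; case: ltP => // x0; by rewrite !expr0n/= !mulr0.
Qed.

Lemma is_derive_pos_pow n x : is_derive x 1 (pos_pow n.+2) (pos_pow n.+1 x).
Proof.
have H := is_derive_pos_pow_mul n x.
have -> : pos_pow n.+2 = n.+2`!%:R^-1 \*: (fun y => Num.max y 0 ^+ n.+2).
  by apply/funext => y; rewrite /pos_pow mulrC.
apply: is_derive_eq; rewrite /GRing.scale/= /pos_pow [n.+2`!]factS natrM.
set a : R := n.+2%:R; set b : R := (n.+1)`!%:R.
have a0 : a != 0 by rewrite pnatr_eq0.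
have b0 : b != 0 by rewrite pnatr_eq0 -lt0n fact_gt0.
set z := Num.max x 0 ^+ n.+1.
have -> : (a * b)^-1 * (a * z) = (a^-1 * a) * (z / b) by rewrite invfM; ring.
by rewrite mulVf// mul1r.
Qed.

Definition bdiff f : R -> R := fun x => f x - f (x - 1).

Lemma is_derive_bdiff f g : (forall x, is_derive x 1 f (g x)) ->
  forall x, is_derive x 1 (bdiff f) (bdiff g x).
Proof.
move=> H x.
have H1 : is_derive x 1 (f \o (fun y => y - 1)) (g (x - 1)).
  rewrite -[g (x - 1)]mulr1.
  apply: is_derive1_comp.
  rewrite -[X in is_derive _ _ _ X](subr0 1); exact: is_deriveB.
exact: is_deriveB.
Qed.

Lemma is_derive_iter_bdiff j f g : (forall x, is_derive x 1 f (g x)) ->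
  forall x, is_derive x 1 (iter j bdiff f) (iter j bdiff g x).
Proof. by move=> H; elim: j => //= j IH x; exact: is_derive_bdiff. Qed.

Lemma mvt_bound f g x y (M : R) : (forall t, is_derive t 1 f (g t)) ->
  (forall t, `|t - x| <= `|y - x| -> `|g t| <= M) -> `|f y - f x| <= M * `|y - x|.
Proof.
move=> H hM.
have cf a b : {within `[a, b], continuous f}.
  apply: continuous_subspaceT => t.
  by apply/differentiable_continuous/derivable1_diffP; have [] := H t.
have [xy|yx] := leP x y.
  have [c] := MVT_segment xy (fun t _ => H t) (cf _ _).
  rewrite in_itv/= => /andP[c1 c2] ->; rewrite normrM ler_wpM2r// hM//.
  by rewrite !ger0_norm; lra.
have [c] := MVT_segment (ltW yx) (fun t _ => H t) (cf _ _).
rewrite in_itv/= => /andP[c1 c2]; rewrite distrC => ->.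
rewrite normrM [`|x - y|]distrC ler_wpM2r// hM//.
by rewrite !ler0_norm; lra.
Qed.

Lemma taylor_remainder f f1 f2 f3 (B : R) :
  (forall x, is_derive x 1 f (f1 x)) -> (forall x, is_derive x 1 f1 (f2 x)) ->
  (forall x, is_derive x 1 f2 (f3 x)) -> (forall x, `|f3 x| <= B) ->
  forall x y, `|f (x + y) - f x - f1 x * y - f2 x * y ^+ 2 / 2| <= B * `|y| ^+ 3.
Proof.
move=> d0 d1 d2 hB x y.
have B0 : 0 <= B by apply: le_trans (hB 0).
have s2 t : `|t - x| <= `|y| -> `|f2 t - f2 x| <= B * `|y|.
  move=> ht; apply: (le_trans (mvt_bound (M := B) d2 _)) => //.
  exact: ler_wpM2l.
have s1 t : `|t - x| <= `|y| -> `|f1 t - f1 x - f2 x * (t - x)| <= B * `|y| * `|y|.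
  move=> ht; pose g u := f1 u - f2 x * u.
  have dg u : is_derive u 1 g (f2 u - f2 x).
    have -> : g = f1 - (f2 x \*: id) by apply/funext.
    rewrite -[X in is_derive _ _ _ (_ - X)]mulr1; exact: is_deriveB.
  have -> : f1 t - f1 x - f2 x * (t - x) = g t - g x by rewrite /g; ring.
  apply: (le_trans (mvt_bound (M := B * `|y|) dg _)).
    by move=> u hu; apply: s2; exact: le_trans ht.
  by apply: ler_wpM2l => //; rewrite mulr_ge0.
pose g u := f u - f1 x * u - f2 x * (u - x) ^+ 2 / 2.
have dg u : is_derive u 1 g (f1 u - f1 x - f2 x * (u - x)).
  have -> : g = f - (f1 x \*: id) - ((f2 x / 2) \*: ((id - cst x) * (id - cst x))).
    apply/funext => v; rewrite /g !fctE /GRing.scale/=.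
    change (f v - f1 x * v - f2 x * (v - x) ^+ 2 / 2 =
      f v - f1 x * v - (f2 x / 2) * ((v - x) * (v - x))).
    by ring.
  apply: is_derive_eq; rewrite /GRing.scale/=.
  by change ((id - cst x) u) with (u - x); field.
have -> : f (x + y) - f x - f1 x * y - f2 x * y ^+ 2 / 2 = g (x + y) - g x.
  by rewrite /g; field.
have e : x + y - x = y by ring.
apply: (le_trans (mvt_bound (M := B * `|y| * `|y|) dg _)); rewrite e.
  by move=> u hu; exact: s1.
by have -> : B * `|y| * `|y| * `|y| = B * `|y| ^+ 3 by ring.
Qed.

(** The distribution function of a sum of [n] independent uniform variables on [0, 1] (the
    integrated cardinal B-spline), written as backward differences of a truncated power. *)
Definition smooth_step n : R -> R := iter n bdiff (pos_pow n).

Lemma continuous_bdiff f : continuous f -> continuous (bdiff f).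
Proof.
move=> cf x; apply: cvgB; first exact: cf.
apply: (continuous_comp (f := fun y : R => y - 1)); last exact: cf.
by apply: cvgB; [exact: cvg_id|exact: cvg_cst].
Qed.

Lemma continuous_max0 : continuous (fun x : R => Num.max x 0).
Proof.
by move=> x; apply: (continuous_max (f := id) (g := cst 0)); [exact: cvg_id|exact: cvg_cst].
Qed.

Lemma pos_pow1 : pos_pow 1 = fun x => Num.max x 0.
Proof. by apply/funext => x; rewrite /pos_pow expr1 divr1. Qed.

Lemma smooth_step1 x : smooth_step 1 x = Num.max x 0 - Num.max (x - 1) 0.
Proof. by rewrite /smooth_step/= pos_pow1. Qed.

Lemma is_derive_smooth_step n x :
  is_derive x 1 (smooth_step n.+2) (bdiff (smooth_step n.+1) x).
Proof.
exact: (is_derive_iter_bdiff n.+2 (is_derive_pos_pow n)).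
Qed.

Lemma is_derive_continuous f g : (forall x, is_derive x 1 f (g x)) -> continuous f.
Proof.
by move=> H x; apply/differentiable_continuous/derivable1_diffP; have [] := H x.
Qed.

Lemma continuous_smooth_step n : continuous (smooth_step n.+1).
Proof.
case: n => [|n]; last exact: is_derive_continuous (is_derive_smooth_step n).
by rewrite /smooth_step/= pos_pow1; apply: continuous_bdiff; exact: continuous_max0.
Qed.

(** A step is the unit increment of a primitive of the previous step, so the mean value theorem
    transfers the range [0, 1] and both plateaus by induction. *)
Lemma smooth_step_mean n x : exists2 t, x - 1 <= t <= x &
  smooth_step n.+2 x = smooth_step n.+1 t.
Proof.
(* One backward difference fewer than in [smooth_step n.+2]. *)
pose G := iter n.+1 bdiff (pos_pow n.+2).
have dG t : is_derive t 1 G (smooth_step n.+1 t).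
  exact: (is_derive_iter_bdiff n.+1 (is_derive_pos_pow n)).
have [t] := @MVT_segment _ G (smooth_step n.+1) (x - 1) x (ltac:(lra)) (fun t _ => dG t)
   (continuous_subspaceT (is_derive_continuous dG)).
rewrite in_itv/= => ht e; exists t => //.
rewrite -[RHS]mulr1; have -> : 1 = x - (x - 1) by ring.
by rewrite -e.
Qed.

Lemma smooth_step01 n x : 0 <= smooth_step n.+1 x <= 1.
Proof.
elim: n x => [|n IH] x; last by have [t _ ->] := smooth_step_mean n x.
by rewrite smooth_step1 /Num.max; case: ltP => h1; case: ltP => h2; apply/andP; split; lra.
Qed.

Lemma smooth_step_eq0 n x : x <= 0 -> smooth_step n.+1 x = 0.
Proof.
elim: n x => [|n IH] x x0.
  by rewrite smooth_step1 /Num.max; case: ltP => h1; case: ltP => h2; lra.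
by have [t /andP[_ tx] ->] := smooth_step_mean n x; rewrite IH//; lra.
Qed.

Lemma smooth_step_eq1 n x : n.+1%:R <= x -> smooth_step n.+1 x = 1.
Proof.
elim: n x => [|n IH] x x0.
  by rewrite smooth_step1 /Num.max; case: ltP => h1; case: ltP => h2; lra.
have [t /andP[tx _] ->] := smooth_step_mean n x; rewrite IH//.
by move: x0; rewrite -[n.+2]addn1 natrD; lra.
Qed.

Lemma iter_bdiff_bound j f (b : R) : (forall x, `|f x| <= b) ->
  forall x, `|iter j bdiff f x| <= 2 ^+ j * b.
Proof.
move=> hb; elim: j => [|j IH] x /=; first by rewrite expr0 mul1r.
rewrite /bdiff exprS; apply: (le_trans (ler_normB _ _)).
by have := IH x; have := IH (x - 1); lra.
Qed.

Lemma continuous_iter_bdiff j f : continuous f -> continuous (iter j bdiff f).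
Proof. by move=> cf; elim: j => //= j IH; exact: continuous_bdiff. Qed.

(* [step_d K j] is the [j]-th derivative of a [C^K] transition from 0 to 1 on [0, K+1]. *)
Definition step_d K j : R -> R := iter j bdiff (smooth_step (K.+1 - j)).

Lemma is_derive_step_d K j x : (j < K)%N -> is_derive x 1 (step_d K j) (step_d K j.+1 x).
Proof.
move=> jK; rewrite /step_d iterSr.
have -> : (K.+1 - j = (K.+1 - j.+1).-1.+2)%N by lia.
have -> : (K.+1 - j.+1 = (K.+1 - j.+1).-1.+1)%N by lia.
exact: (is_derive_iter_bdiff j (is_derive_smooth_step _)).
Qed.

Lemma step_d_bound K j x : (j <= K)%N -> `|step_d K j x| <= 2 ^+ K.
Proof.
move=> jK; apply: (le_trans (y := 2 ^+ j * 1)).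
  apply: iter_bdiff_bound => y.
  have -> : (K.+1 - j = (K - j).+1)%N by lia.
  by have /andP[h0 h1] := smooth_step01 (K - j) y; rewrite ger0_norm.
by rewrite mulr1 ler_weXn2l// ler1n.
Qed.

Lemma continuous_step_d K j : (j <= K)%N -> continuous (step_d K j).
Proof.
move=> jK; apply: continuous_iter_bdiff.
have -> : (K.+1 - j = (K - j).+1)%N by lia.
exact: continuous_smooth_step.
Qed.

(** The [j]-th derivative of the step composed with an affine map; a^j is the chain-rule factor. *)
Definition step_aff K (a b : R) j : R -> R := fun x => a ^+ j * step_d K j (a * x + b).

Lemma is_derive_step_aff K a b j x : (j < K)%N ->
  is_derive x 1 (step_aff K a b j) (step_aff K a b j.+1 x).
Proof.
move=> jK.
have H : is_derive x 1 (step_d K j \o (fun y => a * y + b)) (step_d K j.+1 (a * x + b) * a).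
  apply: is_derive1_comp; first exact: is_derive_step_d.
  have -> : (fun y => a * y + b) = (a \*: id) + cst b by apply/funext.
  by apply: is_derive_eq; rewrite addr0 /GRing.scale/= mulr1.
have -> : step_aff K a b j = a ^+ j \*: (step_d K j \o (fun y => a * y + b)) by apply/funext.
by apply: is_derive_eq; rewrite /step_aff /GRing.scale/= exprSr; ring.
Qed.

Lemma step_aff_bound K a b j x : (j <= K)%N ->
  `|step_aff K a b j x| <= 2 ^+ K * `|a| ^+ j.
Proof.
move=> jK; rewrite /step_aff normrM normrX mulrC; apply: ler_wpM2r; first exact: exprn_ge0.
exact: step_d_bound.
Qed.

Lemma continuous_step_aff K a b j : (j <= K)%N -> continuous (step_aff K a b j).
Proof.
move=> jK x; apply: cvgM; first exact: cvg_cst.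
apply: (continuous_comp (f := fun y : R => a * y + b)); last exact: continuous_step_d.
by apply: cvgD; [apply: cvgM; [exact: cvg_cst|exact: cvg_id]|exact: cvg_cst].
Qed.

End smooth_step.

(** * Lagrange interpolation on a grid *)

Section lagrange_bound.
Context (R : realType).

(** Nodes in [0, 1] at mutual distance at least q/M make each of the n - 1 factors of a Lagrange
    basis polynomial at most M/q on [0, 1]. *)
Lemma lagrange_bound (n M q : nat) (f : nat -> nat) (p : {poly R}) (h a : R) :
  injective f -> (0 < n)%N -> (0 < q)%N -> (forall i, (i < n)%N -> (f i < M)%N) ->
  (forall i j, (i < n)%N -> (j < n)%N -> i != j ->
    (f i + q <= f j)%N || (f j + q <= f i)%N) ->
  (size p <= n)%N -> (forall i, (i < n)%N -> `|p.[(f i)%:R / M%:R]| <= h) ->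
  0 <= a <= 1 -> `|p.[a]| <= n%:R * h * (M%:R / q%:R) ^+ n.-1.
Proof.
move=> finj n0 q0 fM fq sp ph /andP[a0 a1].
have M0 : (0 < M)%N by apply: leq_ltn_trans (fM 0%N n0).
have MR : 0 < (M%:R : R) by rewrite ltr0n.
have qR : 0 < (q%:R : R) by rewrite ltr0n.
pose x (i : nat) : R := (f i)%:R / M%:R.
have xinj : injective x.
  by move=> i j /divIf -/(_ (lt0r_neq0 MR)) /eqP; rewrite eqr_nat => /eqP /finj.
have -> : p.[a] = \sum_(i < n) p.[x i] * (tnth (lagrange n x) i : {poly R}).[a].
  rewrite [p in LHS](lagrange_gen n0 xinj sp) horner_sum.
  by apply: eq_bigr => i _; rewrite hornerM hornerC.
apply: (le_trans (ler_norm_sum _ _ _)).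
have -> : n%:R * h * (M%:R / q%:R) ^+ n.-1 =
    \sum_(i < n) (h * (M%:R / q%:R) ^+ n.-1).
  by rewrite sumr_const card_ord -[RHS]mulr_natl mulrA.
apply: ler_sum => i _; rewrite normrM; apply: ler_pM => //; first exact: ph.
rewrite lagrangeE// hornerM hornerC !horner_prod -prodfV -big_split/=.
rewrite normr_prod.
have -> : (M%:R / q%:R : R) ^+ n.-1 = \prod_(j < n | j != i) (M%:R / q%:R).
  by rewrite prodr_const; congr (_ ^+ _); rewrite cardC1 card_ord.
apply: ler_prod => j ji; apply/andP; split => //.
rewrite !hornerXsubC normrM normfV mulrC.
have xi01 (k : 'I_n) : 0 <= x k <= 1.
  rewrite divr_ge0//= ler_pdivrMr// mul1r ler_nat; exact/ltnW/fM.
have h1 : `|a - x j| <= 1.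
  by have /andP[? ?] := xi01 j; rewrite ler_norml; apply/andP; split; lra.
have h2 : q%:R / M%:R <= `|x i - x j|.
  rewrite /x -mulrBl normrM [X in _ <= _ * X]ger0_norm ?invr_ge0//.
  apply: ler_wpM2r => //.
  have ij : (i : nat) != j by rewrite eq_sym.
  case/orP: (fq i j (ltn_ord i) (ltn_ord j) ij) => h3.
    rewrite distrC; apply: le_trans (ler_norm _).
    by rewrite lerBrDl -natrD ler_nat.
  by apply: le_trans (ler_norm _); rewrite lerBrDl -natrD ler_nat.
have e : M%:R / q%:R = (q%:R / M%:R)^-1 :> R by rewrite invf_div.
rewrite e -[leRHS]mul1r; apply: ler_pM => //.
by rewrite lef_pV2// posrE ?divr_gt0// (lt_le_trans _ h2)// divr_gt0.
Qed.

Lemma nth_sorted_gap (s : seq nat) (i k : nat) : sorted ltn s -> (i + k < size s)%N ->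
  (nth 0 s i + k <= nth 0 s (i + k))%N.
Proof.
move=> ss; elim: k => [|k IH] h; first by rewrite !addn0.
have h' : (i + k < size s)%N by lia.
rewrite !addnS; apply: leq_ltn_trans (IH h') _.
by apply: (sorted_ltn_nth ltn_trans); rewrite // inE -?addnS//; lia.
Qed.

(** Among more than n q good grid points, every q-th one is kept; this yields n + 1 nodes with gaps
    at least q. *)
Lemma poly_small_count (n M q : nat) (p : {poly R}) (h a : R) :
  (0 < q)%N -> (size p <= n.+1)%N ->
  (n * q < count (fun j : nat => `|p.[j%:R / M%:R]| <= h)%R (iota 0 M))%N ->
  0 <= a <= 1 -> `|p.[a]| <= n.+1%:R * h * (M%:R / q%:R) ^+ n.
Proof.
move=> q0 sp hc a01; set Q := fun j : nat => _ in hc.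
pose s := [seq j <- iota 0 M | Q j].
have sz : (n * q < size s)%N by rewrite size_filter.
have ss : sorted ltn s by apply: sorted_filter; [exact: ltn_trans|exact: iota_ltn_sorted].
have ms i : (i < size s)%N -> (nth 0 s i < M)%N && Q (nth 0 s i).
  by move=> /(mem_nth 0); rewrite mem_filter mem_iota /= => /andP[-> ->].
(* Past [n] the values M + i serve only to make [f] injective on all naturals, as the interpolation
   formula demands. *)
pose f i := if (i <= n)%N then nth 0 s (i * q) else (M + i)%N.
have fin i : (i <= n)%N -> (i * q < size s)%N.
  by move=> hi; apply: leq_ltn_trans sz; rewrite leq_mul2r hi orbT.
have fM i : (i < n.+1)%N -> (f i < M)%N.
  by rewrite ltnS /f => hi; rewrite hi; have /andP[] := ms _ (fin i hi).
have gap i j : (i < j)%N -> (j <= n)%N -> (f i + q <= f j)%N.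
  move=> ij jn; rewrite /f jn (leq_trans (ltnW ij) jn).
  have e : (j * q = i * q + (j - i) * q)%N by rewrite -mulnDl subnKC// ltnW.
  have := @nth_sorted_gap s (i * q) ((j - i) * q) ss; rewrite -e => /(_ (fin j jn)).
  by apply: leq_trans; rewrite leq_add2l leq_pmull// subn_gt0.
have finj : injective f.
  move=> i j; wlog ij : i j / (i < j)%N.
    by move=> H e; have [/H->|/H->|] := ltngtP i j.
  have [jn|jn] := leqP j n; first by have := gap i j ij jn; lia.
  have [iN|iN] := leqP i n; last first.
    by rewrite /f (leqNgt j) jn (leqNgt i) iN/=; exact: addnI.
  have fj : f j = (M + j)%N by rewrite /f leqNgt jn.
  by have := fM i iN; rewrite fj; lia.
apply: (lagrange_bound (f := f) finj _ q0 fM) => //.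
  move=> i j hi hj ij; have [ij'|ij'|e] := ltngtP i j.
  - by rewrite gap.
  - by rewrite (gap j i) ?orbT.
  - by rewrite e eqxx in ij.
by move=> i hi; rewrite /f -ltnS hi; have /andP[] := ms _ (fin i hi).
Qed.

End lagrange_bound.

(** * Rotated blocks *)

Section rotation.
Context (R : realType) (m : nat).
Implicit Types (z : nat -> 'I_m -> R).

(** Cosine in the rational parametrisation of the circle by the tangent of the half-angle: clearing
    denominators leaves a polynomial in [u], and [0, 1] is a quarter turn. *)
Definition rot_c (u : R) : R := (1 - u ^+ 2) / (1 + u ^+ 2).
Definition rot_s (u : R) : R := 2 * u / (1 + u ^+ 2).

Lemma one_plus_sqr_gt0 (u : R) : 0 < 1 + u ^+ 2.
Proof. by have := sqr_ge0 u; lra. Qed.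

Lemma rot_sq (u : R) : rot_c u ^+ 2 + rot_s u ^+ 2 = 1.
Proof. by rewrite /rot_c /rot_s; field; rewrite gt_eqF// one_plus_sqr_gt0. Qed.

Definition rotv (u : R) z1 z2 : nat -> 'I_m -> R :=
  fun k i => rot_c u * z1 k i + rot_s u * z2 k i.

(** Each variable clears one factor 1 + u^2; the extra power supplies the missing ones, so that
    every monomial is multiplied by the same (1 + u^2)^N. *)
Definition mono_poly (N : nat) z1 z2 (a : seq (nat * 'I_m)) : {poly R} :=
  (\prod_(x <- a) ((1 - 'X ^+ 2) * (z1 x.1 x.2)%:P + 2%:P * 'X * (z2 x.1 x.2)%:P)) *
  (1 + 'X ^+ 2) ^+ (N - size a).

Lemma size_mul_deg (p q : {poly R}) (i j : nat) : (size p <= i.+1)%N -> (size q <= j.+1)%N ->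
  (size (p * q)%R <= (i + j).+1)%N.
Proof. by move=> hp hq; apply: leq_trans (size_polyMleq p q) _; lia. Qed.

Lemma size_quad1 : (size (1 + 'X ^+ 2 : {poly R})%R <= 3)%N.
Proof.
apply: leq_trans (size_polyD _ _) _.
by rewrite geq_max size_poly1 size_polyXn.
Qed.

Lemma size_mono_poly N z1 z2 a : (size a <= N)%N ->
  (size (mono_poly N z1 z2 a) <= (2 * N).+1)%N.
Proof.
move=> sa; have -> : (2 * N = 2 * size a + 2 * (N - size a))%N by lia.
apply: size_mul_deg.
  elim: a {sa} => [|x a IH]; first by rewrite big_nil size_poly1.
  rewrite big_cons /= mulnS; apply: size_mul_deg => //.
  apply: leq_trans (size_polyD _ _) _; rewrite geq_max; apply/andP; split.
    have := @size_mul_deg (1 - 'X ^+ 2) (z1 x.1 x.2)%:P 2 0; apply.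
      apply: leq_trans (size_polyD _ _) _.
      by rewrite geq_max size_poly1 size_polyN size_polyXn.
    exact: size_polyC_leq1.
  have h : (size (2%:P * 'X : {poly R})%R <= 2)%N.
    have := @size_mul_deg 2%:P 'X 0 1; apply; first exact: size_polyC_leq1.
    by rewrite size_polyX.
  have := @size_mul_deg (2%:P * 'X) (z2 x.1 x.2)%:P 1 0 h (size_polyC_leq1 _).
  by move=> /leq_trans; apply.
elim: (N - size a)%N => [|k IH]; first by rewrite expr0 size_poly1.
rewrite exprS mulnS; apply: size_mul_deg => //; exact: size_quad1.
Qed.

Lemma horner_mono_poly N z1 z2 a u : (size a <= N)%N ->
  (mono_poly N z1 z2 a).[u] = (1 + u ^+ 2) ^+ N * mono (rotv u z1 z2) a.
Proof.
move=> sa; rewrite /mono_poly hornerM horner_prod horner_exp.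
have -> : (1 + 'X ^+ 2 : {poly R}).[u] = 1 + u ^+ 2.
  by rewrite hornerD hornerXn hornerE.
rewrite -{2}(subnK sa) exprD -mulrA mulrC; congr (_ * _).
have nz : 1 + u ^+ 2 != 0 by rewrite gt_eqF// one_plus_sqr_gt0.
rewrite /mono; elim: a {sa} => [|x a IH]; first by rewrite !big_nil expr0 mulr1.
rewrite !big_cons [(1 + u ^+ 2) ^+ size (x :: a)]exprS mulrACA -IH; congr (_ * _).
rewrite /rotv /rot_c /rot_s !hornerE; field; exact: nz.
Qed.

Definition rot_poly (L N : nat) (c : seq (nat * 'I_m) -> R) z1 z2 (x : R) : {poly R} :=
  \sum_(a <- mis m L | (size a <= N)%N) c a *: mono_poly N z1 z2 a -
  x *: (1 + 'X ^+ 2) ^+ N.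

Lemma size_rot_poly L N c z1 z2 x : (size (rot_poly L N c z1 z2 x) <= (2 * N).+1)%N.
Proof.
apply: leq_trans (size_polyD _ _) _; rewrite geq_max size_polyN; apply/andP; split.
  elim/big_ind : _ => [|p q hp hq|a sa]; first by rewrite size_poly0.
    by apply: leq_trans (size_polyD _ _) _; rewrite geq_max hp.
  exact: leq_trans (size_scale_leq _ _) (size_mono_poly _ _ sa).
apply: leq_trans (size_scale_leq _ _) _.
have := @size_mono_poly N z1 z2 [::] (leq0n _).
by rewrite /mono_poly big_nil mul1r subn0.
Qed.

Lemma horner_rot_poly L N c z1 z2 x u : vanL L N c ->
  (rot_poly L N c z1 z2 x).[u] = (1 + u ^+ 2) ^+ N * (mpoly L c (rotv u z1 z2) - x).
Proof.
move=> vc; rewrite /rot_poly hornerD hornerN hornerZ horner_exp.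
have -> : (1 + 'X ^+ 2 : {poly R}).[u] = 1 + u ^+ 2 by rewrite hornerD hornerXn hornerE.
rewrite mulrBr [x * _]mulrC; congr (_ - _).
rewrite horner_sum /mpoly mulr_sumr big_mkcond/= big_seq [RHS]big_seq.
apply: eq_bigr => a aL; case: leqP => sa.
  by rewrite hornerZ horner_mono_poly// mulrCA.
by rewrite vc// mul0r mulr0.
Qed.

(* If the random rotation angle makes [mpoly - x] small for more than a fraction
   [2^-i] of the grid, then both endpoints [z1] (angle 0) and [z2] (angle pi/2) do. *)
Lemma rotation_count L N c z1 z2 (x h : R) (i I : nat) : (i <= I)%N -> vanL L N c -> 0 <= h ->
  (2 * N * 2 ^ (I - i) < count (fun j : nat =>
     `|mpoly L c (rotv (j%:R / (2 ^ I)%:R) z1 z2) - x| <= h)%R (iota 0 (2 ^ I)))%N ->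
  `|mpoly L c z1 - x| <= (2 * N).+1%:R * 2 ^+ N * h * 4 ^+ (N * i) /\
  `|mpoly L c z2 - x| <= (2 * N).+1%:R * 2 ^+ N * h * 4 ^+ (N * i).
Proof.
move=> iI vc h0 hc; pose p := rot_poly L N c z1 z2 x.
pose M := (2 ^ I)%N.
have M0 : (0 < M)%N by rewrite expn_gt0.
have key (a : R) : 0 <= a <= 1 ->
    `|p.[a]| <= (2 * N).+1%:R * 2 ^+ N * h * 4 ^+ (N * i).
  move=> a01.
  have -> : (2 * N).+1%:R * 2 ^+ N * h * 4 ^+ (N * i) =
     (2 * N).+1%:R * (2 ^+ N * h) * (M%:R / (2 ^ (I - i))%:R) ^+ (2 * N).
    rewrite -!mulrA; congr (_ * (_ * (_ * _))).
    have -> : (M%:R / (2 ^ (I - i))%:R : R) = 2 ^+ i.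
      have -> : (M = 2 ^ (I - i) * 2 ^ i)%N by rewrite -expnD subnK.
      by rewrite natrM mulrAC divff ?mul1r ?natrX.
    have -> : (4 : R) = 2 ^+ 2 by ring.
    by rewrite -!exprM; congr (_ ^+ _); lia.
  apply: poly_small_count => //; first by rewrite expn_gt0.
    exact: size_rot_poly.
  apply: (leq_trans hc); rewrite -/M.
  rewrite -!size_filter; apply: uniq_leq_size; first by rewrite filter_uniq// iota_uniq.
  move=> j; rewrite !mem_filter mem_iota add0n => /andP[hj /=  jM]; rewrite jM andbT.
  rewrite horner_rot_poly// normrM; apply: ler_pM => //.
  (* On [0, 1] the cleared denominator is at most 2^N, the origin of that factor in the bound. *)
  have u01 : 0 <= (j%:R / M%:R : R) <= 1.
    by rewrite divr_ge0//= ler_pdivrMr ?ltr0n// mul1r ler_nat ltnW.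
  have /andP[u0 u1] := u01.
  have u2 : 0 <= 1 + (j%:R / M%:R : R) ^+ 2 by exact/ltW/one_plus_sqr_gt0.
  rewrite ger0_norm ?exprn_ge0//; apply: lerXn2r; rewrite ?nnegrE//.
  nra.
have e0 : rotv 0 z1 z2 = z1.
  apply/funext => k; apply/funext => j; rewrite /rotv /rot_c /rot_s.
  by rewrite expr0n/= mulr0 mul0r mul0r subr0 !addr0 divr1 mul1r.
have e1 : rotv 1 z1 z2 = z2.
  apply/funext => k; apply/funext => j; rewrite /rotv /rot_c /rot_s.
  by rewrite expr1n subrr mul0r mul0r add0r mulr1 divff ?mul1r.
split.
  have := key 0; rewrite lexx ler01 => /(_ isT).
  by rewrite horner_rot_poly// e0 expr0n addr0 expr1n mul1r.
have := key 1; rewrite ler01 lexx => /(_ isT).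
rewrite horner_rot_poly// e1 expr1n normrM; apply: le_trans.
by rewrite ler_peMl// ger0_norm ?exprn_ege1 ?exprn_ge0//; lra.
Qed.

End rotation.

(** * A smooth bump at a given scale *)

Section bump.
Context (R : realType).
Implicit Types (x h y : R).

(** The [j]-th derivative of a bump rising on [x - 2h, x - h] and falling on [x + h, x + 2h]. The
    step of order 3 rises on [0, 4], hence the slope 4/h; order 3 is what Lindeberg's remainder
    requires. *)
Definition bump (x h : R) (j : nat) (y : R) : R :=
  step_aff 3 (4 / h) (- (4 / h) * (x - 2 * h)) j y -
  step_aff 3 (4 / h) (- (4 / h) * (x + h)) j y.

Lemma step_d0 K : @step_d R K 0 = smooth_step K.+1.
Proof. by rewrite /step_d subn0. Qed.

Lemma is_derive_bump x h j y : (j < 3)%N -> is_derive y 1 (bump x h j) (bump x h j.+1 y).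
Proof.
move=> j3; have -> : bump x h j = step_aff 3 (4 / h) (- (4 / h) * (x - 2 * h)) j -
  step_aff 3 (4 / h) (- (4 / h) * (x + h)) j by apply/funext.
by apply: is_deriveB; exact: is_derive_step_aff.
Qed.

Lemma bump_bound x h j y : (j <= 3)%N -> 0 < h -> `|bump x h j y| <= 16 * (4 / h) ^+ j.
Proof.
move=> j3 h0; apply: (le_trans (ler_normB _ _)).
have a0 : 0 <= 4 / h by rewrite divr_ge0// ltW.
have h1 := step_aff_bound (4 / h) (- (4 / h) * (x - 2 * h)) y j3.
have h2 := step_aff_bound (4 / h) (- (4 / h) * (x + h)) y j3.
rewrite (ger0_norm a0) in h1 h2; have e : (2 : R) ^+ 3 = 8 by ring.
by rewrite e in h1 h2; lra.
Qed.

Lemma bump_val x h y : 0 < h -> [/\ 0 <= bump x h 0 y <= 1,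
  `|y - x| <= h -> bump x h 0 y = 1 & 2 * h < `|y - x| -> bump x h 0 y = 0].
Proof.
move=> h0; rewrite /bump /step_aff !expr0 !mul1r step_d0.
have e1 : 4 / h * y + - (4 / h) * (x - 2 * h) = 4 * ((y - x) / h) + 8.
  by field; rewrite gt_eqF.
have e2 : 4 / h * y + - (4 / h) * (x + h) = 4 * ((y - x) / h) - 4.
  by field; rewrite gt_eqF.
rewrite e1 e2; set t := (y - x) / h.
have ty : y - x = t * h by rewrite /t mulfVK// gt_eqF.
have E1 : -1 <= t -> smooth_step 4 (4 * t + 8) = 1.
  by move=> ht; apply: smooth_step_eq1; lra.
have E2 : t <= 1 -> smooth_step 4 (4 * t - 4) = 0.
  by move=> ht; apply: smooth_step_eq0; lra.
have /andP[a0 a1] := smooth_step01 3 (4 * t + 8).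
have /andP[b0 b1] := smooth_step01 3 (4 * t - 4).
have n1 : (`|y - x| <= h) = (`|t| <= 1).
  by rewrite ty normrM (gtr0_norm h0) ger_pMl.
have n2 : (2 * h < `|y - x|) = (2 < `|t|).
  by rewrite ty normrM (gtr0_norm h0) ltr_pM2r.
rewrite n1 n2; split.
- by have [ht|ht] := leP t 1; [rewrite E2// subr0 a0|rewrite E1; [|lra]; apply/andP; split; lra].
- by rewrite ler_norml => /andP[h1 h2]; rewrite E1// E2// subr0.
- have [t0|t0] := leP 0 t.
    rewrite ger0_norm// => t2; rewrite E1; last lra.
    by rewrite smooth_step_eq1 ?subrr//; lra.
  rewrite ltr0_norm// => t2; rewrite E2; last lra.
  by rewrite smooth_step_eq0 ?subrr//; lra.
Qed.

Lemma continuous_measurable_fun (f : R -> R) : continuous f -> measurable_fun setT f.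
Proof. exact: continuous_measurable_fun. Qed.

Lemma bump_taylor3 x h : 0 < h ->
  exists b, taylor3 (bump x h 0) (bump x h 1) (bump x h 2) b (16 * (4 / h) ^+ 3).
Proof.
move=> h0; have cont j : (j <= 3)%N -> continuous (bump x h j).
  by move=> j3 y; apply: cvgB; exact: continuous_step_aff.
have mb j : (j <= 3)%N -> measurable_fun setT (bump x h j).
  by move=> j3; apply: continuous_measurable_fun; exact: cont.
have a0 j : 0 <= 16 * (4 / h) ^+ j by rewrite mulr_ge0// exprn_ge0// divr_ge0// ltW.
exists (16 * (4 / h) ^+ 0 + 16 * (4 / h) ^+ 1 + 16 * (4 / h) ^+ 2); split.
- exact: mb.
- exact: mb.
- exact: mb.
- move=> y; have := @bump_bound x h 0 y isT h0; have := a0 1%N; have := a0 2%N; lra.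
- move=> y; have := @bump_bound x h 1 y isT h0; have := a0 0%N; have := a0 2%N; lra.
- move=> y; have := @bump_bound x h 2 y isT h0; have := a0 0%N; have := a0 1%N; lra.
- have D0 y := @is_derive_bump x h 0 y isT.
  have D1 y := @is_derive_bump x h 1 y isT.
  have D2 y := @is_derive_bump x h 2 y isT.
  exact: (taylor_remainder D0 D1 D2 (fun y => @bump_bound x h 3 y isT h0)).
Qed.

End bump.

(** * Anticoncentration *)

Section anticoncentration.
Context (d : measure_display) (T : measurableType d) (R : realType)
  (P : probability T R).
Local Notation Er := (Er P).
Local Notation ig := (ig P).
Local Notation L4 := (L4 P).
Local Notation pr := (pr P).

Lemma measurable_le_set (f g : T -> R) : measurable_fun setT f -> measurable_fun setT g ->
  measurable [set w | f w <= g w].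
Proof.
by move=> mf mg; rewrite -[X in measurable X]setTI; exact: measurable_fun_le.
Qed.

Lemma measurable_ball_set (f : T -> R) (x s : R) : measurable_fun setT f ->
  measurable [set w | `|f w - x| <= s].
Proof.
move=> mf; apply: measurable_le_set; last exact: measurable_cst.
by apply: measurableT_comp => //; apply: measurable_funB => //; exact: measurable_cst.
Qed.

Lemma indicE_if (A : set T) w : (\1_A w : R) = if w \in A then 1 else 0.
Proof. by rewrite indicE; case: (w \in A). Qed.

(* Paley-Zygmund, from [1_(|U| > s) >= 2 t (U^2 - m/2) - t^2 U^4] with [t = 1/(2 C m)]. *)
Lemma paley_zygmund (U : T -> R) (C s : R) : L4 U -> 0 < Er (fun w => U w ^+ 2) ->
  Er (fun w => U w ^+ 4) <= C * Er (fun w => U w ^+ 2) ^+ 2 -> 0 < C -> 0 <= s ->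
  s ^+ 2 <= Er (fun w => U w ^+ 2) / 2 ->
  pr [set w | `|U w| <= s] <= 1 - (4 * C)^-1.
Proof.
move=> hU; set m := Er (fun w => U w ^+ 2) => m0 h4 C0 s0 hs.
pose t := (2 * C * m)^-1.
have t0 : 0 < t by rewrite invr_gt0 !mulr_gt0.
have mU : measurable_fun setT U by case: hU.
have mA : measurable [set w | `|U w| <= s].
  by apply: measurable_le_set; [exact: measurableT_comp|exact: measurable_cst].
set A := [set w | _] in mA *.
have i2 : ig (fun w => U w ^+ 2).
  by have := ig_mul2 hU hU; under eq_fun do rewrite -expr2.
have i4 : ig (fun w => U w ^+ 4) by case: hU.
have iR : ig (fun w => (2 * t) * U w ^+ 2 - t ^+ 2 * U w ^+ 4).
  by apply: igB; exact: igZ.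
have iL : ig (fun w => (1 + t * m) - \1_A w).
  by apply: igB; [exact: ig_cst|exact: ig_indic].
have pw w : (2 * t) * U w ^+ 2 - t ^+ 2 * U w ^+ 4 <= (1 + t * m) - \1_A w.
  have e4 : U w ^+ 4 = (U w ^+ 2) ^+ 2 by rewrite -exprM.
  rewrite indicE_if e4; case: ifPn => [/set_mem/= hw|_].
    have : U w ^+ 2 <= s ^+ 2 by rewrite -[U w ^+ 2]real_normK ?num_real// lerXn2r ?nnegrE.
    have := sqr_ge0 (t * U w ^+ 2); nra.
  have := sqr_ge0 (1 - t * U w ^+ 2); have : 0 <= t * m by rewrite mulr_ge0// ltW.
  nra.
have := Er_le iR iL pw.
rewrite ErB; [|exact: igZ|exact: igZ]; rewrite !ErZ//.
rewrite ErB; [|exact: ig_cst|exact: ig_indic]; rewrite Er_cst Er_indic// -/m => H.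
have e1 : t * m = (2 * C)^-1 by rewrite /t; field; rewrite !gt_eqF.
have e2 : t ^+ 2 * (C * m ^+ 2) = (4 * C)^-1 by rewrite /t; field; rewrite !gt_eqF.
have e3 : t ^+ 2 * Er (fun w => U w ^+ 4) <= t ^+ 2 * (C * m ^+ 2).
  by apply: ler_wpM2l => //; exact: sqr_ge0.
have e5 : (2 * C)^-1 = 2 * (4 * C)^-1 by field; rewrite gt_eqF.
have : pr A <= 1 + t * m - 2 * (t * m) + (4 * C)^-1 by lra.
rewrite e1 e5; lra.
Qed.

Context (Pi : nat -> set (set T)) (L : nat) (HPi : pi_family P Pi L) (m : nat).
Local Notation good_env := (good_env P Pi L).
Local Notation mbs := (mbs Pi L).
Local Notation hyp := (hyp_cst m).
Implicit Types (V : nat -> 'I_m -> T -> R) (c : seq (nat * 'I_m) -> R).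

Lemma measurable_ev K V c : good_env K V -> measurable_fun setT (ev L c V).
Proof. by move=> gV; have [] := L4_ev HPi c (good_regular gV) (leqnn L). Qed.

(** Putting the shift into the empty multi-index makes G - x a chaos of the same degree, to which
    the moment bounds apply. *)
Definition recentre c (x : R) : seq (nat * 'I_m) -> R :=
  fun a => if a == [::] then c [::] - x else c a.

Lemma nil_mis : [::] \in mis m L.
Proof. by rewrite mem_mis. Qed.

Lemma mpoly_recentre c x (v : nat -> 'I_m -> R) : mpoly L (recentre c x) v = mpoly L c v - x.
Proof.
rewrite /mpoly !(bigD1_seq _ nil_mis (uniq_mis m L))/= /recentre eqxx /mono big_nil !mulr1.
rewrite [LHS]addrAC; congr (_ + _ - _); apply: eq_bigr => a /negbTE an.
by rewrite an.
Qed.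

(** Second and fourth moments of the recentred chaos are comparable, so Paley-Zygmund applies. Only
    top-degree coefficients bound its norm below uniformly in [x], whence |c|_N. *)
Lemma small_ball_lt1 K lam V N c (x s : R) : 1 <= K -> good_env K V -> cov_ge P L lam V ->
  0 < lam <= 1 -> vanL L N c -> (0 < N)%N -> 0 < s ->
  s ^+ 2 <= lam ^+ N * (\sum_(a <- mis m L | size a == N) c a ^+ 2) / 2 ->
  pr [set w | `|ev L c V w - x| <= s] <=
    1 - (4 * (hyp K ^+ N / lam ^+ N) ^+ 2)^-1.
Proof.
move=> K1 gV cV /andP[l0 l1] vc N0 s0 hs.
have hyp1 : 1 <= hyp K.
  have : (1 : R) <= m.+1%:R ^+ 2 by rewrite exprn_ege1// ler1n.
  rewrite /hyp_cst; nra.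
have hypN : 0 < hyp K ^+ N by rewrite exprn_gt0//; lra.
have lN : 0 < lam ^+ N by rewrite exprn_gt0.
have vx : vanL L N (recentre c x).
  by move=> a aL sa; rewrite /recentre; case: eqP => [e|_]; [rewrite e in sa|exact: vc].
have ex : ev L (recentre c x) V = fun w => ev L c V w - x.
  by apply/funext => w; rewrite /ev mpoly_recentre.
have top : \sum_(a <- mis m L | size a == N) c a ^+ 2 <= nrm2 L (recentre c x).
  rewrite /nrm2 [leRHS](bigID (fun a => size a == N))/=.
  have -> : \sum_(a <- mis m L | size a == N) c a ^+ 2 =
     \sum_(a <- mis m L | size a == N) recentre c x a ^+ 2.
    by apply: eq_bigr => a /eqP sa; rewrite /recentre; case: eqP => // e; rewrite e /= in sa; lia.
  by rewrite lerDl sumr_ge0// => a _; exact: sqr_ge0.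
have h4 := hyper4 HPi K1 gV (leqnn L) vx.
have l01 : 0 <= lam <= 1 by rewrite ltW.
have h2 := second_moment_ge HPi gV cV l01 (leqnn L) vx.
rewrite ex in h4 h2.
have hU := L4_ev HPi (recentre c x) (good_regular gV) (leqnn L); rewrite ex in hU.
have ms : s ^+ 2 <= Er (fun w => (ev L c V w - x) ^+ 2) / 2.
  apply: (le_trans hs); apply: ler_wpM2r => //; apply: le_trans h2.
  by apply: ler_wpM2l => //; exact: ltW.
have s2 : 0 < s ^+ 2 by rewrite exprn_gt0.
apply: (paley_zygmund hU) => //; last 2 first.
- by rewrite exprn_gt0// divr_gt0.
- exact: ltW.
- lra.
apply: (le_trans h4); rewrite -exprMn lerXn2r ?nnegrE//.
- by rewrite mulr_ge0 ?nrm2_ge0// ltW.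
- by rewrite mulr_ge0// ?Er_ge0//; [rewrite divr_ge0// ltW|move=> w; exact: sqr_ge0].
by rewrite -mulrA; apply: ler_wpM2l; [exact: ltW|rewrite ler_pdivlMl].
Qed.

Definition rotV (u : R) V1 V2 : nat -> 'I_m -> T -> R :=
  fun k i w => rot_c u * V1 k i w + rot_s u * V2 k i w.

(* [V1] and [V2] play the role of two independent copies of the same blocks. *)
Record twin K V1 V2 : Prop := Twin {
  twin_good1 : good_env K V1;
  twin_good2 : good_env K V2;
  twin_cov : forall k, (k < L)%N -> forall i j,
    Er (fun w => V1 k i w * V1 k j w) = Er (fun w => V2 k i w * V2 k j w);
  twin_cross : forall k, (k < L)%N -> forall i j,
    Er (fun w => V1 k i w * V2 k j w) = 0;
  twin_ball : forall c x s,
    pr [set w | `|ev L c V1 w - x| <= s /\ `|ev L c V2 w - x| <= s] <=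
    pr [set w | `|ev L c V1 w - x| <= s] ^+ 2 }.

(** The factor 8 is that of (x + y)^4 <= 8 (x^4 + y^4), and the fourth powers of cosine and sine sum
    to at most 1; it does not depend on the angle. *)
Lemma rot_good K V1 V2 u : 1 <= K -> twin K V1 V2 -> good_env (8 * K) (rotV u V1 V2).
Proof.
move=> K1 [g1 g2 _ _ _] k kL i.
have [s1 l1 e1 q1] := g1 k kL i; have [s2 l2 e2 q2] := g2 k kL i.
have l : L4 (rotV u V1 V2 k i) by apply: L4D; exact: L4Z.
split => //.
- by apply: mbsD; apply: mbsM => //; exact: mbs_cst.
- rewrite /rotV ErD; [|by apply: igZ; exact: L4_ig|by apply: igZ; exact: L4_ig].
  by rewrite !ErZ; [|exact: L4_ig|exact: L4_ig]; rewrite e1 e2 !mulr0 addr0.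
have i1 : ig (fun w => V1 k i w ^+ 4) by case: l1.
have i2 : ig (fun w => V2 k i w ^+ 4) by case: l2.
set a := rot_c u; set b := rot_s u.
apply: (le_trans (y := Er (fun w => 8 * a ^+ 4 * V1 k i w ^+ 4 + 8 * b ^+ 4 * V2 k i w ^+ 4))).
  apply: Er_le; [by case: l|by apply: igD; exact: igZ|move=> w].
  by apply: (le_trans (exprD4_le _ _)); rewrite !exprMn mulrDr !mulrA.
rewrite ErD; [|exact: igZ|exact: igZ]; rewrite !ErZ//.
have ab : a ^+ 2 + b ^+ 2 = 1 by exact: rot_sq.
have a4 : 0 <= a ^+ 4 by rewrite exprn_even_ge0.
have b4 : 0 <= b ^+ 4 by rewrite exprn_even_ge0.
have ab4 : a ^+ 4 + b ^+ 4 <= 1.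
  have := mulr_ge0 (sqr_ge0 a) (sqr_ge0 b); nra.
have h1 : 8 * a ^+ 4 * Er (fun w => V1 k i w ^+ 4) <= 8 * a ^+ 4 * K.
  by apply: ler_wpM2l => //; rewrite mulr_ge0.
have h2 : 8 * b ^+ 4 * Er (fun w => V2 k i w ^+ 4) <= 8 * b ^+ 4 * K.
  by apply: ler_wpM2l => //; rewrite mulr_ge0.
apply: (le_trans (lerD h1 h2)); nra.
Qed.

Lemma rot_cov K V1 V2 u k : twin K V1 V2 -> (k < L)%N -> forall i j,
  Er (fun w => V1 k i w * V1 k j w) = Er (fun w => rotV u V1 V2 k i w * rotV u V1 V2 k j w).
Proof.
move=> [g1 g2 cov cross _] kL i j.
have l1 i' : L4 (V1 k i') by have [] := g1 k kL i'.
have l2 i' : L4 (V2 k i') by have [] := g2 k kL i'.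
set a := rot_c u; set b := rot_s u.
have -> : (fun w => rotV u V1 V2 k i w * rotV u V1 V2 k j w) =
  (fun w => a ^+ 2 * (V1 k i w * V1 k j w) + a * b * (V1 k i w * V2 k j w) +
    a * b * (V1 k j w * V2 k i w) + b ^+ 2 * (V2 k i w * V2 k j w)).
  by apply/funext => w; rewrite /rotV -/a -/b; ring.
rewrite !ErD; do ?[by apply: igZ; exact: ig_mul2].
all: do ?[by apply: igD; apply: igZ; exact: ig_mul2].
  rewrite !ErZ; do ?exact: ig_mul2.
  by rewrite !cross// -cov// !mulr0 !addr0 -mulrDl rot_sq mul1r.
by apply: igD; [apply: igD|]; apply: igZ; exact: ig_mul2.
Qed.

Lemma good_env_le K K' V : K <= K' -> good_env K V -> good_env K' V.
Proof.
by move=> KK gV k kL i; have [? ? ? h] := gV k kL i; split => //; exact: le_trans KK.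
Qed.

(** The constant of [lindeberg] for a bump with third derivative at most 16 (4/h)^3, at the
    fourth-moment bound 8K of rotated blocks, with h^-3 taken out. *)
Definition lind_cst (K : R) (N : nat) : R := 2 * (16 * 4 ^+ 3) * (1 + hyp (8 * K) ^+ (N * 2)) * N%:R.

Lemma small_ball_rot K V1 V2 N c (delta x h u : R) : 1 <= K -> twin K V1 V2 ->
  vanL L N c -> 0 < delta -> (forall n, (n < L)%N -> infl L c n <= delta ^+ 2) -> 0 < h ->
  pr [set w | `|ev L c V1 w - x| <= h] <=
  pr [set w | `|ev L c (rotV u V1 V2) w - x| <= 2 * h] +
  lind_cst K N * delta * nrm2 L c / h ^+ 3.
Proof.
move=> K1 tw vc d0 hd h0.
have K8 : K <= 8 * K by lra.
have K81 : 1 <= 8 * K by lra.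
have g1 := good_env_le K8 (twin_good1 tw).
have gr := rot_good u K1 tw.
have [b tay] := bump_taylor3 x h0.
have B0 : 0 <= 16 * (4 / h) ^+ 3.
  by rewrite mulr_ge0// exprn_ge0// divr_ge0// ltW.
have lin := lindeberg HPi K81 g1 gr (fun k kL => rot_cov u tw kL) vc d0 hd tay B0.
have m1 := measurable_ev c g1; have mr := measurable_ev c gr.
have mf := t3_mf tay.
have igf (U : T -> R) : measurable_fun setT U -> ig (fun w => bump x h 0 (U w)).
  move=> mU; have := bounded_comp_ig mf (t3_f tay) mU (ig_cst P 1).
  by under eq_fun do rewrite mulr1.
have lo : pr [set w | `|ev L c V1 w - x| <= h] <= Er (fun w => bump x h 0 (ev L c V1 w)).
  have mA : measurable [set w | `|ev L c V1 w - x| <= h] by exact: measurable_ball_set.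
  rewrite -Er_indic//; apply: Er_le; [exact: ig_indic|exact: igf|move=> w].
  have [/andP[b0 _] b1 _] := bump_val x (ev L c V1 w) h0.
  by rewrite indicE_if; case: ifPn => // /set_mem/= /b1 ->.
have hi : Er (fun w => bump x h 0 (ev L c (rotV u V1 V2) w)) <=
    pr [set w | `|ev L c (rotV u V1 V2) w - x| <= 2 * h].
  have mA : measurable [set w | `|ev L c (rotV u V1 V2) w - x| <= 2 * h].
    exact: measurable_ball_set.
  rewrite -Er_indic//; apply: Er_le; [exact: igf|exact: ig_indic|move=> w].
  have [/andP[_ b1] _ b2] := bump_val x (ev L c (rotV u V1 V2) w) h0.
  rewrite indicE_if; case: ifPn => // /negP wA; rewrite b2// ltNge.
  by apply/negP => hw; apply: wA; rewrite inE.
have e : 2 * (16 * (4 / h) ^+ 3) * (1 + hyp (8 * K) ^+ (N * 2)) * delta * N%:R * nrm2 L c =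
   lind_cst K N * delta * nrm2 L c / h ^+ 3.
  by rewrite /lind_cst; field; rewrite gt_eqF.
rewrite e in lin; move: lin; rewrite ler_norml => /andP[_ lin]; lra.
Qed.

(** The constant of [rotation_count], with a last factor 2 for the radius 2h left by
    [small_ball_rot]. *)
Definition rot_scale (N : nat) : R := (2 * N).+1%:R * 2 ^+ N * 2.

(* Averaging [small_ball_rot] over a grid of angles; [g] dominates the fraction of
   angles at which the rotated polynomial is close to [x]. *)
Lemma small_ball_average K V1 V2 N c (delta x h : R) (I : nat) (g : T -> R) :
  1 <= K -> twin K V1 V2 ->
  vanL L N c -> 0 < delta -> (forall n, (n < L)%N -> infl L c n <= delta ^+ 2) -> 0 < h ->
  ig g ->
  (forall w, (count (fun j : nat =>
     `|mpoly L c (rotv (j%:R / (2 ^ I)%:R) (fun k i => V1 k i w) (fun k i => V2 k i w)) - x|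
        <= 2 * h)%R (iota 0 (2 ^ I)))%:R <= (2 ^ I)%:R * g w) ->
  pr [set w | `|ev L c V1 w - x| <= h] <=
  Er g + lind_cst K N * delta * nrm2 L c / h ^+ 3.
Proof.
move=> K1 tw vc d0 hd h0 ig_g hg; set M := (2 ^ I)%N; set e := _ / h ^+ 3.
have M0 : 0 < (M%:R : R) by rewrite ltr0n expn_gt0.
pose A (j : nat) := [set w | `|ev L c (rotV (j%:R / M%:R) V1 V2) w - x| <= 2 * h].
have mA j : measurable (A j).
  by apply: measurable_ball_set; exact: measurable_ev (rot_good _ K1 tw).
rewrite -(ler_pM2l M0) mulrDr.
apply: (le_trans (y := \sum_(j <- iota 0 M) (pr (A j) + e))).
  have -> : M%:R * pr [set w | `|ev L c V1 w - x| <= h] =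
     \sum_(j <- iota 0 M) pr [set w | `|ev L c V1 w - x| <= h].
    by rewrite big_const_seq count_predT size_iota iter_addr addr0 mulr_natl.
  by apply: ler_sum => j _; exact: small_ball_rot.
rewrite big_split/= big_const_seq count_predT size_iota iter_addr addr0 -[e *+ M]mulr_natl.
rewrite lerD2r -ErZ//.
under eq_bigr do rewrite -Er_indic//.
rewrite -Er_sum; last by move=> j; exact: ig_indic.
apply: Er_le; [by apply: ig_sum => j; exact: ig_indic|exact: igZ|move=> w].
apply: le_trans (hg w).
have -> : \sum_(j <- iota 0 M) (\1_(A j) w : R) = (count (fun j => w \in A j) (iota 0 M))%:R.
  rewrite -sum1_count natr_sum [RHS]big_mkcond/=; apply: eq_bigr => j _.
  by rewrite indicE_if; case: ifP.
rewrite le_eqVlt; apply/orP; left; apply/eqP; congr (_%:R); apply: eq_count => j.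
by apply/idP/idP => [/set_mem|hj]; [|apply/mem_set].
Qed.

Section recursion.
Context (K : R) (V1 V2 : nat -> 'I_m -> T -> R) (N : nat)
  (c : seq (nat * 'I_m) -> R) (delta : R).
Hypotheses (K1 : 1 <= K) (tw : twin K V1 V2) (vc : vanL L N c) (N0 : (0 < N)%N)
  (d0 : 0 < delta) (hd : forall n, (n < L)%N -> infl L c n <= delta ^+ 2).

Let ball (x s : R) : R := pr [set w | `|ev L c V1 w - x| <= s].
Let both (x s : R) := [set w | `|ev L c V1 w - x| <= s /\ `|ev L c V2 w - x| <= s].
Let cnt (I : nat) (x h : R) (w : T) := count (fun j : nat =>
     `|mpoly L c (rotv (j%:R / (2 ^ I)%:R) (fun k i => V1 k i w) (fun k i => V2 k i w)) - x|
        <= 2 * h)%R (iota 0 (2 ^ I)).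

Let mboth x s : measurable (both x s).
Proof.
apply: measurableI; apply: measurable_ball_set.
  exact: measurable_ev (twin_good1 tw).
exact: measurable_ev (twin_good2 tw).
Qed.

Let cnt_le I x h w : (cnt I x h w <= 2 ^ I)%N.
Proof. by rewrite -[leqRHS](size_iota 0) count_size. Qed.

Let cnt_both I i x h w : (i <= I)%N -> 0 < h -> (2 * N * 2 ^ (I - i) < cnt I x h w)%N ->
  w \in both x (rot_scale N * h * 4 ^+ (N * i)).
Proof.
move=> iI h0 hc; apply/mem_set.
have h2 : 0 <= 2 * h by lra.
have := rotation_count iI vc h2 hc.
by rewrite /both /rot_scale/= /ev -!mulrA.
Qed.

(** If more than 2N grid angles are close, both endpoints are close at the coarse scale and the
    fraction of angles is bounded by 1; otherwise it is at most 2N / 2^I. *)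
Lemma small_ball_rec1 x h I : 0 < h ->
  ball x h <= ball x (rot_scale N * h * 4 ^+ (N * I)) ^+ 2 + (2 * N)%:R / 2 ^+ I +
  lind_cst K N * delta * nrm2 L c / h ^+ 3.
Proof.
move=> h0; set s := rot_scale N * h * _.
pose g w : R := \1_(both x s) w + (2 * N)%:R / 2 ^+ I.
have ig_g : ig g by apply: igD; [exact: ig_indic|exact: ig_cst].
apply: (le_trans (small_ball_average K1 tw vc d0 hd h0 ig_g (x := x) (I := I) _)).
  move=> w; rewrite -/(cnt I x h w) /g indicE_if mulrDr.
  have e : (2 ^ I)%:R * ((2 * N)%:R / 2 ^+ I) = (2 * N)%:R :> R.
    by rewrite natrX mulrCA divff ?mulr1// expf_neq0.
  rewrite e; case: ifPn => [_|/negP wb].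
    by rewrite mulr1 -natrD ler_nat; apply: leq_trans (cnt_le _ _ _ _) (leq_addr _ _).
  rewrite mulr0 add0r ler_nat leqNgt; apply/negP => hc; apply: wb.
  by have := @cnt_both I I x h w (leqnn _) h0; rewrite subnn muln1; apply.
rewrite /g ErD; [|exact: ig_indic|exact: ig_cst].
rewrite Er_cst Er_indic// !lerD2r; exact: twin_ball tw _ _ _.
Qed.

(** The points are sorted by the first dyadic scale at which both copies are close: a coarser scale
    is reached only when fewer angles are good, which gives the weight 2^-i. *)
Lemma small_ball_rec2 x h I : 0 < h ->
  ball x h <= (4 * N)%:R * (\sum_(0 <= i < I.+1)
      2 ^- i * ball x (rot_scale N * h * 4 ^+ (N * i)) ^+ 2) + (2 * N)%:R / 2 ^+ I +
  lind_cst K N * delta * nrm2 L c / h ^+ 3.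
Proof.
move=> h0; pose s i := rot_scale N * h * 4 ^+ (N * i).
pose g0 w : R := \sum_(0 <= i < I.+1) 2 ^- i * \1_(both x (s i)) w.
pose g w : R := (4 * N)%:R * g0 w + (2 * N)%:R / 2 ^+ I.
have ig_g0 : ig g0 by apply: ig_sum => i; apply: igZ; exact: ig_indic.
have ig_g : ig g by apply: igD; [exact: igZ|exact: ig_cst].
apply: (le_trans (small_ball_average K1 tw vc d0 hd h0 ig_g (x := x) (I := I) _)).
  move=> w; rewrite -/(cnt I x h w) /g mulrDr.
  have e : (2 ^ I)%:R * ((2 * N)%:R / 2 ^+ I) = (2 * N)%:R :> R.
    by rewrite natrX mulrCA divff ?mulr1// expf_neq0.
  rewrite e.
  have g00 : 0 <= g0 w by apply: sumr_ge0 => i _; rewrite mulr_ge0 ?invr_ge0 ?exprn_ge0.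
  pose Q i := (i <= I)%N && (w \in both x (s i)).
  have [ex|no] := pselect (exists i, Q i); last first.
    apply: (le_trans (y := (2 * N)%:R)); last by rewrite lerDr !mulr_ge0.
    rewrite ler_nat leqNgt; apply/negP => hc; apply: no; exists I.
    rewrite /Q leqnn; have := @cnt_both I I x h w (leqnn _) h0.
    by rewrite subnn muln1; apply.
  (* Failure at the previous scale bounds the count by 2N 2^(I - i + 1), which is 4N 2^(I - i); at i
     = 0 the bound is trivial. *)
  case: (ex_minnP ex) => i /andP[iI wi] imin.
  have gi : 2 ^- i <= g0 w.
    rewrite /g0 big_mkord (bigD1 (Ordinal (iI : (i < I.+1)%N)))//=.
    by rewrite indicE_if wi mulr1 lerDl sumr_ge0.
  apply: (le_trans (y := (2 ^ I)%:R * ((4 * N)%:R * 2 ^- i))); last first.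
    apply: (le_trans (y := (2 ^ I)%:R * ((4 * N)%:R * g0 w))); last by rewrite lerDl.
    by do 2!apply: ler_wpM2l => //.
  have -> : (2 ^ I)%:R * ((4 * N)%:R * 2 ^- i) = (4 * N * 2 ^ (I - i))%:R :> R.
    rewrite -{1}(subnK iI) expnD !natrM !natrX; field; exact: expf_neq0.
  rewrite ler_nat; case: i wi imin iI {gi} => [|i] wi imin iI.
    apply: leq_trans (cnt_le _ _ _ _) _; rewrite subn0.
    by rewrite leq_pmull// muln_gt0.
  rewrite leqNgt; apply/negP => hc.
  have iI' : (i <= I)%N by exact: ltnW.
  have : (i.+1 <= i)%N.
    have hc' : (2 * N * 2 ^ (I - i) < cnt I x h w)%N.
      apply: leq_ltn_trans hc; have -> : (I - i = (I - i.+1).+1)%N by lia.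
      by rewrite expnS; nia.
    by apply: imin; rewrite /Q iI'; exact: (@cnt_both I i x h w iI' h0 hc').
  by rewrite ltnn.
rewrite /g ErD; [|exact: igZ|exact: ig_cst].
rewrite Er_cst ErZ// !lerD2r; apply: ler_wpM2l => //.
rewrite Er_sum; last by move=> i; apply: igZ; exact: ig_indic.
apply: ler_sum => i _; rewrite ErZ; last exact: ig_indic.
rewrite Er_indic//; apply: ler_wpM2l; first by rewrite invr_ge0 exprn_ge0.
exact: twin_ball tw _ _ _.
Qed.

End recursion.

End anticoncentration.

(** * Solving the small-ball recursion *)

Section scale_iteration.
Context (R : realType).
Implicit Types (t y a : R).

Lemma pow2_unbounded y : 0 < y -> exists n : nat, 1 < 2 ^+ n * y.
Proof.
move=> y0; have iy : 0 <= y^-1 by rewrite invr_ge0 ltW.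
exists (Num.bound y^-1); rewrite -ltr_pdivrMr// mul1r.
apply: lt_le_trans (archi_boundP iy) _.
by rewrite -natrX ler_nat ltnW// ltn_expl.
Qed.

Lemma pow_lt1_small (r e : R) : 0 <= r < 1 -> 0 < e -> exists n : nat, r ^+ n <= e.
Proof.
move=> /andP[r0 r1] e0.
have cv : r ^+ n @[n --> \oo] --> (0 : R) by apply: cvg_expr; rewrite ger0_norm.
have /cvgrPdist_le /(_ e e0) [n _ /(_ n)] := cv.
rewrite /= leqnn sub0r normrN ger0_norm ?exprn_ge0// => /(_ isT) h.
by exists n.
Qed.

Lemma scale_index (N : nat) y : (0 < N)%N -> 0 < y <= 1 ->
  exists I : nat, 4 ^+ (N * I) * y <= 1 < 4 ^+ (N * I.+1) * y.
Proof.
move=> N0 /andP[y0 y1].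
have [n hn] := pow2_unbounded y0.
have ex : exists n : nat, 1 < 4 ^+ (N * n.+1) * y.
  exists n; apply: (lt_le_trans hn); apply: ler_wpM2r; first exact: ltW.
  apply: (le_trans (y := 4 ^+ n)).
    by apply: lerXn2r; rewrite ?nnegrE//; lra.
  by apply: ler_weXn2l; [lra|nia].
case: (ex_minnP ex) => I hI Imin; exists I; rewrite hI andbT.
case: I hI Imin => [|I] hI Imin; first by rewrite muln0 expr0 mul1r.
by rewrite leNgt; apply/negP => /Imin; rewrite ltnn.
Qed.

Lemma pow4_powR (n : nat) a : (4 ^+ n) `^ a = 2 `^ (2 * n%:R * a) :> R.
Proof.
have -> : (4 : R) ^+ n = 2 `^ (2 * n%:R).
  by rewrite -natrM powR_mulrn// exprM; congr (_ ^+ _); ring.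
by rewrite -powRrM.
Qed.

Variables (N : nat) (B C0 q0 theta : R).
Hypotheses (N0 : (0 < N)%N) (B2 : 2 <= B) (C00 : 0 <= C0) (q01 : 0 <= q0 < 1)
  (th01 : 0 < theta < 1).

Let g : R := (2 * N%:R)^-1.

Let NR : 0 < (N%:R : R). Proof. by rewrite ltr0n. Qed.
Let g0 : 0 < g. Proof. by rewrite invr_gt0 mulr_gt0. Qed.
Let B0 : 0 < B. Proof. by apply: lt_le_trans B2. Qed.

(** Here [q t] stands for the ball probability at a relative scale [t], [t0] for the scale below
    which the exchange error is no longer controlled, and the last term for that error. Bounds over
    all such [q] give constants free of the probability space. *)
Definition small_ball_recursion (t0 : R) (q : R -> R) : Prop :=
  [/\ forall t, 0 <= q t <= 1, forall s t, s <= t -> q s <= q t, q 1 <= q0,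
   forall t I, 0 < t -> t0 <= t <= 1 ->
     q t <= q (B * t * 4 ^+ (N * I)) ^+ 2 + (2 * N)%:R / 2 ^+ I + C0 * t `^ g &
   forall t I, 0 < t -> t0 <= t <= 1 ->
     q t <= (4 * N)%:R * (\sum_(0 <= i < I.+1) 2 ^- i * q (B * t * 4 ^+ (N * i)) ^+ 2) +
       (2 * N)%:R / 2 ^+ I + C0 * t `^ g].

(** Since q <= q0 up to scale 1, the square in the one-scale inequality is at most q0 q, a
    contraction up to an additive [eta]; finitely many enlargements of scale suffice. *)
Lemma small_ball_to_0 (e : R) : 0 < e -> exists t1 : R, 0 < t1 <= 1 /\
  forall t0 q, small_ball_recursion t0 q -> forall t, 0 < t -> t0 <= t <= t1 -> q t <= e.
Proof.
move=> e0; have /andP[q00 q11] := q01; have hC0 := C00; have hB2 := B2.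
(* The contraction then has fixed point eta / (1 - q0) = e/2; half of [eta] is reserved for the grid
   term and half for the exchange error. *)
pose eta := (1 - q0) * e / 2.
have eta0 : 0 < eta by rewrite !mulr_gt0//; lra.
have N4 : 0 < (4 * N)%:R :> R by rewrite ltr0n muln_gt0.
have [I hI] : exists I : nat, (2 * N)%:R / 2 ^+ I <= eta / 2.
  have [I hI] := @pow_lt1_small (2^-1) (eta / (4 * N)%:R) (ltac:(lra)) (divr_gt0 eta0 N4).
  exists I; rewrite -exprVn.
  have := ler_wpM2l (ler0n R (2 * N)) hI; move=> /le_trans; apply.
  have -> : (4 * N)%:R = 2 * (2 * N)%:R :> R by rewrite -natrM mulnA.
  have a0 : 0 < (2 * N)%:R :> R by rewrite ltr0n muln_gt0.
  by rewrite le_eqVlt; apply/orP; left; apply/eqP; field; rewrite gt_eqF.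
pose u := Num.min 1 (eta / (2 * (C0 + 1))).
have u0 : 0 < u by rewrite lt_min ltr01/= divr_gt0//; lra.
have u1 : u <= 1 by rewrite ge_min lexx.
have Cu : C0 * u <= eta / 2.
  have : u <= eta / (2 * (C0 + 1)) by rewrite ge_min lexx orbT.
  rewrite ler_pdivlMr; last lra.
  by nra.
(* The exponent inverts g = 1/(2N), so that tau^g = u. *)
pose tau := u ^+ (2 * N).
have tau0 : 0 < tau by rewrite exprn_gt0.
have tau1 : tau <= 1 by rewrite exprn_ile1// ltW.
have taug : tau `^ g = u.
  rewrite /tau -powR_mulrn; last exact: ltW.
  by rewrite -powRrM /g natrM mulfV ?powRr1// ?mulf_neq0// ?gt_eqF// ltW.
pose rho := (B * 4 ^+ (N * I))^-1.
have BI1 : 1 <= B * 4 ^+ (N * I).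
  have : (1 : R) <= 4 ^+ (N * I) by rewrite exprn_ege1//; lra.
  by nra.
have rho0 : 0 < rho by rewrite invr_gt0; lra.
have rho1 : rho <= 1 by rewrite invf_le1//; lra.
have [j hj] := @pow_lt1_small q0 (e / 2) q01 (ltac:(lra)).
exists (tau * rho ^+ j); split.
  rewrite mulr_gt0 ?exprn_gt0//=.
  by rewrite mulr_ile1// ?exprn_ile1// ?exprn_ge0// ltW.
move=> t0 q [qb qm q1 r1 _].
have main k t : 0 < t -> t0 <= t <= tau * rho ^+ k -> q t <= q0 ^+ k + eta / (1 - q0).
  elim: k t => [|k IH] t tp /andP[tt0 tt].
    rewrite expr0; have /andP[_ h] := qb t.
    by apply: (le_trans h); rewrite lerDl divr_ge0; lra.
  have t1 : t <= 1.
    apply: (le_trans tt); rewrite mulr_ile1// ?exprn_ile1// ?exprn_ge0//; lra.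
  have tTau : t <= tau.
    by apply: (le_trans tt); rewrite ger_pMr// exprn_ile1//; lra.
  have := r1 t I tp; rewrite tt0 t1 => /(_ isT).
  set s := B * t * _; have se : s = t / rho by rewrite /s /rho invrK; ring.
  have st : t <= s by rewrite se ler_pdivlMr// ger_pMr.
  have sk : s <= tau * rho ^+ k by rewrite se ler_pdivrMr// -mulrA -exprSr.
  have s1 : s <= 1.
    by apply: (le_trans sk); rewrite mulr_ile1// ?exprn_ile1// ?exprn_ge0//; lra.
  have sp : 0 < s by exact: lt_le_trans st.
  have hs := IH s sp; rewrite (le_trans tt0 st) sk in hs.
  have {}hs := hs isT.
  have qs0 : q s <= q0 by apply: (le_trans (qm _ _ s1)).
  have /andP[qs _] := qb s.
  have tg : C0 * t `^ g <= eta / 2.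
    apply: (le_trans _ Cu); apply: ler_wpM2l => //; rewrite -taug.
    by apply: ge0_ler_powR; rewrite ?nnegrE// ltW.
  have e1 : eta / (1 - q0) = e / 2 by rewrite /eta; field; lra.
  rewrite e1 in hs *; have e2 : eta = (1 - q0) * (e / 2) by rewrite /eta mulrA.
  have h2 : q s ^+ 2 <= q0 * (q0 ^+ k + e / 2) by rewrite expr2; exact: ler_pM.
  have h3 : eta = e / 2 - q0 * (e / 2) by rewrite e2; ring.
  move: hI; rewrite [q0 ^+ k.+1]exprS; set z := _ / 2 ^+ I => hI hr; rewrite mulrDr in h2.
  lra.
move=> t tp ht; have := main j t tp ht.
have -> : eta / (1 - q0) = e / 2 by rewrite /eta; field; lra.
lra.
Qed.

(** Below [t1] one has q^2 <= e q. Inserting a bound A t^(theta g) in the sum turns the weights 2^-i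
    into powers of r = 2^(theta - 1) < 1, and [e] makes the total at most half of the bound. *)
Lemma small_ball_decay : exists C : R, 1 <= C /\
  forall t0 q, small_ball_recursion t0 q ->
    forall t, 0 < t -> t0 <= t <= 1 -> q t <= C * t `^ (theta * g).
Proof.
have /andP[th0 th1] := th01; have hC0 := C00; have hB2 := B2.
pose ga := theta * g; have ga0 : 0 < ga by rewrite mulr_gt0.
have gag : ga <= g by rewrite /ga ger_pMl// ltW.
pose r : R := 2 `^ (theta - 1).
have r0 : 0 < r by exact: powR_gt0.
have r1 : r < 1.
  rewrite /r -[X in _ < X](powRr0 2).
  have := @gt0_ltr_powR R (1 - theta) (ltac:(lra)) 1 2.
  rewrite !nnegrE => /(_ ler01 (ler0n _ _)); rewrite ltr1n powR1 => /(_ isT) h.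
  by rewrite powRr0 (_ : theta - 1 = - (1 - theta)) ?powRN ?invf_lt1 ?powR_gt0//; ring.
pose S := (1 - r)^-1.
have S0 : 0 < S by rewrite invr_gt0; lra.
have Bga : 0 < B `^ ga by exact: powR_gt0.
(* Solves 4N e B^(theta g) S = 1/2, with S the sum of the geometric series. *)
pose e := (8 * N%:R * B `^ ga * S)^-1.
have e0 : 0 < e by rewrite invr_gt0 !mulr_gt0.
have [t1 [/andP[t10 t11] Ht1]] := small_ball_to_0 e0.
have Bt1 : 1 <= B / t1 by rewrite ler_pdivlMr// mul1r; lra.
have Bt0 : 0 < B / t1 by lra.
(* The first term covers the scales above t1/B; the second is twice the additive terms of the
   recursion, so that these and A/2 together stay below A. *)
pose A := (B / t1) `^ ga + 2 * ((4 * N)%:R * (B / t1) `^ g + C0).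
have Ab0 : 0 <= (4 * N)%:R * (B / t1) `^ g by rewrite mulr_ge0 ?powR_ge0.
have Aa0 : 1 <= (B / t1) `^ ga.
  by rewrite -[leLHS](powRr0 (B / t1)); apply: ler_powR => //; exact: ltW.
have A1 : 1 <= A by rewrite /A; lra.
exists A; split=> // t0 q rec; have Hq := Ht1 _ _ rec.
case: rec => [qb qm q1 _ r2].
have base t : 0 < t -> t1 / B < t -> q t <= A * t `^ ga.
  move=> tp tt; have /andP[_ h] := qb t; apply: (le_trans h).
  apply: (le_trans (y := (B / t1) `^ ga * t `^ ga)); last first.
    by apply: ler_wpM2r; [exact: powR_ge0|rewrite /A; lra].
  rewrite -powRM; [|exact: ltW|exact: ltW].
  have : 1 <= B / t1 * t.
    move: tt; rewrite ltr_pdivrMr// => tt.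
    by rewrite mulrAC ler_pdivlMr// mul1r mulrC ltW.
  by move=> h1; rewrite -[leLHS](powRr0 (B / t1 * t)); apply: ler_powR => //; exact: ltW.
have main n t : 0 < t -> t0 <= t <= 1 -> t1 / B ^+ n.+1 < t -> q t <= A * t `^ ga.
  elim: n t => [|n IH] t tp /andP[tt0 tt1] ht; first by apply: base => //; rewrite expr1 in ht.
  have [?|ht1] := ltP (t1 / B) t; first exact: base.
  have Btt : B * t <= t1 by move: ht1; rewrite ler_pdivlMr// mulrC.
  pose y := B * t / t1.
  have y01 : 0 < y <= 1 by rewrite divr_gt0 ?mulr_gt0//= ler_pdivrMr// mul1r.
  (* The largest [I] for which all enlarged scales stay below [t1], where q <= e; by maximality 2^-I
     is at most a multiple of t^g. *)
  have [I /andP[hI1 hI2]] := scale_index N0 y01.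
  have := r2 t I tp; rewrite tt0 tt1 => /(_ isT) h; apply: (le_trans h) => {h}.
  have tga : 0 <= t `^ ga by exact: powR_ge0.
  have pt (i : nat) : (i <= I)%N -> q (B * t * 4 ^+ (N * i)) ^+ 2 <=
      e * (A * (B `^ ga * t `^ ga * (2 `^ theta) ^+ i)).
    move=> iI; set s := B * t * _.
    have p4 : (1 : R) <= 4 ^+ (N * i) by rewrite exprn_ege1//; lra.
    have Btp : 0 < B * t by rewrite mulr_gt0.
    have sB : B * t <= s by rewrite /s ler_peMr// ltW.
    have st1 : s <= t1.
      apply: (le_trans (y := B * t * 4 ^+ (N * I))).
        apply: ler_wpM2l; first exact: ltW.
        by rewrite ler_weXn2l//; [lra|rewrite leq_mul2l iI orbT].
      move: hI1; rewrite /y mulrA ler_pdivrMr// mul1r mulrC; lra.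
    have sp : 0 < s by lra.
    have ts : t <= s by apply: le_trans sB; rewrite ler_peMl// ?ltW//; lra.
    have qe : q s <= e by apply: Hq => //; rewrite (le_trans tt0 ts).
    have qA : q s <= A * s `^ ga.
      apply: IH => //; first by rewrite (le_trans tt0 ts)/=; lra.
      apply: lt_le_trans sB; rewrite -ltr_pdivrMl//.
      rewrite mulrC -mulrA -invfM -exprSr; exact: ht.
    have -> : B `^ ga * t `^ ga * (2 `^ theta) ^+ i = s `^ ga.
      rewrite /s !powRM ?mulr_ge0 ?exprn_ge0 ?ltW//; congr (_ * _).
      rewrite pow4_powR -[LHS]powR_mulrn ?powR_ge0// -powRrM.
      by congr (_ `^ _); rewrite /ga /g natrM; field; rewrite gt_eqF.
    have /andP[qs0 _] := qb s.
    by rewrite expr2; apply: ler_pM.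
  have sum_le : \sum_(0 <= i < I.+1) 2 ^- i * q (B * t * 4 ^+ (N * i)) ^+ 2 <=
      e * A * (B `^ ga * t `^ ga) * S.
    apply: (le_trans (y := \sum_(0 <= i < I.+1) e * A * (B `^ ga * t `^ ga) * r ^+ i)).
      rewrite big_nat [leRHS]big_nat; apply: ler_sum => i /andP[_ iI].
      have -> : e * A * (B `^ ga * t `^ ga) * r ^+ i =
         2 ^- i * (e * (A * (B `^ ga * t `^ ga * (2 `^ theta) ^+ i))).
        have -> : r = 2 `^ theta / 2 by rewrite /r powRB ?powRr1// pnatr_eq0 implybT.
        by rewrite expr_div_n; ring.
      apply: ler_wpM2l; first by rewrite invr_ge0 exprn_ge0.
      exact: pt.
    rewrite -mulr_sumr; apply: ler_wpM2l.
      by rewrite !mulr_ge0 ?powR_ge0//; lra.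
    rewrite big_mkord /S -[leRHS]mul1r ler_pdivlMr; last lra.
    have -> : (\sum_(i < I.+1) r ^+ i) * (1 - r) = 1 - r ^+ I.+1.
      by rewrite -[LHS]opprK -mulrN opprB mulrC -subrX1 opprB.
    by rewrite gerBl exprn_ge0// ltW.
  have h1 : (4 * N)%:R * (\sum_(0 <= i < I.+1) 2 ^- i * q (B * t * 4 ^+ (N * i)) ^+ 2) <=
      A * t `^ ga / 2.
    apply: (le_trans (ler_wpM2l (ler0n _ _) sum_le)).
    rewrite le_eqVlt; apply/orP; left; apply/eqP; rewrite /e natrM; field.
    by rewrite !gt_eqF.
  have tgg : t `^ g <= t `^ ga by apply: ger_powR => //; rewrite tp.
  have h2 : (2 * N)%:R / 2 ^+ I <= (4 * N)%:R * (B / t1) `^ g * t `^ ga.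
    have hy : y `^ g = (B / t1) `^ g * t `^ g.
      by rewrite -powRM; [congr (_ `^ _); rewrite /y; ring|exact: ltW|exact: ltW].
    have : (2 ^+ I.+1)^-1 <= y `^ g.
      rewrite -[leLHS]mul1r ler_pdivrMr ?exprn_gt0// mulrC.
      have -> : (2 : R) ^+ I.+1 = (4 ^+ (N * I.+1)) `^ g.
        rewrite pow4_powR -powR_mulrn//.
        by congr (_ `^ _); rewrite /g natrM; field; rewrite gt_eqF.
      have /andP[y0 _] := y01.
      have y0' := ltW y0; rewrite -powRM ?exprn_ge0//.
      rewrite -[leLHS](powRr0 (4 ^+ (N * I.+1) * y)); apply: ler_powR; exact: ltW.
    rewrite hy => h.
    apply: (le_trans (y := (4 * N)%:R * (2 ^+ I.+1)^-1)).
      rewrite exprS natrM [(4 * N)%:R]natrM le_eqVlt; apply/orP; left; apply/eqP; field.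
      exact: expf_neq0.
    rewrite -mulrA; apply: ler_wpM2l => //; apply: (le_trans h).
    by apply: ler_wpM2l => //; exact: powR_ge0.
  have h3 : C0 * t `^ g <= C0 * t `^ ga by apply: ler_wpM2l.
  have : A * t `^ ga = (B / t1) `^ ga * t `^ ga +
     2 * ((4 * N)%:R * (B / t1) `^ g * t `^ ga + C0 * t `^ ga) by rewrite /A; ring.
  have : 0 <= (B / t1) `^ ga * t `^ ga by rewrite mulr_ge0// powR_ge0.
  lra.
move=> t tp tt.
have [n hn] := @pow2_unbounded (t / t1) (divr_gt0 tp t10).
apply: (main n) => //; rewrite ltr_pdivrMr ?exprn_gt0//.
move: hn; rewrite mulrA ltr_pdivlMr// mul1r => /lt_le_trans; apply.
rewrite mulrC; apply: ler_wpM2l; first exact: ltW.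
apply: (le_trans (y := 2 ^+ n.+1)); first by rewrite ler_weXn2l// ?leqnSn//; lra.
by apply: lerXn2r; rewrite ?nnegrE//; lra.
Qed.

End scale_iteration.

(** * Anticoncentration with uniform constants *)

Lemma min1_powR_le (R : realType) (y g : R) (n : nat) : 0 < y -> 0 <= g <= 1 -> (0 < n)%N ->
  ((Num.min 1 y)^-1) `^ g <= 1 + y ^- n.
Proof.
move=> y0 /andP[g0 g1] n0.
have yn : 0 <= y ^- n by rewrite invr_ge0 exprn_ge0// ltW.
have [y1|y1] := leP 1 y; first by rewrite invr1 powR1 lerDl.
have iy1 : 1 <= y^-1 by rewrite invf_ge1// ltW.
apply: (le_trans (y := y ^- n)); last by rewrite lerDr.
apply: (le_trans (y := y^-1)).
  have iy0 : 0 <= y^-1 by lra.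
  by rewrite -[leRHS]powRr1//; exact: ler_powR.
rewrite -exprVn; case: n n0 yn => // n _ _.
by rewrite exprS ler_peMr ?exprn_ege1// invr_ge0 ltW.
Qed.

(** The recursion is run in units of a scale [s1] that depends on the coefficients; returning to
    absolute scales costs a power of 1/s1, which is the prefactor in [a] and [b]. *)
Theorem anticoncentration (R : realType) (m N : nat) (K lam theta : R) :
  (0 < N)%N -> 1 <= K -> 0 < lam <= 1 -> 0 < theta < 1 ->
  exists C : R, 0 < C /\
  forall (d : measure_display) (T : measurableType d) (P : probability T R)
    (Pi : nat -> set (set T)) (L : nat) (V1 V2 : nat -> 'I_m -> T -> R)
    (c : seq (nat * 'I_m) -> R) (delta a b h x : R),
  pi_family P Pi L -> twin P Pi L K V1 V2 -> cov_ge P L lam V1 -> vanL L N c ->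
  0 < delta -> (forall n, (n < L)%N -> infl L c n <= delta ^+ 2) ->
  0 < a -> a ^+ 2 <= \sum_(a <- mis m L | size a == N) c a ^+ 2 ->
  0 <= b -> nrm2 L c <= b ^+ 2 ->
  0 < h <= 1 -> delta <= h ^+ 3 * h `^ (2 * N%:R)^-1 ->
  pr P [set w | `|ev L c V1 w - x| <= h] <=
    C * (1 + a ^- (2 * N)) * (1 + b) ^+ 2 * h `^ (theta * (2 * N%:R)^-1).
Proof.
move=> N0 K1 /andP[l0 l1] th01; have /andP[th0 th1] := th01.
set g : R := (2 * N%:R)^-1.
have NR : 1 <= (N%:R : R) by rewrite ler1n.
have g0 : 0 < g by rewrite invr_gt0; lra.
have g1 : g <= 1 by rewrite /g invf_le1; lra.
have hyp1 : 1 <= hyp_cst m K.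
  have : (1 : R) <= m.+1%:R ^+ 2 by rewrite exprn_ege1// ler1n.
  rewrite /hyp_cst; nra.
have lN0 : 0 < lam ^+ N by rewrite exprn_gt0.
have lN1 : lam ^+ N <= 1 by rewrite exprn_ile1// ltW.
pose C1 : R := (hyp_cst m K ^+ N / lam ^+ N) ^+ 2.
have C11 : 1 <= C1.
  rewrite /C1 exprn_ege1// ler_pdivlMr// mul1r; apply: (le_trans lN1).
  by rewrite exprn_ege1.
pose q0 : R := 1 - (4 * C1)^-1.
have q01 : 0 <= q0 < 1.
  have : (4 * C1)^-1 <= 1 by rewrite invf_le1; lra.
  have : 0 < (4 * C1)^-1 by rewrite invr_gt0; lra.
  by move=> ? ?; apply/andP; split; rewrite /q0; lra.
pose B := rot_scale R N.
have B2 : 2 <= B.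
  have h1 : (1 : R) <= (2 * N).+1%:R by rewrite ler1n.
  have h2 : (1 : R) <= 2 ^+ N by rewrite exprn_ege1//; lra.
  rewrite /B /rot_scale; nra.
pose C0 := lind_cst m K N.
have C00 : 0 <= C0.
  rewrite /C0 /lind_cst !mulr_ge0// ?exprn_ge0// addr_ge0// exprn_even_ge0//.
  by rewrite oddM andbF.
have [C [HC1 HC]] := small_ball_decay N0 B2 C00 q01 th01.
(* Then (c0 a)^2 <= lam^N a^2 / 2, the threshold of [small_ball_lt1]. *)
pose c0 := lam ^+ N / 2.
have c00 : 0 < c0 by rewrite divr_gt0.
pose Cf := C * (1 + c0 ^- (2 * N)).
have cN : 0 < c0 ^- (2 * N) by rewrite invr_gt0 exprn_gt0.
have Cf0 : 0 < Cf by rewrite mulr_gt0//; lra.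
exists Cf; split=> // d T P Pi L V1 V2 c delta a b h x HPi tw cv vc d0 hd a0 ha b0 hb /andP[h0 h1] hdh.
pose p s := pr P [set w | `|ev L c V1 w - x| <= s].
rewrite -/(p h).
have mev : measurable_fun setT (ev L c V1) by exact: (measurable_ev HPi c (twin_good1 tw)).
have mball s : measurable [set w | `|ev L c V1 w - x| <= s] by exact: measurable_ball_set.
have p01 s : 0 <= p s <= 1 by rewrite pr_ge0 pr_le1.
have pm s t : s <= t -> p s <= p t.
  by move=> st; apply: pr_le => // w /= hw; exact: le_trans st.
pose mn := Num.min 1 (c0 * a).
have ca : 0 < c0 * a by rewrite mulr_gt0.
have mn0 : 0 < mn by rewrite lt_min ltr01.
have mn1 : mn <= 1 by rewrite ge_min lexx.
have mnc : mn <= c0 * a by rewrite ge_min lexx orbT.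
have b1 : 1 <= 1 + b by lra.
have bN1 : 1 <= (1 + b) ^+ (4 * N) by rewrite exprn_ege1.
(* The denominator satisfies ((1 + b)^(4N))^g = (1 + b)^2, which absorbs the factor b^2 of the
   exchange error. *)
pose s1 := mn / (1 + b) ^+ (4 * N).
have s10 : 0 < s1 by rewrite divr_gt0//; lra.
have s1mn : s1 <= mn by rewrite ler_pdivrMr ?ler_peMr//; lra.
have bg : ((1 + b) ^+ (4 * N)) `^ g = (1 + b) ^+ 2.
  rewrite -powR_mulrn; last lra.
  rewrite -powRrM -powR_mulrn; last lra.
  by congr (_ `^ _); rewrite /g natrM; field; rewrite gt_eqF//; lra.
have is1 : s1^-1 = mn^-1 * (1 + b) ^+ (4 * N) by rewrite /s1 invfM invrK mulrC.
have is11 : 1 <= s1^-1 by rewrite invf_ge1//; lra.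
have scale : (s1^-1) `^ (theta * g) <=
    (1 + c0 ^- (2 * N)) * (1 + a ^- (2 * N)) * (1 + b) ^+ 2.
  apply: (le_trans (y := (s1^-1) `^ g)).
    by apply: ler_powR => //; rewrite ger_pMl// ltW.
  rewrite is1 powRM; [|by rewrite invr_ge0 ltW|by rewrite exprn_ge0; lra].
  rewrite bg; apply: ler_wpM2r; first exact: sqr_ge0.
  have N20 : (0 < 2 * N)%N by rewrite muln_gt0.
  have g01 : 0 <= g <= 1 by rewrite ltW.
  apply: (le_trans (min1_powR_le ca g01 N20)).
  have aN : 0 <= a ^- (2 * N) by rewrite invr_ge0 exprn_ge0// ltW.
  rewrite exprMn invfM; nra.
have fin : C * (h / s1) `^ (theta * g) <=
    Cf * (1 + a ^- (2 * N)) * (1 + b) ^+ 2 * h `^ (theta * g).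
  rewrite powRM; [|exact: ltW|by rewrite invr_ge0 ltW].
  have hp : 0 <= h `^ (theta * g) by exact: powR_ge0.
  have -> : Cf * (1 + a ^- (2 * N)) * (1 + b) ^+ 2 * h `^ (theta * g) =
    C * (h `^ (theta * g) * ((1 + c0 ^- (2 * N)) * (1 + a ^- (2 * N)) * (1 + b) ^+ 2)).
    by rewrite /Cf; ring.
  apply: ler_wpM2l; first lra.
  exact: ler_wpM2l.
have hs : 0 < h / s1 by rewrite divr_gt0.
apply: le_trans fin.
(* Above [s1] the claimed bound exceeds 1. *)
have [s1h|hs1] := ltP s1 h.
  have /andP[_ p1] := p01 h; apply: (le_trans p1).
  have : 1 <= (h / s1) `^ (theta * g).
    rewrite -[leLHS](powRr0 (h / s1)); apply: ler_powR.
      by rewrite ler_pdivlMr// mul1r ltW.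
    by rewrite mulr_ge0// ltW.
  by nra.
pose q t := p (s1 * t).
have -> : p h = q (h / s1) by rewrite /q mulrCA divff ?mulr1// gt_eqF.
(* The hypothesis on [delta] at scale [h] passes to every larger scale, so the exchange error is
   controlled down to the relative scale h/s1. *)
have err t : 0 < t -> h / s1 <= t <= 1 ->
    lind_cst m K N * delta * nrm2 L c / (s1 * t) ^+ 3 <= C0 * t `^ g.
  move=> t0 /andP[ht t1]; set h' := s1 * t.
  have hh' : h <= h' by move: ht; rewrite ler_pdivrMr// mulrC.
  have h'0 : 0 < h' by rewrite mulr_gt0.
  have dh' : delta <= h' ^+ 3 * h' `^ g.
    apply: (le_trans hdh); have h0' := ltW h0; apply: ler_pM; rewrite ?exprn_ge0 ?powR_ge0//.
      by apply: lerXn2r; rewrite ?nnegrE// ltW.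
    by apply: ge0_ler_powR; rewrite ?nnegrE// ltW.
  rewrite -/C0 ler_pdivrMr ?exprn_gt0// -[leLHS]mulrA -[leRHS]mulrA; apply: ler_wpM2l => //.
  have bs : b ^+ 2 * s1 `^ g <= 1.
    have sg : s1 `^ g <= ((1 + b) ^+ 2)^-1.
      rewrite /s1 powRM; [|exact: ltW|by rewrite invr_ge0; lra].
      rewrite -[X in _ * X `^ g]powR_inv1; last lra.
      rewrite powRAC powR_inv1 ?powR_ge0// bg -[leRHS]mul1r.
      apply: ler_wpM2r; first by rewrite invr_ge0 sqr_ge0.
      have e1 : 1 `^ g = 1 :> R by rewrite powR1.
      rewrite -e1; apply: ge0_ler_powR => //; rewrite ?nnegrE//; exact: ltW.
    have b10 : 0 < (1 + b) ^+ 2 := exprn_gt0 2 (lt_le_trans ltr01 b1).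
    apply: (le_trans (y := b ^+ 2 * ((1 + b) ^+ 2)^-1)).
      by apply: ler_wpM2l => //; exact: sqr_ge0.
    rewrite ler_pdivrMr// mul1r; have b10' : 0 <= 1 + b := le_trans ler01 b1.
    by apply: lerXn2r => //; rewrite ?nnegrE// lerDr ler01.
  have hg : h' `^ g = s1 `^ g * t `^ g by rewrite powRM// ltW.
  apply: (le_trans (y := (h' ^+ 3 * h' `^ g) * b ^+ 2)).
    by apply: ler_pM => //; [exact: ltW|exact: nrm2_ge0].
  have -> : h' ^+ 3 * h' `^ g * b ^+ 2 = (b ^+ 2 * s1 `^ g) * (t `^ g * h' ^+ 3).
    by rewrite hg; ring.
  rewrite ger_pMl// mulr_gt0 ?powR_gt0// exprn_gt0//.
apply: (HC (h / s1) q) => //; last by rewrite lexx/= ler_pdivrMr// mul1r.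
split.
- by move=> t; exact: p01.
- by move=> s t st; apply: pm; rewrite ler_wpM2l// ltW.
- rewrite /q mulr1 /p; apply: (small_ball_lt1 HPi _ K1 (twin_good1 tw) cv _ vc N0 s10).
    by rewrite l0.
  apply: (le_trans (y := (c0 * a) ^+ 2)).
    by apply: lerXn2r; [exact: ltW|exact: ltW|exact: le_trans mnc].
  apply: (le_trans (y := lam ^+ N * a ^+ 2 / 2)).
    have -> : (c0 * a) ^+ 2 = lam ^+ N * (lam ^+ N * a ^+ 2 / 4) by rewrite /c0; field.
    have a2 : 0 <= lam ^+ N * a ^+ 2 by rewrite mulr_ge0 ?sqr_ge0// ltW.
    apply: (le_trans (y := lam ^+ N * a ^+ 2 / 4)).
      by rewrite ger_pMl// divr_gt0// mulr_gt0// exprn_gt0.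
    by apply: ler_wpM2l => //; rewrite lef_pV2 ?posrE// ler_nat.
  by apply: ler_wpM2r => //; apply: ler_wpM2l => //; exact: ltW.
- move=> t I t0 ht.
  have st0 : 0 < s1 * t by rewrite mulr_gt0.
  have := small_ball_rec1 HPi K1 tw vc d0 hd x I st0.
  have e : rot_scale R N * (s1 * t) * 4 ^+ (N * I) = s1 * (B * t * 4 ^+ (N * I)).
    by rewrite /B; ring.
  rewrite e => H; apply: (le_trans H); rewrite lerD2l; exact: err.
- move=> t I t0 ht.
  have st0 : 0 < s1 * t by rewrite mulr_gt0.
  have := small_ball_rec2 HPi K1 tw vc N0 d0 hd x I st0.
  have e i : rot_scale R N * (s1 * t) * 4 ^+ (N * i) = s1 * (B * t * 4 ^+ (N * i)).
    by rewrite /B; ring.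
  under eq_bigr do rewrite e.
  move=> H; apply: (le_trans H); rewrite lerD2l; exact: err.
Qed.

(** * Centred powers and chaoses *)

Section centered_powers.
Context (R : realType) (d : measure_display) (T : measurableType d)
  (P : probability T R) (dstar kstar : nat) (X : nat -> 'I_dstar -> T -> R).
Hypotheses (dstar0 : (0 < dstar)%N) (mX : random_vectors X).
Local Notation m := (dstar * kstar)%N.
Implicit Types i j : 'I_m.

(** Opens the dependent match on [dstar]; later arguments only need some centred power of some
    coordinate. *)
Lemma ZcE n i : exists l k,
  Zc P X n i = (fun w => X n l w ^+ k.+1 - fine ('E_P[fun w' => X n l w' ^+ k.+1])).
Proof. by case: dstar X dstar0 i => // p X' _ i; do 2 eexists. Qed.

Lemma measurable_Zc n i : measurable_fun setT (Zc P X n i).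
Proof.
have [l [k ->]] := ZcE n i.
by apply: measurable_funB => //; apply: measurable_funX; exact: mX.
Qed.

Lemma sigma_vec_Zc n i (B : set R) : measurable B -> sigma_vec X n (Zc P X n i @^-1` B).
Proof.
move=> mB; have [l [k ->]] := ZcE n i; set a := fine _.
apply: sub_sigma_algebra; exists l, ((fun x : R => x ^+ k.+1 - a) @^-1` B); split=> //.
apply: measurable_preimage => //; apply: measurable_funB => //.
Qed.

Lemma sigma_vec_measurable n : sigma_vec X n `<=` measurable.
Proof.
apply: smallest_sub; first exact: sigma_algebra_measurable.
by move=> A [l [B [mB ->]]]; apply: measurable_preimage => //; exact: mX.
Qed.

Lemma sigma_vecT n : sigma_vec X n setT.
Proof.
rewrite -setC0 -setTD; apply: sigma_algebraCD.
exact: sigma_algebra0.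
Qed.

Lemma sigma_vecI n : setI_closed (sigma_vec X n).
Proof.
move=> A B; rewrite /sigma_vec; set G := [set _ | _] => hA hB.
exact: (@measurableI _ (g_sigma_algebraType G) A B hA hB).
Qed.

Section moments.
Context (M : R).
Hypothesis ZM : forall n i, ('N[P]_(4%:E)[EFin \o Zc P X n i] <= M%:E)%E.

Lemma Zc_moment4 n i :
  L4 P (Zc P X n i) /\ Er P (fun w => Zc P X n i w ^+ 4) <= M ^+ 4.
Proof.
have M0 : 0 <= M by rewrite -lee_fin; apply: le_trans (ZM n i); exact: Lnorm_ge0.
have e4 x : `|x| `^ 4 = x ^+ 4 :> R.
  by rewrite powR_mulrn// -normrX ger0_norm// exprn_even_ge0.
have e4E w : (`|(EFin \o Zc P X n i) w| `^ 4)%E = (Zc P X n i w ^+ 4)%:E.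
  by rewrite /= -e4.
have H : (\int[P]_w (Zc P X n i w ^+ 4)%:E <= (M ^+ 4)%:E)%E.
  have := @gt0_ler_poweR R 4 (ler0n _ _) _ _ _ _ (ZM n i).
  rewrite poweR_Lnorm ?gt_eqF// poweR_EFin -[4]/(4%:R) powR_mulrn//.
  rewrite (eq_integral (fun w => (Zc P X n i w ^+ 4)%:E)); last by move=> w _; exact: e4E.
  by move=> H; apply: H; rewrite in_itv/= ?Lnorm_ge0 ?lee_fin ?M0 leey.
have mZ := measurable_Zc n i.
have h4 w : 0 <= Zc P X n i w ^+ 4 by rewrite exprn_even_ge0.
have L : L4 P (Zc P X n i).
  split=> //; apply/integrableP; split.
    by apply/measurable_EFinP; exact: measurable_funX.
  apply: le_lt_trans (ltry (M ^+ 4)); apply: le_trans H.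
  rewrite (eq_integral (fun w => (Zc P X n i w ^+ 4)%:E))// => w _.
  by rewrite /= ger0_norm.
split=> //; rewrite -lee_fin -Er_EFin//; by case: L.
Qed.

Lemma Er_Zc n i : Er P (Zc P X n i) = 0.
Proof.
have [L _] := Zc_moment4 n i; have := L4_ig L.
have [l [k ->]] := ZcE n i; set a := fine _ => iZ.
have iX : ig P (fun w => X n l w ^+ k.+1).
  have := igD iZ (ig_cst P a).
  by under eq_fun do rewrite subrK.
rewrite ErB ?Er_cst//; last exact: ig_cst.
by apply/eqP; rewrite subr_eq0 /a expectation.unlock.
Qed.

Lemma covZE n i j : covZ P kstar X n i j = Er P (fun w => Zc P X n i w * Zc P X n j w).
Proof.
rewrite mxE unlock.
have e (l : 'I_m) : fine ('E_P[Zc P X n l]) = 0.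
  by rewrite expectation.unlock; exact: Er_Zc.
rewrite !e unlock /Er /Rintegral; congr fine; apply: eq_integral => w _.
by rewrite /= -[RHS]/((Zc P X n i w * Zc P X n j w)%:E) /= /cst /GRing.mul/= !subr0.
Qed.

Lemma cov_ge_Zc lam L : (forall n, loewner_ge (covZ P kstar X n) lam%:M) ->
  cov_ge P L lam (Zc P X (kstar := kstar)).
Proof.
move=> H n _ x; have := H n (\row_i x i).
rewrite mulmxBr mulmxBl mul_mx_scalar mxE [X in _ + X]mxE -scalemxAl mxE subr_ge0.
move=> h; apply: (le_trans (y := lam * \sum_i x i ^+ 2)) => //.
have -> : lam * \sum_i x i ^+ 2 = lam * (\row_i x i *m (\row_i x i)^T) 0 0.
  by congr (_ * _); rewrite mxE; apply: eq_bigr => i _; rewrite !mxE expr2.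
rewrite [in leLHS]mxE in h; apply: (le_trans h).
under eq_bigr => j _ do rewrite !mxE big_distrl/=.
rewrite exchange_big/=; apply: ler_sum => i _; apply: ler_sum => j _.
by rewrite -covZE [in leLHS]mxE mulrAC lexx.
Qed.

End moments.
End centered_powers.

(** * Two independent copies on the product space *)

Section projections.
Context (R : realType) (d1 d2 : measure_display) (T1 : measurableType d1)
  (T2 : measurableType d2) (P1 : probability T1 R) (P2 : probability T2 R).

Lemma pr_prod (A : set T1) (B : set T2) : measurable A -> measurable B ->
  pr (Pprod P1 P2) (A `*` B) = pr P1 A * pr P2 B.
Proof.
move=> mA mB; rewrite {1}/pr /Pprod /= product_measure1E//.
exact: fineM (fin_num_measure P1 A mA) (fin_num_measure P2 B mB).
Qed.

Lemma ig_fst (f : T1 -> R) : ig P1 f -> ig (Pprod P1 P2) (fun w => f w.1).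
Proof.
move=> hf; have := ig_prod hf (ig_cst P2 1).
by under eq_fun do rewrite mulr1.
Qed.

Lemma ig_snd (f : T2 -> R) : ig P2 f -> ig (Pprod P1 P2) (fun w => f w.2).
Proof.
move=> hf; have := ig_prod (ig_cst P1 1) hf.
by under eq_fun do rewrite mul1r.
Qed.

Lemma Er_fst (f : T1 -> R) : ig P1 f -> Er (Pprod P1 P2) (fun w => f w.1) = Er P1 f.
Proof.
move=> hf; have := Er_prod hf (ig_cst P2 1); rewrite Er_cst mulr1 => <-.
by under [in RHS]eq_fun do rewrite mulr1.
Qed.

Lemma Er_snd (f : T2 -> R) : ig P2 f -> Er (Pprod P1 P2) (fun w => f w.2) = Er P2 f.
Proof.
move=> hf; have := Er_prod (ig_cst P1 1) hf; rewrite Er_cst mul1r => <-.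
by under [in RHS]eq_fun do rewrite mul1r.
Qed.

Lemma L4_fst (f : T1 -> R) : L4 P1 f -> L4 (Pprod P1 P2) (fun w => f w.1).
Proof. by move=> [mf hf]; split; [exact: measurableT_comp|exact: ig_fst hf]. Qed.

Lemma L4_snd (f : T2 -> R) : L4 P2 f -> L4 (Pprod P1 P2) (fun w => f w.2).
Proof. by move=> [mf hf]; split; [exact: measurableT_comp|exact: ig_snd hf]. Qed.

End projections.

Section two_copies.
Context (R : realType) (d : measure_display) (T : measurableType d)
  (P : probability T R) (Sg : nat -> set (set T)) (L m : nat)
  (V : nat -> 'I_m -> T -> R).

(** Block [k] of both copies is measurable for the same family, so the exchange between a copy and
    its rotation takes place inside one [pi_family]. *)
Definition rectangles k : set (set (T * T)) :=
  [set C | exists A B, [/\ Sg k A, Sg k B & C = A `*` B]].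

Lemma pi_family_rectangles : pi_family P Sg L -> pi_family (Pprod P P) rectangles L.
Proof.
move=> [ST SI Sm SP]; split=> [k|k _ _ [A [B [hA hB ->]]] [A' [B' [hA' hB' ->]]]|k _ [A [B [hA hB ->]]]|C hC].
- by exists setT, setT; split=> //; rewrite setXTT.
- by exists (A `&` A'), (B `&` B'); split; [exact: SI|exact: SI|rewrite setXI].
- by apply: measurableX; [exact: Sm hA|exact: Sm hB].
have /choice[AB hAB] : forall k, exists AB : set T * set T,
    [/\ Sg k AB.1, Sg k AB.2 & C k = AB.1 `*` AB.2].
  by move=> k; have [A [B h]] := hC k; exists (A, B).
have mA k : measurable (AB k).1 by have [h _ _] := hAB k; exact: Sm h.
have mB k : measurable (AB k).2 by have [_ h _] := hAB k; exact: Sm h.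
have e n : \big[setI/setT]_(k < n) C k =
    (\big[setI/setT]_(k < n) (AB k).1) `*` (\big[setI/setT]_(k < n) (AB k).2).
  elim: n => [|n IH]; first by rewrite !big_ord0 setXTT.
  by rewrite !big_ord_recr/= IH setXI; have [_ _ ->] := hAB n.
rewrite e pr_prod; try by apply: bigsetI_measurable => k _.
rewrite (SP (fun k => (AB k).1)); last by move=> k; have [] := hAB k.
rewrite (SP (fun k => (AB k).2)); last by move=> k; have [] := hAB k.
rewrite -big_split.
by apply: eq_bigr => k _ /=; have [_ _ ->] := hAB k; rewrite pr_prod.
Qed.

(** Cross-covariances vanish by Fubini and centring; the event that both copies are near [x] is a
    rectangle A x A, which yields the square. *)
Lemma twin_copies K : pi_family P Sg L ->
  (forall k i (B : set R), measurable B -> Sg k (V k i @^-1` B)) ->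
  (forall k i, L4 P (V k i)) -> (forall k i, Er P (V k i) = 0) ->
  (forall k i, Er P (fun w => V k i w ^+ 4) <= K) ->
  twin (Pprod P P) rectangles L K (fun k i w => V k i w.1) (fun k i w => V k i w.2).
Proof.
move=> hS hV V4 V0 VK; have HPi := pi_family_rectangles hS.
have [ST _ Sm _] := hS.
have iV k i : ig P (V k i) := L4_ig (V4 k i).
have i4 k i : ig P (fun w => V k i w ^+ 4) by have [] := V4 k i.
have gV : good_env P Sg L K V.
  by move=> k kL i; split=> //; apply: (mbs_base hS) => // B mB; exact: hV.
split.
- move=> k kL i; split.
  + apply: (mbs_base HPi) => // B mB; exists (V k i @^-1` B), setT; split=> //; first exact: hV.
    by rewrite eqEsubset; split=> w //= [].
  + exact: L4_fst.
  + by rewrite Er_fst.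
  + by rewrite (Er_fst P (i4 k i)).
- move=> k kL i; split.
  + apply: (mbs_base HPi) => // B mB; exists setT, (V k i @^-1` B); split=> //; first exact: hV.
    by rewrite eqEsubset; split=> w //= [].
  + exact: L4_snd.
  + by rewrite Er_snd.
  + by rewrite (Er_snd P (i4 k i)).
- move=> k kL i j; have h := ig_mul2 (V4 k i) (V4 k j).
  by rewrite (Er_fst P h) (Er_snd P h).
- by move=> k kL i j; rewrite Er_prod// V0 mul0r.
move=> c x s; pose A := [set w | `|ev L c V w - x| <= s].
have mA : measurable A.
  by apply: measurable_ball_set; exact: (measurable_ev hS c gV).
rewrite (_ : [set w | _ /\ _] = A `*` A)//; rewrite (_ : [set w | _ <= s] = A `*` setT).
  by rewrite !pr_prod// [pr P setT]/pr probability_setT/= mulr1 expr2.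
by rewrite eqEsubset; split=> w //= [].
Qed.

Lemma pr_ev_fst K c x s : pi_family P Sg L -> good_env P Sg L K V ->
  pr (Pprod P P) [set w | `|ev L c (fun k i w => V k i w.1) w - x| <= s] =
  pr P [set w | `|ev L c V w - x| <= s].
Proof.
move=> hS gV; pose A := [set w | `|ev L c V w - x| <= s].
have mA : measurable A.
  by apply: measurable_ball_set; exact: (measurable_ev hS c gV).
rewrite (_ : [set w | _] = A `*` setT).
  by rewrite pr_prod// [pr P setT]/pr probability_setT/= mulr1.
by rewrite eqEsubset; split=> w //= [].
Qed.

Lemma cov_ge_fst lam : (forall k i, L4 P (V k i)) -> cov_ge P L lam V ->
  cov_ge (Pprod P P) L lam (fun k i w => V k i w.1).
Proof.
move=> V4 cV k kL x; apply: (le_trans (cV k kL x)).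
apply: ler_sum => i _; apply: ler_sum => j _.
by rewrite (Er_fst P (ig_mul2 (V4 k i) (V4 k j))).
Qed.

End two_copies.

(** * Coefficient norms over a finite range of blocks *)

Section coefficient_norms.
Context (R : realType) (m : nat).
Implicit Types (c : seq (nat * 'I_m) -> R) (a : seq (nat * 'I_m)).

(** Reduces sums over all multi-indices to sums over the list [mis m L]. *)
Definition supp_lt L c := forall a, multi_index a -> a \notin mis m L -> c a = 0.

Lemma mis_multi_index L a : a \in mis m L -> multi_index a.
Proof. by rewrite mem_mis => /andP[]. Qed.

Lemma finitely_supported_lt c : finitely_supported c -> exists L, supp_lt L c.
Proof.
move=> /finite_seqP[s hs].
exists (\max_(a <- s) \max_(x <- a) x.1.+1)%N => a ha; apply: contraNeq => ca.
have as_ : a \in s by have : [set` s] a by rewrite -hs; split.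
rewrite mem_mis; apply/andP; split=> //; apply/allP => x xa.
apply: (@leq_trans (\max_(x <- a) x.1.+1)%N); last exact: leq_bigmax_seq.
exact: (@leq_bigmax_seq _ _ _ (fun x : nat * 'I_m => x.1.+1)).
Qed.

Lemma fsum_mis L (p : pred (seq (nat * 'I_m))) (F : seq (nat * 'I_m) -> R) :
  (forall a, multi_index a -> a \notin mis m L -> F a = 0) ->
  \sum_(a \in [set a | multi_index a /\ p a]) F a = \sum_(a <- mis m L | p a) F a.
Proof.
move=> hF; rewrite (@fsbigE _ _ _ _ _ [seq a <- mis m L | p a]).
- rewrite big_filter_cond big_seq_cond [RHS]big_seq_cond; apply: eq_bigl => a.
  have [aL|//] := boolP (a \in mis m L); case pa: (p a) => //=.
  by apply/asboolP; split=> //; exact: mis_multi_index aL.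
- by rewrite filter_uniq// uniq_mis.
- by move=> a /=; rewrite mem_filter => /andP[pa /mis_multi_index].
- by move=> a [ha pa]; rewrite mem_filter pa/=; exact: hF.
Qed.

Section supp.
Context (L N : nat) (c : seq (nat * 'I_m) -> R).
Hypotheses (sc : supp_lt L c) (vc : vanish_above N c).

Lemma vanL_vanish : vanL L N c.
Proof. by move=> a aL sa; apply: vc => //; exact: mis_multi_index aL. Qed.

Lemma sum_mis_le (F : seq (nat * 'I_m) -> R) : (forall a, c a = 0 -> F a = 0) ->
  \sum_(a <- mis m L | (size a <= N)%N) F a = \sum_(a <- mis m L) F a.
Proof.
move=> hF; rewrite big_mkcond/=; apply: eq_big_seq => a aL.
by case: leqP => // Na; rewrite hF// vanL_vanish.
Qed.

Lemma cnorm_sqr : cnorm N c ^+ 2 = nrm2 L c.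
Proof.
rewrite /cnorm (fsum_mis (L := L)) => [|a ha aL]; last by rewrite sc// expr0n.
rewrite sqr_sqrtr; last by apply: sumr_ge0 => a _; exact: sqr_ge0.
by rewrite sum_mis_le// => a ->; rewrite expr0n.
Qed.

Lemma cnorm_deg_sqr : cnorm_deg N c ^+ 2 = \sum_(a <- mis m L | size a == N) c a ^+ 2.
Proof.
rewrite /cnorm_deg.
rewrite (_ : [set a | _ /\ _] = [set a | multi_index a /\ size a == N]); last first.
  by rewrite eqEsubset; split=> a [ha /eqP].
rewrite (fsum_mis (L := L)) => [|a ha aL]; last by rewrite sc// expr0n.
by rewrite sqr_sqrtr//; apply: sumr_ge0 => a _; exact: sqr_ge0.
Qed.

Lemma fsum_touches n :
  \sum_(a \in [set a | multi_index a /\ n \in [seq x.1 | x <- a]]) c a ^+ 2 = infl L c n.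
Proof.
rewrite (fsum_mis (L := L) (touches n)) => [|a ha aL]; last by rewrite sc// expr0n.
rewrite /infl /nrm2 big_mkcond/=; apply: eq_bigr => a _.
by rewrite /restr; case: ifP => // _; rewrite expr0n.
Qed.

(** All influences are at most [nrm2 L c], so the set is bounded above and [sup] is a genuine
    supremum rather than a default value. *)
Lemma infl_le_delta_star n : infl L c n <= delta_star c ^+ 2.
Proof.
rewrite /delta_star; set S := [set _ | _ in _].
have hS x : S x -> 0 <= x <= nrm2 L c.
  move=> [k _ <-]; rewrite fsum_touches nrm2_ge0/=.
  apply: ler_sum => a _; rewrite /restr; case: ifP => // _.
  by rewrite expr0n sqr_ge0.
have Sn : S (infl L c n) by exists n => //; exact: fsum_touches.
have ub : has_ubound S by exists (nrm2 L c) => x /hS /andP[].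
rewrite sqr_sqrtr; first exact: ub_le_sup.
by have /andP[h _] := hS _ Sn; apply: (le_trans h); exact: ub_le_sup.
Qed.

(** A nonzero coefficient of degree [N] > 0 touches a block and gives it a positive influence. This
    keeps the smoothing parameter positive. *)
Lemma delta_star_gt0 : (0 < N)%N -> 0 < cnorm_deg N c -> 0 < delta_star c.
Proof.
move=> N0 a0; rewrite lt_neqAle sqrtr_ge0 andbT eq_sym; apply/eqP => d0.
have c0 a : a \in mis m L -> size a == N -> c a = 0.
  case: a => [|x a] aL /eqP sa; first by rewrite -sa in N0.
  have := infl_le_delta_star x.1; rewrite d0 expr0n/= => h.
  have /eqP : infl L c x.1 = 0 by apply/eqP; rewrite eq_le h nrm2_ge0.
  rewrite /infl /nrm2 psumr_eq0; last by move=> b _; exact: sqr_ge0.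
  by move=> /allP/(_ _ aL)/=; rewrite /restr /touches /= inE eqxx sqrf_eq0 => /eqP.
have := exprn_gt0 2 a0; rewrite cnorm_deg_sqr big_seq_cond big1 ?ltxx// => a /andP[aL sa].
by rewrite c0// expr0n.
Qed.

End supp.
End coefficient_norms.

Section polynomial_chaos.
Context (R : realType) (d : measure_display) (T : measurableType d)
  (P : probability T R) (dstar kstar : nat) (X : nat -> 'I_dstar -> T -> R).
Hypotheses (dstar0 : (0 < dstar)%N) (mX : random_vectors X).
Local Notation m := (dstar * kstar)%N.
Context (L N : nat) (c : seq (nat * 'I_m) -> R).
Hypotheses (sc : supp_lt L c) (vc : vanish_above N c).

Lemma QE : Q P N c X = ev L c (Zc P X (kstar := kstar)).
Proof.
apply/funext => w; rewrite /Q (fsum_mis (L := L)) => [|a ha aL]; last by rewrite sc// mul0r.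
by rewrite (sum_mis_le L vc)// => a ->; rewrite mul0r.
Qed.

Lemma measurable_Q : measurable_fun setT (Q P N c X).
Proof.
rewrite QE /ev /mpoly; apply: measurable_sum => a; apply: measurable_funM => //.
apply: measurable_prod => x _; exact: measurable_Zc.
Qed.

Lemma pi_family_sigma_vec : independent_seq P X -> pi_family P (sigma_vec X) L.
Proof.
move=> iX; split.
- by move=> k; exact: sigma_vecT.
- by move=> k; exact: sigma_vecI.
- by move=> k; exact: sigma_vec_measurable.
move=> A hA; have := iX (index_iota 0 L) A (iota_uniq _ _) (fun n _ => hA n).
have mA k : measurable (A k) by exact: sigma_vec_measurable (hA k).
rewrite !big_mkord => e; apply: EFin_inj.
rewrite -pr_EFin; last by apply: bigsetI_measurable.
by rewrite e -prodEFin; apply: eq_bigr => k _; rewrite -pr_EFin.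
Qed.

End polynomial_chaos.

Theorem chaos_anticoncentration (R : realType) (dstar kstar N : nat) (lam M theta : R) :
  (0 < dstar)%N -> (0 < N)%N -> 0 < lam <= 1 -> 0 < theta < 1 ->
  exists C : R, 0 < C /\
  forall (d : measure_display) (T : measurableType d) (P : probability T R)
    (Y : nat -> 'I_dstar -> T -> R) (c : seq (nat * 'I_(dstar * kstar)) -> R)
    (delta h x : R),
  random_vectors Y -> independent_seq P Y ->
  (forall n (i : 'I_(dstar * kstar)), ('N[P]_(4%:E)[EFin \o Zc P Y n i] <= M%:E)%E) ->
  (forall n, loewner_ge (covZ P kstar Y n) lam%:M) ->
  finitely_supported c -> vanish_above N c -> 0 < cnorm_deg N c ->
  0 < delta -> delta_star c <= delta ->
  0 < h <= 1 -> delta <= h ^+ 3 * h `^ (2 * N%:R)^-1 ->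
  pr P [set w | `|Q P N c Y w - x| <= h] <=
    C * (1 + cnorm_deg N c ^- (2 * N)) * (1 + cnorm N c) ^+ 2 *
    h `^ (theta * (2 * N%:R)^-1).
Proof.
(* The maximum with 1 meets the normalisation 1 <= K of the moment bounds. *)
move=> dstar0 N0 lam01 th01; pose K := Num.max 1 (M ^+ 4).
have K1 : 1 <= K by rewrite le_max lexx.
have [C [C0 HC]] := @anticoncentration R (dstar * kstar)%N N K lam theta N0 K1 lam01 th01.
exists C; split=> // d T P Y c delta h x mY iY YM hcov /finitely_supported_lt[L sc] vc a0 d0 hd h01 hdh.
pose Z := Zc P Y (kstar := kstar).
have hS := pi_family_sigma_vec mY L iY.
have Z4 k i : L4 P (Z k i) by have [] := Zc_moment4 dstar0 mY YM k i.
have ZK k i : Er P (fun w => Z k i w ^+ 4) <= K.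
  have [_ h4] := Zc_moment4 dstar0 mY YM k i.
  by apply: (le_trans h4); rewrite le_max lexx orbT.
have ZB k i (B : set R) : measurable B -> sigma_vec Y k (Z k i @^-1` B).
  exact: sigma_vec_Zc.
have Z0 k i : Er P (Z k i) = 0 by exact: Er_Zc YM _ _.
have gZ : good_env P (sigma_vec Y) L K Z.
  by move=> k kL i; split=> //; apply: (mbs_base hS) => // B mB; exact: ZB.
rewrite (QE P Y sc vc) -(pr_ev_fst c x h hS gZ).
apply: (HC _ _ _ _ _ _ _ c delta) => //.
- exact: pi_family_rectangles hS.
- exact: twin_copies.
- by apply: cov_ge_fst => //; exact: cov_ge_Zc YM _ _ hcov.
- exact: vanL_vanish.
- move=> n _; apply: (le_trans (infl_le_delta_star sc n)).
  by apply: lerXn2r; rewrite ?nnegrE// ?sqrtr_ge0// ltW.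
- by rewrite (cnorm_deg_sqr N sc).
- exact: sqrtr_ge0.
- by rewrite (cnorm_sqr sc vc).
Qed.

(** * Kolmogorov smoothing *)

Section smoothing.
Context (R : realType) (d : measure_display) (T : measurableType d)
  (P : probability T R) (F G : T -> R).
Hypotheses (mF : measurable_fun setT F) (mG : measurable_fun setT G).

Lemma Ck_unit_ball_continuous k f : Ck_unit_ball k f -> continuous (f : R -> R).
Proof.
case: k => [|k] [Hd [Hc _]]; first exact: Hc.
by move=> x; apply/differentiable_continuous/derivable1_diffP; exact: (Hd 0%N).
Qed.

Lemma unit_ball_Er k f (U : T -> R) : Ck_unit_ball k f -> measurable_fun setT U ->
  ig P (f \o U) /\ `|Er P (f \o U)| <= 1.
Proof.
move=> Hf mU; have [_ [_ Hb]] := Hf.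
have b1 y : `|f y| <= 1 by exact: (Hb 0%N).
have mf : measurable_fun setT (f \o U).
  apply: measurableT_comp mU.
  by apply: continuous_measurable_fun; exact: Ck_unit_ball_continuous Hf.
have iU : ig P (f \o U) by apply: ig_le mf _ (ig_cst P 1) => w; exact: b1.
split=> //; apply: (le_trans (Er_norm iU)); rewrite -(Er_cst P 1).
by apply: Er_le => [| |w]; [exact: ig_norm|exact: ig_cst|exact: b1].
Qed.

(** Test functions are bounded by 1, so the set defining [dk] is bounded by 2 and its [sup]
    dominates each element. *)
Lemma Er_le_dk k f : Ck_unit_ball k f -> `|Er P (f \o F) - Er P (f \o G)| <= dk P k F G.
Proof.
have e g : fine ('E_P[g \o F]) - fine ('E_P[g \o G]) = Er P (g \o F) - Er P (g \o G).
  by rewrite !expectation.unlock.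
move=> Hf; rewrite -e; apply: ub_le_sup; last by exists f.
exists 2 => _ [g Hg <-]; rewrite e; apply: (le_trans (ler_normB _ _)).
have [_ h1] := unit_ball_Er Hg mF; have [_ h2] := unit_ball_Er Hg mG.
lra.
Qed.

Lemma dk_ge0 k : 0 <= dk P k F G.
Proof.
apply: le_trans (normr_ge0 _) (Er_le_dk (f := cst 0) _); split.
- move=> j _ x; rewrite (_ : derive1n j _ = cst 0); first exact: derivable_cst.
  by elim: j => // j IH; rewrite derive1nS IH; apply/funext => y; rewrite derive1_cst.
have D j : derive1n j (cst 0 : R -> R) = cst 0.
  by elim: j => // j IH; rewrite derive1nS IH; apply/funext => y; rewrite derive1_cst.
by rewrite D; split=> [x|j _ x]; [exact: cvg_cst|rewrite D normr0].
Qed.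

(* Rescaling a step of width [h] to have [K] derivatives bounded by 1. *)
Lemma step_unit_ball K (h x : R) : 0 < h <= 1 ->
  Ck_unit_ball K (fun y => (2 ^+ K * (K.+1%:R / h) ^+ K)^-1 *
    step_aff K (K.+1%:R / h) (- (K.+1%:R / h * x)) 0 y).
Proof.
move=> /andP[h0 h1]; set a := K.+1%:R / h; set b := - _; set s := _^-1.
have a1 : 1 <= a by rewrite ler_pdivlMr// mul1r; apply: (le_trans h1); rewrite ler1n.
have aK : 0 < 2 ^+ K * a ^+ K by rewrite mulr_gt0// exprn_gt0//; lra.
have s0 : 0 < s by rewrite invr_gt0.
have D j : (j < K)%N -> forall y : R, is_derive y 1 (fun y => s * step_aff K a b j y)
    (s * step_aff K a b j.+1 y).
  move=> jK y; have := is_derive_step_aff a b y jK.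
  exact: is_deriveZ.
have E j : (j <= K)%N -> derive1n j (fun y => s * step_aff K a b 0 y) =
    (fun y => s * step_aff K a b j y).
  elim: j => // j IH jK; rewrite derive1nS IH; last exact: ltnW.
  by apply/funext => y; rewrite derive1E; have [_ ->] := D j jK y.
split; [|split].
- by move=> j jK y; rewrite E; [have [] := D j jK y|exact: ltnW].
- rewrite E// => y; apply: cvgM; first exact: cvg_cst.
  exact: continuous_step_aff.
- move=> j jK y; rewrite E// normrM (ger0_norm (ltW s0)) /s ler_pdivrMl// mulr1.
  apply: (le_trans (step_aff_bound a b y jK)); apply: ler_wpM2l; first exact: exprn_ge0.
  by rewrite ger0_norm; [exact: ler_weXn2l|lra].
Qed.

Lemma Kolmogorov_smoothing K (h x p : R) : 0 < h <= 1 ->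
  pr P [set w | `|G w - x| <= h] <= p ->
  `|pr P [set w | F w <= x] - pr P [set w | G w <= x]| <=
    p + 2 ^+ K * (K.+1%:R / h) ^+ K * dk P K F G.
Proof.
move=> h01 hp; have /andP[h0 h1] := h01.
set W := _ * dk _ _ _ _.
have mle (U : T -> R) y : measurable_fun setT U -> measurable [set w | U w <= y].
  by move=> mU; exact: measurable_le_set.
have mB : measurable [set w | `|G w - x| <= h] by exact: measurable_ball_set.
pose phi z := step_aff K (K.+1%:R / h) (- (K.+1%:R / h * z)) 0.
have phiE z y : phi z y = smooth_step K.+1 (K.+1%:R * ((y - z) / h)).
  rewrite /phi /step_aff expr0 mul1r step_d0; congr smooth_step.
  by set k : R := K.+1%:R; field; rewrite gt_eqF.
have phi01 z y : 0 <= phi z y <= 1 by rewrite phiE smooth_step01.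
have phi0 z y : y <= z -> phi z y = 0.
  move=> yz; rewrite phiE smooth_step_eq0// mulr_ge0_le0// mulr_le0_ge0 ?invr_ge0//; lra.
have phi1 z y : z + h <= y -> phi z y = 1.
  move=> yz; rewrite phiE smooth_step_eq1// ler_peMr// ler_pdivlMr// mul1r; lra.
have mphi z (U : T -> R) : measurable_fun setT U -> ig P (phi z \o U).
  move=> mU; have mf : measurable_fun setT (phi z \o U).
    apply: measurableT_comp mU; apply: continuous_measurable_fun.
    exact: continuous_step_aff.
  apply: ig_le mf _ (ig_cst P 1) => w /=; have /andP[? ?] := phi01 z (U w).
  by rewrite ger0_norm.
have cmp z : `|Er P (phi z \o F) - Er P (phi z \o G)| <= W.
  have := Er_le_dk (step_unit_ball K z h01); rewrite -/(phi z).
  set s := (_ * _)^-1 => hd.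
  have s0 : 0 < 2 ^+ K * (K.+1%:R / h) ^+ K :> R.
    by rewrite mulr_gt0 ?exprn_gt0// divr_gt0.
  have e (U : T -> R) : measurable_fun setT U ->
      Er P ((fun y => s * phi z y) \o U) = s * Er P (phi z \o U).
    by move=> mU; rewrite -ErZ//; exact: mphi.
  move: hd; rewrite !e// -mulrBr normrM ger0_norm; last by rewrite invr_ge0 ltW.
  by rewrite ler_pdivrMl.
(* [1_{U <= z} <= 1 - phi z U <= 1_{U <= z + h}] *)
have lo z (U : T -> R) : measurable_fun setT U -> pr P [set w | U w <= z] <= 1 - Er P (phi z \o U).
  move=> mU; rewrite -Er_indic//; last exact: mle.
  rewrite -[X in X - _](Er_cst P 1) -ErB; [|exact: ig_cst|exact: mphi].
  apply: Er_le => [| |w].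
  - by apply: ig_indic; exact: mle.
  - by apply: igB; [exact: ig_cst|exact: mphi].
  rewrite indicE_if; case: ifPn => [/set_mem/= hw|_]; first by rewrite phi0// subr0.
  by have /andP[_ ?] := phi01 z (U w); rewrite subr_ge0.
have up z (U : T -> R) : measurable_fun setT U ->
    1 - Er P (phi z \o U) <= pr P [set w | U w <= z + h].
  move=> mU; rewrite -Er_indic//; last exact: mle.
  rewrite -[X in X - _](Er_cst P 1) -ErB; [|exact: ig_cst|exact: mphi].
  apply: Er_le => [| |w].
  - by apply: igB; [exact: ig_cst|exact: mphi].
  - by apply: ig_indic; exact: mle.
  rewrite indicE_if; case: ifPn => [_|/negP hw].
    by have /andP[? _] := phi01 z (U w); rewrite gerBl.
  rewrite /= phi1 ?subrr// ltW// ltNge; apply/negP => hz; apply: hw.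
  exact: mem_set.
have wG : pr P [set w | G w <= x + h] <= pr P [set w | G w <= x] + p.
  apply: (le_trans _ (lerD (lexx _) hp)); apply: (le_trans _ (prU_le P _ mB)); last exact: mle.
  apply: pr_le; [exact: mle|by apply: measurableU => //; exact: mle|].
  move=> w /= hw; have [?|?] := leP (G w) x; [by left|right].
  by rewrite ger0_norm; lra.
have wG' : pr P [set w | G w <= x] <= pr P [set w | G w <= x - h] + p.
  apply: (le_trans _ (lerD (lexx _) hp)); apply: (le_trans _ (prU_le P _ mB)); last exact: mle.
  apply: pr_le; [exact: mle|by apply: measurableU => //; exact: mle|].
  move=> w /= hw; have [?|?] := leP (G w) (x - h); [by left|right].
  by rewrite ler_norml; apply/andP; split; lra.
(* The step at [x] bounds the law of [F] from above and the step at [x - h] from below; in both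
   cases the window of width [h] is paid by [G] alone. *)
have := cmp x; have := cmp (x - h); rewrite !ler_norml => /andP[c1 c2] /andP[c3 c4].
have l1 := lo x F mF; have u1 := up x G mG.
have l2 := lo (x - h) G mG; have u2 := up (x - h) F mF; rewrite subrK in u2.
by apply/andP; split; lra.
Qed.

End smoothing.

(* The smoothing width [h] balances [h^(1/(2N))] against [D / h^K]. *)
Lemma smoothing_scale (R : realType) (N K : nat) (D theta : R) :
  (0 < N)%N -> (3 <= K)%N -> 0 < D <= 1 -> theta <= 1 ->
  exists h, [/\ 0 < h <= 1, D <= h ^+ 3 * h `^ (2 * N%:R)^-1,
    D / h ^+ K <= D `^ (theta / (2 * K * N + 1)%:R) &
    h `^ (theta * (2 * N%:R)^-1) = D `^ (theta / (2 * K * N + 1)%:R)].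
Proof.
move=> N0 K3 /andP[D0 D1] th1; set n : R := N%:R; set r : R := (2 * K * N + 1)%:R.
have n0 : 0 < n by rewrite ltr0n.
have rE : r = 2 * K%:R * n + 1 by rewrite /r natrD !natrM.
have k0 : 0 <= K%:R :> R by exact: ler0n.
have r0 : 0 < r by rewrite rE; nra.
(* The solution of h^K h^(1/(2N)) = D: then D / h^K = D^(1/r), and K >= 3 with h <= 1 gives the
   condition on D. *)
pose h := D `^ (2 * n / r).
have h0 : 0 < h by exact: powR_gt0.
have h1 : h <= 1.
  rewrite -(powRr0 D); apply: ger_powR; rewrite ?D0 ?D1//.
  by rewrite divr_ge0 ?mulr_ge0// ltW.
have hg : h `^ (2 * n)^-1 = D `^ r^-1.
  by rewrite -powRrM; congr (_ `^ _); field; rewrite !gt_eqF//= mulr_gt0.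
have hK : h ^+ K * D `^ r^-1 = D.
  rewrite -powR_mulrn; last exact: ltW.
  rewrite -powRrM -powRD; last by apply/implyP => _; rewrite gt_eqF.
  rewrite -[RHS]powRr1; last exact: ltW.
  by congr (_ `^ _); rewrite rE; field; rewrite -rE gt_eqF.
exists h; split.
- by rewrite h0 h1.
- rewrite hg -[leLHS]hK; apply: ler_wpM2r; first exact: powR_ge0.
  by apply: ler_wiXn2l => //; exact: ltW.
- rewrite -[X in X / _]hK mulrAC divff ?mul1r; last by rewrite expf_neq0// gt_eqF.
  apply: ger_powR; first by rewrite D0 D1.
  by rewrite ler_pdivrMr// mulVf// gt_eqF.
- by rewrite -powRrM; congr (_ `^ _); field; rewrite !gt_eqF//= mulr_gt0.
Qed.

(** * The Kolmogorov bound *)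

Lemma pr_dist_le1 (d : measure_display) (T : measurableType d) (R : realType)
    (P : probability T R) (A B : set T) : measurable A -> measurable B ->
  `|pr P A - pr P B| <= 1.
Proof.
move=> mA mB; have := pr_ge0 P A; have := pr_ge0 P B.
have := pr_le1 P mA; have := pr_le1 P mB.
by move=> ? ? ? ?; rewrite ler_norml; apply/andP; split; lra.
Qed.

Theorem theorem3p5 (R : realType) (dstar kstar N : nat) (lam : R)
  (M : R -> R) (k : nat) (theta : R) :
  (0 < dstar)%N -> (0 < kstar)%N -> (0 < N)%N ->
  0 < lam <= 1 ->
  (1 + k%:R) ^- 2 < theta < 1 ->
  exists C : R, 0 < C /\
  forall (d : measure_display) (T : measurableType d) (P : probability T R)
    (X Y : nat -> 'I_dstar -> T -> R)
    (c c' : seq (nat * 'I_(dstar * kstar)) -> R),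
    random_vectors X -> random_vectors Y ->
    independent_seq P X -> independent_seq P Y ->
    (forall p : R, 1 <= p -> forall n (i : 'I_(dstar * kstar)),
        ('N[P]_(p%:E)[EFin \o Zc P X n i] <= (M p)%:E)%E /\
        ('N[P]_(p%:E)[EFin \o Zc P Y n i] <= (M p)%:E)%E) ->
    (forall n, loewner_ge (covZ P kstar X n) lam%:M /\
               loewner_ge (covZ P kstar Y n) lam%:M) ->
    finitely_supported c -> finitely_supported c' ->
    vanish_above N c -> vanish_above N c' ->
    0 < cnorm_deg N c -> 0 < cnorm_deg N c' ->
    delta_star c <= 1 -> delta_star c' <= 1 ->
    dKol P (Q P N c X) (Q P N c' Y) <=
      C * (1 + cnorm_deg N c ^- (2 * N) + cnorm_deg N c' ^- (2 * N))
        * (1 + cnorm N c + cnorm N c') ^+ (5 * maxn k 3 + 1)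
        * (delta_star c `^ (theta / (2 * maxn k 3 * N + 1)%:R)
           + delta_star c' `^ (theta / (2 * maxn k 3 * N + 1)%:R)
           + dk P (maxn k 3) (Q P N c X) (Q P N c' Y)
               `^ (theta / (2 * maxn k 3 * N + 1)%:R)).
Proof.
move=> dstar0 _ N0 lam01 /andP[thk th1].
have th0 : 0 < theta.
  by apply: le_lt_trans thk; rewrite invr_ge0 exprn_ge0// addr_ge0.
have th01 : 0 < theta < 1 by rewrite th0.
set K := maxn k 3; have K3 : (3 <= K)%N by exact: leq_maxr.
have K5 : (2 <= 5 * K + 1)%N by lia.
have [C [C0 HC]] := @chaos_anticoncentration R dstar kstar N lam (M 4) theta dstar0 N0 lam01 th01.
pose CK : R := 2 ^+ K * K.+1%:R ^+ K.
have CK0 : 0 <= CK by rewrite mulr_ge0// exprn_ge0.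
(* [C] pays for anticoncentration, [CK] for smoothing, and 1 ensures that the bound is at least 1
   when [D] is. *)
exists (C + CK + 1); split; first by lra.
move=> d T P X Y c c' mX mY _ iY YM hcov fc fc' vc vc' a0 a0' _ _.
set F := Q P N c X; set G := Q P N c' Y; set e := theta / _.
have e0 : 0 <= e by rewrite divr_ge0// ltW.
have [L sc] := finitely_supported_lt fc; have [L' sc'] := finitely_supported_lt fc'.
have mF : measurable_fun setT F by exact: measurable_Q sc vc.
have mG : measurable_fun setT G by exact: measurable_Q sc' vc'.
have d0 : 0 < delta_star c' by exact: (delta_star_gt0 sc' N0 a0').
have dk0 := dk_ge0 P mF mG K.
set A := 1 + _ + _; set b := cnorm N c; set b' := cnorm N c'.
pose S := delta_star c `^ e + delta_star c' `^ e + dk P K F G `^ e.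
rewrite -/S.
have b_ge0 : 0 <= b by exact: sqrtr_ge0.
have b'_ge0 : 0 <= b' by exact: sqrtr_ge0.
have ia : 0 <= cnorm_deg N c ^- (2 * N) by rewrite invr_ge0 exprn_ge0// ltW.
have ia' : 0 <= cnorm_deg N c' ^- (2 * N) by rewrite invr_ge0 exprn_ge0// ltW.
have A1 : 1 <= A by rewrite /A -addrA lerDl addr_ge0.
have AA : 1 + cnorm_deg N c' ^- (2 * N) <= A by rewrite /A lerD2r lerDl.
pose B := (1 + b + b') ^+ (5 * K + 1).
have b1 : 1 + b' <= 1 + b + b' by rewrite lerD2r lerDl.
have b1' : 1 <= 1 + b + b' by rewrite -addrA lerDl addr_ge0.
have B2 : (1 + b') ^+ 2 <= B.
  apply: (le_trans (y := (1 + b + b') ^+ 2)); last exact: ler_weXn2l.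
  by apply: lerXn2r => //; rewrite nnegrE ?addr_ge0.
have B1 : 1 <= B by exact: exprn_ege1.
(* One parameter for both error sources: dominating [delta_star c'] permits anticoncentration of [G]
   at the chosen scale, dominating [dk] controls the smoothing term. *)
pose D := Num.max (delta_star c') (dk P K F G).
have D0 : 0 < D by rewrite lt_max d0.
have DS : D `^ e <= S.
  rewrite /D /S /Num.max; case: ifP => _; last by rewrite addrAC lerDr addr_ge0 ?powR_ge0.
  by rewrite lerDr addr_ge0 ?powR_ge0.
have S0 : 0 <= S := le_trans (powR_ge0 _ _) DS.
have mle (U : T -> R) y : measurable_fun setT U -> measurable [set w | U w <= y].
  by move=> mU; exact: measurable_le_set.
apply: ge_sup; first by eexists; exists 0.
move=> _ [x _ <-]; rewrite -/(pr P [set w | F w <= x]) -/(pr P [set w | G w <= x]) -/B.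
have [D1|D1] := leP 1 D.
  apply: (le_trans (y := 1)).
    by apply: pr_dist_le1; exact: mle.
  have S1 : 1 <= S.
    by apply: le_trans DS; rewrite -(powRr0 D); apply: ler_powR.
  have C1 : 1 <= C + CK + 1 by rewrite lerDr addr_ge0// ltW.
  by do 3!(apply: mulr_ege1 => //).
have [||h [/andP[h0 h1] hD hK he]] := @smoothing_scale R N K D theta N0 K3.
- by rewrite D0 ltW.
- exact: ltW.
have h01 : 0 < h <= 1 by rewrite h0.
have dD : delta_star c' <= D by rewrite le_max lexx.
have kD : dk P K F G <= D by rewrite le_max lexx orbT.
have YM4 n (i : 'I_(dstar * kstar)) : ('N[P]_(4%:E)[EFin \o Zc P Y n i] <= (M 4)%:E)%E.
  by have [] := YM 4 (ler1n _ 4) n i.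
have hp := HC _ _ P Y c' D h x mY iY YM4 (fun n => proj2 (hcov n)) fc' vc' a0' D0 dD h01 hD.
apply: (le_trans (Kolmogorov_smoothing mF mG K h01 hp)); rewrite he.
have t1 : C * (1 + cnorm_deg N c' ^- (2 * N)) * (1 + b') ^+ 2 * D `^ e <= C * A * B * S.
  apply: ler_pM => //; first by do 2?apply: mulr_ge0; rewrite ?sqr_ge0 ?addr_ge0// ltW.
    exact: powR_ge0.
  apply: ler_pM => //; first by rewrite mulr_ge0 ?addr_ge0// ltW.
    exact: sqr_ge0.
  by apply: ler_wpM2l => //; exact: ltW.
have t2 : 2 ^+ K * (K.+1%:R / h) ^+ K * dk P K F G <= CK * A * B * S.
  apply: (le_trans (y := CK * D `^ e)).
    rewrite expr_div_n mulrA -/CK -mulrA; apply: ler_wpM2l => //.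
    apply: le_trans hK; rewrite mulrC; apply: ler_wpM2r => //.
    by rewrite invr_ge0 exprn_ge0// ltW.
  rewrite -(mulrA CK A B) -(mulrA CK); apply: ler_wpM2l => //; apply: (le_trans DS).
  by rewrite ler_peMl// mulr_ege1.
have t3 : 0 <= A * B * S by rewrite !mulr_ge0// (le_trans ler01).
have -> : (C + CK + 1) * A * B * S = C * A * B * S + CK * A * B * S + A * B * S by ring.
by rewrite -[leLHS]addr0; do 2?[apply: lerD => //].
Qed.
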